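(* Let $\alpha\in(0,1)$, let $s\ge1$ be an integer, and let $A\in\mathbb{R}^{s\times s}$ satisfy $\sigma(A)\subset\Lambda_\alpha^s$. Let $Q:[0,\infty)\to\mathbb{R}^{s\times s}$ be continuous with $$\lim_{t\to\infty}|||Q(t)|||=0,$$ and let $g:[0,\infty)\to\mathbb{R}^s$ be continuous with $$\sup_{t\ge0}\;t^{1-\alpha}\int_0^t(t-\tau)^{\alpha-1}\,\|E_{\alpha,\alpha}((t-\tau)^{\alpha}A)\,g(\tau)\|\,d\tau<\infty.$$ For $x_0\in\mathbb{R}^s$ let $\varphi(\cdot,x_0)$ denote the unique solution in $C_{1-\alpha}([0,\infty),\mathbb{R}^s)$ of $$D_{0+}^{\alpha}x(t)=Ax(t)+Q(t)x(t)+g(t),\quad t>0,\qquad \lim_{t\to0^+}t^{1-\alpha}x(t)=x_0.$$ Then $\varphi(\cdot,x_0)\in C_{1-\alpha}^0([0,\infty),\mathbb{R}^s)$ for every $x_0\in\mathbb{R}^s$. In particular, the equation is globally attractive, i.e. $\lim_{t\to\infty}\varphi(t,x_0)=0$ for every $x_0\in\mathbb{R}^s$.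
   Context: $\|\cdot\|$ is an arbitrary norm on $\mathbb{R}^s$ and $|||\cdot|||$ is the matrix norm on $\mathbb{R}^{s\times s}$ induced by it. $\sigma(A)$ is the set of (complex) eigenvalues of $A$, and $\Lambda_\alpha^s:=\{\lambda\in\mathbb{C}\setminus\{0\}:|\arg(\lambda)|>\frac{\alpha\pi}{2}\}$ with $\arg$ the principal argument in $(-\pi,\pi]$ (the superscript $s$ here is part of the notation). The Mittag-Leffler function is $E_{\alpha,\beta}(M):=\sum_{k=0}^\infty\frac{M^k}{\Gamma(\alpha k+\beta)}$ for a square matrix $M$. The Riemann--Liouville fractional integral of order $\beta>0$ is $I_{0+}^{\beta}x(t):=\frac{1}{\Gamma(\beta)}\int_0^t(t-\tau)^{\beta-1}x(\tau)\,d\tau$, and the Riemann--Liouville fractional derivative of order $\alpha\in(0,1)$ is $D_{0+}^{\alpha}x(t):=\frac{d}{dt}I_{0+}^{1-\alpha}x(t)$. $C_{1-\alpha}([0,\infty),\mathbb{R}^s)$ is the set of all continuous functions $x:(0,\infty)\to\mathbb{R}^s$ such that $\lim_{t\to0^+}t^{1-\alpha}x(t)$ exists, and $C_{1-\alpha}^0([0,\infty),\mathbb{R}^s)$ is the subset of those with $\sup_{t}t^{1-\alpha}\|x(t)\|<\infty$. Suprema over $t\ge0$ of expressions defined only for $t>0$ are taken over $t>0$. For continuous $Q$ and $g$, the stated initial value problem has exactly one solution in $C_{1-\alpha}([0,\infty),\mathbb{R}^s)$ for each $x_0$ (a known fact that may be used). *)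

(* Defs.v *)
From HB Require Import structures.
From mathcomp Require Import all_boot all_order all_algebra.
From mathcomp Require Import complex.
From mathcomp Require Import all_classical all_reals all_analysis.

Set Implicit Arguments.
Unset Strict Implicit.
Unset Printing Implicit Defensive.

Import Order.TTheory GRing.Theory Num.Theory.
Import numFieldNormedType.Exports.

Local Open Scope classical_set_scope.
Local Open Scope ring_scope.

(* Vectors are columns.  Limits, continuity and derivatives of vector- and
   matrix-valued functions refer to the library's (entrywise) topology, which
   is the topology of every norm. *)

Record is_norm (R : realType) (s : nat) (N : 'cV[R]_s -> R) : Prop := IsNorm {
  is_norm_eq0 : forall x, N x = 0 -> x = 0 ;
  is_normZ : forall (c : R) x, N (c *: x) = `|c| * N x ;
  is_normD : forall x y, N (x + y) <= N x + N y }.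

(* For s = 0 the index set is empty and [sup] is 0. *)
Definition induced_norm (R : realType) (s : nat) (N : 'cV[R]_s -> R)
    (M : 'M[R]_s) : R :=
  sup [set N (M *m x) | x in [set x | N x = 1]].

Definition spectrum (R : realType) (s : nat) (A : 'M[R]_s) : set R[i] :=
  [set l | eigenvalue (map_mx (real_complex R) A) l].

(* Principal argument, in ]-pi, pi]; see [argP].  Meaningful for z != 0. *)
Definition arg (R : realType) (z : R[i]) : R :=
  let theta := acos (complex.Re z / Normc.normc z) in
  if 0 <= complex.Im z then theta else - theta.

Lemma argP (R : realType) (z : R[i]) : z != 0 ->
  - pi < arg z <= pi /\
  z = Complex (Normc.normc z * cos (arg z)) (Normc.normc z * sin (arg z)).
Proof.
case: z => a b z0.
have n0 : 0 < a ^+ 2 + b ^+ 2.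
  rewrite lt_neqAle addr_ge0 ?sqr_ge0// andbT eq_sym paddr_eq0 ?sqr_ge0//.
  by rewrite !sqrf_eq0; move: z0; rewrite eq_complex /=.
rewrite /arg /=; set n := Num.sqrt _.
have n_gt0 : 0 < n by rewrite sqrtr_gt0.
have n2 : n ^+ 2 = a ^+ 2 + b ^+ 2 by rewrite sqr_sqrtr// ltW.
have sinE : 1 - (a / n) ^+ 2 = (b / n) ^+ 2.
  rewrite !expr_div_n n2 -[X in X - _](divff (lt0r_neq0 n0)) -mulrBl.
  by rewrite [_ + b ^+ 2]addrC addrK.
have cB : -1 <= a / n <= 1.
  rewrite -ler_norml -(@ler_pXn2r _ 2) ?nnegrE// expr1n real_normK ?num_real//.
  by rewrite -subr_ge0 sinE sqr_ge0.
have nK c : n * (c / n) = c by rewrite mulrCA divff ?gt_eqF// mulr1.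
have [t0 tpi] := (acos_ge0 cB, acos_lepi cB).
have cosE : cos (acos (a / n)) = a / n by rewrite acosK// in_itv.
have sE : sin (acos (a / n)) = `|b / n| by rewrite sin_acos// sinE sqrtr_sqr.
have [b0|b0] := leP 0 b.
  split; first by rewrite tpi andbT (lt_le_trans _ t0)// oppr_lt0 pi_gt0.
  by rewrite cosE sE ger0_norm ?divr_ge0 ?(ltW n_gt0)// !nK.
split.
  rewrite (le_trans _ (pi_ge0 R)) ?oppr_le0// andbT ltrN2.
  rewrite acos_ltpi//; move: cB => /andP[c1 ->]; rewrite andbT lt_neqAle c1 andbT.
  apply/eqP => aE; move: sinE; rewrite -aE sqrrN expr1n subrr => /esym/eqP.
  by rewrite sqrf_eq0 mulf_eq0 invr_eq0 (lt_eqF b0) (gt_eqF n_gt0).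
rewrite cosN sinN cosE sE ltr0_norm ?opprK ?nK//.
by rewrite pmulr_llt0 ?invr_gt0.
Qed.

Definition Lambda (R : realType) (alpha : R) : set R[i] :=
  [set l | l != 0 /\ alpha * pi / 2 < `|arg l|].

(* Euler's integral; the integral converges for x > 0. *)
Definition Gamma (R : realType) (x : R) : R :=
  \int[lebesgue_measure]_(t in `]0, +oo[) (t `^ (x - 1) * expR (- t)).

Definition mittag_leffler (R : realType) (s : nat) (alpha beta : R)
    (M : 'M[R]_s) : 'M[R]_s :=
  limn (series (fun k => (Gamma (alpha * k%:R + beta))^-1 *: M ^+ k)).

(* The integrands below are only meaningful on ]0, t[; whatever values they
   take at the endpoints, these form a null set. *)
Definition RL_integral (R : realType) (s : nat) (beta : R) (x : R -> 'cV[R]_s)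
    (t : R) : 'cV[R]_s :=
  \col_i ((Gamma beta)^-1 *
    \int[lebesgue_measure]_(tau in `[0, t])
      ((t - tau) `^ (beta - 1) * x tau i 0)).

Definition RL_derivable (R : realType) (s : nat) (alpha : R)
    (x : R -> 'cV[R]_s) (t : R) : Prop :=
  derivable (RL_integral (1 - alpha) x) t 1.

Definition RL_derivative (R : realType) (s : nat) (alpha : R)
    (x : R -> 'cV[R]_s) (t : R) : 'cV[R]_s :=
  derive1 (RL_integral (1 - alpha) x) t.

(* The spaces C_{1-alpha} and C_{1-alpha}^0 of functions on ]0, +oo[, encoded as
   total functions whose values outside ]0, +oo[ are irrelevant. *)
Definition C_weighted (R : realType) (s : nat) (alpha : R) :
    set (R -> 'cV[R]_s) :=
  [set x : R -> 'cV[R]_s | {in `]0, +oo[, continuous x} /\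
           exists l : 'cV[R]_s, t `^ (1 - alpha) *: x t @[t --> 0^'+] --> l].
Arguments C_weighted {R} s alpha.

Definition C0_weighted (R : realType) (s : nat) (N : 'cV[R]_s -> R)
    (alpha : R) : set (R -> 'cV[R]_s) :=
  [set x | C_weighted s alpha x /\
    (ereal_sup [set (t `^ (1 - alpha) * N (x t))%:E | t in `]0%R, +oo[]
      < +oo)%E].

Definition IVP_solution (R : realType) (s : nat) (alpha : R) (A : 'M[R]_s)
    (Q : R -> 'M[R]_s) (g : R -> 'cV[R]_s) (x0 : 'cV[R]_s)
    (x : R -> 'cV[R]_s) : Prop :=
  [/\ C_weighted s alpha x,
      forall t, 0 < t -> RL_derivable alpha x t /\
        RL_derivative alpha x t = A *m x t + Q t *m x t + g t
    & t `^ (1 - alpha) *: x t @[t --> 0^'+] --> x0].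

(* Main.v *)
(** Write K(t) = t^(alpha-1) E_{alpha,alpha}(t^alpha A).  Convolving the
    integrated equation with K gives the variation of constants formula
    x = Gamma(alpha) K x0 + K * (Q x + g).

    The spectral condition is used only to show that K is integrable.  For a
    scalar l in the open left half plane this is a perturbation of the
    relaxation kernel t^(alpha-1) E_{alpha,alpha}(-c t^alpha), which is
    positive with integral at most 1/c.  For a general l in Lambda alpha, take
    p large: 1/(z^p - l) splits over the p-th roots w of l, and each w has a
    power w^q of negative real part with q alpha/p <= 1.  Integrability
    survives the solution of a recurrence c(n+1) = l c(n) + d(n), so
    Cayley-Hamilton carries it over to the entries of the sequence A^n.

    Since t K(t) = alpha (E_alpha(t^alpha A) * K)(t) is bounded, integrability
    also gives that t^(1-alpha) (|K| * s^(alpha-1))(t) is bounded.  As Q tends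
    to 0, a bound m for t^(1-alpha) |x(t)| on ]0,T[ then improves to B + m/2
    with B independent of T and m, so that 2B is a bound. *)

Require Import Defs.
From HB Require Import structures.
From mathcomp Require Import all_boot all_order all_algebra.
From mathcomp Require Import complex.
From mathcomp Require Import all_classical all_reals all_analysis.
From mathcomp Require Import measurable_realfun.
From mathcomp Require Import ring lra.

Set Implicit Arguments.
Unset Strict Implicit.
Unset Printing Implicit Defensive.

Import Order.TTheory GRing.Theory Num.Theory.
Import numFieldNormedType.Exports.

Local Open Scope classical_set_scope.
Local Open Scope ring_scope.

(** A coefficient sequence stands in for a Laplace transform: [mlker ga be c] is linear in [c],
    convolution is the Cauchy product, multiplication by t weights the k-th coefficient by ga k +
    be, and splitting the indices modulo q turns the order ga into q ga. The algebra is therefore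
    done on sequences, with real integrals only and without asymptotic expansions.

    Re mu < 0 is exactly what makes |mu + c| < c for some c > 0; with the bound 1 / c on the
    relaxation kernel, replacing -c by mu is then a contraction with factor |mu + c| / c. Splitting
    modulo q also produces exponents be = ga (j + 1) below the order q ga; the relaxation kernels
    with these exponents must be integrable too, and their sign is not controlled.

    The two sides of the variation of constants formula are identified only after one more
    integration, because the convolutions are known to be measurable, not continuous. Pointwise
    bounds for x are then recovered from its continuity by averaging over short intervals. *)

(** * Affine changes of variable in Lebesgue integrals *)

Section lebesgue_affine.
Context {R : realType}.
Local Notation mu := (@lebesgue_measure R).
Implicit Types f : R -> \bar R.

(** Both sides integrate [f] against measures that agree on half-open intervals, and this determines
    Lebesgue measure. *)
Lemma ge0_integral_translation f (b : R) : measurable_fun setT f ->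
  (forall x, 0 <= f x)%E ->
  (\int[mu]_x f (x + b)%R = \int[mu]_x f x)%E.
Proof.
move=> mf f0.
have mphi : measurable_fun [set: R] (fun x : R => x + b).
  by apply: measurable_funD.
pose phi : R -> measurableTypeR R := fun x => x + b.
transitivity (\int[pushforward mu phi]_x f x)%E.
  by rewrite ge0_integral_pushforward.
apply: eq_measure_integral => A mA _.
apply/esym/lebesgue_measure_unique => //= _ [[x y] _ <-].
rewrite /pushforward /= (_ : _ @^-1` _ = `]x - b, y - b]%classic); last first.
  by apply/seteqP; split => t /=; rewrite !in_itv/= ltrBlDr lerBrDr.
rewrite !lebesgue_measure_itv /= !lte_fin ltrD2r.
by case: ifPn => // _; rewrite -!EFinB; congr (_%:E); ring.
Qed.

Lemma ge0_integral_scaling f (a : R) : 0 < a -> measurable_fun setT f ->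
  (forall x, 0 <= f x)%E ->
  (a%:E * \int[mu]_x f (a * x)%R = \int[mu]_x f x)%E.
Proof.
move=> a0 mf f0.
have mphi : measurable_fun [set: R] (fun x : R => a * x).
  exact: mulrl_measurable.
pose phi : R -> measurableTypeR R := fun x => a * x.
pose c := NngNum (ltW a0).
have mphi' : measurable_fun setT phi by [].
pose m := measure_function_pushforward__canonical__measure_function_Measure mu mphi'.
transitivity (\int[mscale c m]_x f x)%E.
  by rewrite ge0_integral_mscale// ge0_integral_pushforward.
apply: eq_measure_integral => A mA _.
apply/esym/lebesgue_measure_unique => //= _ [[x y] _ <-].
rewrite /mscale /=; rewrite /pushforward.
rewrite (_ : _ @^-1` _ = `]x / a, y / a]%classic); last first.
  by apply/seteqP; split => t /=;
    rewrite !in_itv/= /phi ltr_pdivrMr// ler_pdivlMr// mulrC.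
rewrite !lebesgue_measure_itv /= !lte_fin ltr_pM2r ?invr_gt0//.
case: ifPn => _; last by rewrite mule0.
by rewrite -!EFinB -EFinM; congr (_%:E); field; rewrite gt_eqF.
Qed.

Lemma ge0_integral_opp f : measurable_fun setT f ->
  (forall x, 0 <= f x)%E ->
  (\int[mu]_x f (- x)%R = \int[mu]_x f x)%E.
Proof.
move=> mf f0.
have mphi : measurable_fun [set: R] (@GRing.opp R) by apply: measurable_funN.
pose phi : R -> measurableTypeR R := @GRing.opp R.
transitivity (\int[pushforward mu phi]_x f x)%E.
  by rewrite ge0_integral_pushforward.
by apply: eq_measure_integral => A mA _; exact: lebesgue_measureN.
Qed.

Lemma integral_translation f (b : R) : measurable_fun setT f ->
  (\int[mu]_x f (x + b)%R = \int[mu]_x f x)%E.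
Proof.
move=> mf; rewrite [LHS]integralE [RHS]integralE; congr (_ - _)%E.
  rewrite -(ge0_integral_translation b (measurable_funepos mf))//.
  by apply: eq_integral => x _; rewrite !funeposE.
rewrite -(ge0_integral_translation b (measurable_funeneg mf))//.
by apply: eq_integral => x _; rewrite !funenegE.
Qed.

Lemma integral_opp f : measurable_fun setT f ->
  (\int[mu]_x f (- x)%R = \int[mu]_x f x)%E.
Proof.
move=> mf; rewrite [LHS]integralE [RHS]integralE; congr (_ - _)%E.
  rewrite -(ge0_integral_opp (measurable_funepos mf))//.
  by apply: eq_integral => x _; rewrite !funeposE.
rewrite -(ge0_integral_opp (measurable_funeneg mf))//.
by apply: eq_integral => x _; rewrite !funenegE.
Qed.

Lemma integral_reflection f (t : R) : measurable_fun setT f ->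
  (\int[mu]_x f (t - x)%R = \int[mu]_x f x)%E.
Proof.
move=> mf.
have mft : measurable_fun setT (fun x : R => f (x + t)%R).
  by apply: measurableT_comp => //; exact: measurable_funD.
rewrite -(integral_translation t mf) -(integral_opp mft).
by apply: eq_integral => x _; rewrite addrC.
Qed.

Lemma measurable_integral_snd (h : R * R -> \bar R) : measurable_fun setT h ->
  measurable_fun setT (fun x => \int[mu]_y h (x, y))%E.
Proof.
move=> mh.
rewrite (_ : (fun _ => _) = (fun x =>
  (\int[mu]_y (funepos h) (x, y)) - (\int[mu]_y (funeneg h) (x, y)))%E).
  apply: emeasurable_funB.
    by apply: (@measurable_fun_fubini_tonelli_F _ _ _ _ _ mu (funepos h)) => //;
      exact: measurable_funepos.
  by apply: (@measurable_fun_fubini_tonelli_F _ _ _ _ _ mu (funeneg h)) => //;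
    exact: measurable_funeneg.
apply/funext => x; rewrite [LHS]integralE; congr (_ - _)%E.
  by apply: eq_integral => y _; rewrite !funeposE.
by apply: eq_integral => y _; rewrite !funenegE.
Qed.

End lebesgue_affine.

(** * Integrals and smallness of real powers *)

Section power_integrals.
Context {R : realType}.
Local Notation mu := (@lebesgue_measure R).

Lemma gt0_powRD (x r s : R) : 0 < x -> x `^ (r + s) = x `^ r * x `^ s.
Proof. by move=> x0; rewrite powRD ?(gt_eqF x0) ?implybT. Qed.

Lemma gt0_powRB1 (x r : R) : 0 < x -> x `^ (r - 1) = x `^ r / x.
Proof. by move=> x0; rewrite powRB ?(gt_eqF x0) ?implybT// powRr1// ltW. Qed.

Lemma le0_ler_powR (x y r : R) : 0 < x -> x <= y -> r <= 0 -> y `^ r <= x `^ r.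
Proof.
move=> x0 xy r0; have y0 := lt_le_trans x0 xy.
rewrite -[r]opprK ![_ `^ (- - r)]powRN lef_pV2 ?posrE ?powR_gt0//.
by apply: ge0_ler_powR; rewrite ?nnegrE ?oppr_ge0 ?(ltW x0) ?(ltW y0).
Qed.

Lemma continuous_powR_gt0 (a x : R) : 0 < x -> {for x, continuous (@powR R ^~ a)}.
Proof.
move=> x0; apply: differentiable_continuous; apply/derivable1_diffP.
by apply: derivable_powR; rewrite in_itv/= andbT.
Qed.

(** The exponent [a] may be negative; with [a = - b] this is the integral of the tail majorant in
    [inL1_powR]. *)
Lemma integral_powR_cc (a e t : R) : a != 0 -> 0 < e -> e < t ->
  (\int[mu]_(s in `[e, t]) (s `^ (a - 1))%:E
    = (t `^ a / a)%:E - (e `^ a / a)%:E)%E.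
Proof.
move=> a0 e0 et.
have t0 : 0 < t by rewrite (lt_trans e0).
have cP (b x : R) : 0 < x -> {for x, continuous (fun y : R => y `^ b / a)}.
  by move=> x0; apply: cvgM; [exact: continuous_powR_gt0|exact: cvg_cst].
apply: (@continuous_FTC2 R _ (fun x => x `^ a / a)) => //.
- apply: continuous_in_subspaceT => x /set_mem /=; rewrite in_itv/= => /andP[ex _].
  by apply: continuous_powR_gt0; rewrite (lt_le_trans e0).
- split.
  + move=> x; rewrite in_itv/= => /andP[ex _].
    apply: derivableM; last exact: derivable_cst.
    by apply: derivable_powR; rewrite in_itv/= andbT (lt_trans e0).
  + by apply: cvg_at_right_filter; apply: cP.
  + by apply: cvg_at_left_filter; apply: cP.
- move=> x; rewrite in_itv/= => /andP[ex _].
  have x0 : 0 < x by rewrite (lt_trans e0).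
  rewrite derive1E deriveMr; last by apply: derivable_powR; rewrite in_itv/= andbT.
  rewrite -derive1E powR_derive1 ?in_itv/= ?andbT//.
  by field.
Qed.

(** For a < 1 the integrand blows up at 0, so the fundamental theorem is applied on compact
    intervals exhausting ]0, t] and monotone convergence finishes. *)
Lemma ge0_integral_powR (a t : R) : 0 < a -> 0 < t ->
  (\int[mu]_(s in `]0%R, t[) (s `^ (a - 1))%:E = (t `^ a / a)%:E)%E.
Proof.
move=> a0 t0.
have mp D : measurable_fun D (fun s : R => (s `^ (a - 1))%:E).
  by apply/measurable_EFinP; exact: (measurable_funS _ (@subsetT _ _)).
(* The shift by 2 keeps [e n < t] already for n = 0. *)
pose e (n : nat) : R := t * n.+2%:R^-1.
have e0 n : 0 < e n by rewrite mulr_gt0.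
have et n : e n < t by rewrite gtr_pMr// invf_lt1// ltr1n.
rewrite integral_itv_bndo_bndc; last exact/measurable_EFinP/(measurable_funS _ (@subsetT _ _)).
have -> : `]0, t]%classic = \bigcup_n `[e n, t]%classic.
  apply/seteqP; split => [x|x [n _]]; rewrite /= !in_itv/=.
    move=> /andP[x0 xt]; exists (Num.truncn (t / x)) => //=; rewrite in_itv/= xt andbT.
    rewrite /e ler_pdivrMr// mulrC -ler_pdivrMr//.
    have : t / x < (Num.truncn (t / x)).+1%:R by rewrite truncnS_gt.
    by move=> /ltW /le_trans; apply; rewrite ler_nat.
  by move=> /andP[ex ->]; rewrite andbT (lt_le_trans (e0 n)).
have nd : nondecreasing_seq (fun n => `[e n, t]%classic).
  move=> m n mn; apply/subsetPset => x /=; rewrite !in_itv/= => /andP[ex ->].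
  rewrite andbT (le_trans _ ex)// ler_pM2l// lef_pV2 ?posrE// ler_nat.
  by rewrite !ltnS.
have /cvg_lim <- // : ((\int[mu]_(s in `[e n, t]) (s `^ (a - 1))%:E)%E
    @[n --> \oo] --> (\int[mu]_(s in \bigcup_n `[e n, t]%classic) (s `^ (a - 1))%:E)%E).
  apply: ge0_nondecreasing_set_cvg_integral => // [i|i x _]; first exact: mp.
  by rewrite lee_fin powR_ge0.
apply/cvg_lim => //; under eq_fun do rewrite (integral_powR_cc (lt0r_neq0 a0))// -EFinB.
apply: cvg_EFin; first by near=> n.
rewrite -[X in _ --> X]subr0; apply: cvgB; first exact: cvg_cst.
rewrite -(mul0r a^-1); apply: cvgM; last exact: cvg_cst.
have /cvg_at_rightP := powR_cvg0 a0; apply; split; first exact: e0.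
rewrite -(mulr0 t); apply: cvgM; first exact: cvg_cst.
have := @cvg_harmonic R; by rewrite -cvg_shiftS.
Unshelve. all: by end_near. Qed.

Lemma powR_small (e p : R) : 0 < e -> 0 < p ->
  exists2 d : R, 0 < d & forall t, 0 < t <= d -> t `^ p < e.
Proof.
move=> e0 p0; exists ((e / 2) `^ p^-1); first by rewrite powR_gt0 ?divr_gt0.
move=> t /andP[t0 td]; apply: (@le_lt_trans _ _ (e / 2)); last by lra.
have := @ge0_ler_powR _ p (ltW p0) t ((e / 2) `^ p^-1).
rewrite !nnegrE (ltW t0) powR_ge0 -powRrM mulVf ?gt_eqF// powRr1 ?divr_ge0 ?(ltW e0)//.
by move=> /(_ isT isT td).
Qed.

End power_integrals.

(** * Gamma and beta functions *)

Section Gamma_function.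
Context {R : realType}.
Local Notation mu := (@lebesgue_measure R).
Implicit Types (a b s t M : R).

(** Extension by zero turns integrals over ]0, t[ into integrals over the whole line, where
    translation, scaling and Tonelli apply without endpoint bookkeeping. *)
Definition pw a : R -> R := (fun t => t `^ (a - 1)) \_ `]0, +oo[%classic.

Lemma pwE a t : 0 < t -> pw a t = t `^ (a - 1).
Proof. by move=> t0; rewrite /pw patchE mem_set//= in_itv/= t0. Qed.

Lemma pw_le0 a t : t <= 0 -> pw a t = 0.
Proof.
by move=> t0; rewrite /pw patchE memNset//= in_itv/= andbT; apply/negP; rewrite -leNgt.
Qed.

Lemma pw_ge0 a t : 0 <= pw a t.
Proof.
by have [t0|t0] := leP t 0; [rewrite pw_le0|rewrite pwE// powR_ge0].
Qed.

Lemma pw_gt0 a t : 0 < t -> 0 < pw a t.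
Proof. by move=> t0; rewrite pwE// powR_gt0. Qed.

Lemma measurable_pw a : measurable_fun setT (pw a).
Proof.
apply/(measurable_restrictT _ _).1 => //.
exact: (measurable_funS _ (@subsetT _ _)).
Qed.
Hint Resolve measurable_pw : core.

Lemma pwM a t s : 0 < t -> pw a (t * s) = t `^ (a - 1) * pw a s.
Proof.
move=> t0; have [s0|s0] := leP s 0.
  by rewrite !pw_le0 ?mulr0// pmulr_rle0.
by rewrite !pwE ?mulr_gt0// powRM// ltW.
Qed.

(** Euler's beta integral scaled to ]0, t[, kept in the extended reals because its finiteness is
    only proved in [beta_lty]. *)
Let beta a b t := (\int[mu]_s (pw a (t - s) * pw b s)%:E)%E.

Let measurable_betal a b t : measurable_fun setT (fun s => pw a (t - s) * pw b s).
Proof.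
apply: measurable_funM => //; apply: measurableT_comp => //.
exact: measurable_funB.
Qed.

Let beta_ge0 a b t : (0 <= beta a b t)%E.
Proof. by apply: integral_ge0 => s _; rewrite lee_fin mulr_ge0 ?pw_ge0. Qed.

Let beta_scale a b t : 0 < t ->
  beta a b t = ((t `^ (a + b - 1))%:E * beta a b 1)%E.
Proof.
move=> t0; rewrite /beta -(ge0_integral_scaling t0); last 2 first.
- apply/measurable_EFinP; exact: measurable_betal.
- by move=> s; rewrite lee_fin mulr_ge0 ?pw_ge0.
rewrite -[LHS]ge0_integralZl_EFin; last 4 first.
- by [].
- by move=> s _; rewrite lee_fin mulr_ge0 ?pw_ge0.
- apply/measurable_EFinP; apply: measurable_funM.
    by apply: measurableT_comp => //; apply: measurable_funB => //; exact: mulrl_measurable.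
  by apply: measurableT_comp => //; exact: mulrl_measurable.
- exact: ltW.
rewrite -[RHS]ge0_integralZl_EFin; last 4 first.
- by [].
- by move=> s _; rewrite lee_fin mulr_ge0 ?pw_ge0.
- apply/measurable_EFinP; exact: measurable_betal.
- exact: powR_ge0.
apply: eq_integral => s _; rewrite -!EFinM; congr (_%:E).
rewrite -{2}[t]mulr1 -mulrBr !pwM//.
have -> : a + b - 1 = (a - 1) + (b - 1) + 1 by ring.
rewrite (gt0_powRD (a - 1 + (b - 1)) 1 t0) (gt0_powRD (a - 1) (b - 1) t0).
by rewrite powRr1 ?ltW//; ring.
Qed.

Let beta_le0 a b t : t <= 0 -> beta a b t = 0%E.
Proof.
move=> t0; rewrite /beta; apply: integral0_eq => s _.
have [s0|s0] := leP s 0; first by rewrite [pw b s]pw_le0 ?mulr0.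
by rewrite pw_le0 ?mul0r// subr_le0 (le_trans t0)// ltW.
Qed.

Let q a : R -> R := (fun t => t `^ (a - 1)) \_ `]0, 1[%classic.

Let q_ge0 a s : 0 <= q a s.
Proof. by rewrite /q patchE; case: ifPn => // _; rewrite powR_ge0. Qed.

Let measurable_q a : measurable_fun setT (q a).
Proof.
apply/(measurable_restrictT _ _).1 => //.
exact: (measurable_funS _ (@subsetT _ _)).
Qed.

Local Ltac meas_EFin := apply/measurable_EFinP;
  first [exact: measurable_betal | exact: measurable_q | done].

Let integral_q a : 0 < a -> (\int[mu]_s (q a s)%:E = (a^-1)%:E)%E.
Proof.
move=> a0; have := ge0_integral_powR a0 ltr01; rewrite powR1 mul1r => <-.
by rewrite [RHS]integral_mkcond; apply: eq_integral => s _; rewrite /q !patchE; case: ifP.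
Qed.

Let qE a s : 0 < s < 1 -> q a s = s `^ (a - 1).
Proof. by move=> s01; rewrite /q patchE mem_set//= in_itv. Qed.

(** On each half of ]0, 1[ one of the two factors is at most 2, so the integrand is dominated by
    twice the sum of the two separate powers. *)
Let beta_lty a b : 0 < a -> 0 < b -> (beta a b 1 < +oo)%E.
Proof.
move=> a0 b0.
have mq1 : measurable_fun setT (fun s => q a (1 - s)).
  by apply: measurableT_comp => //; exact: measurable_funB.
apply: (@le_lt_trans _ _ (\int[mu]_s (2 * (q a (1 - s) + q b s))%:E)%E).
  apply: ge0_le_integral => //.
  - by move=> s _; rewrite lee_fin mulr_ge0 ?pw_ge0.
  - meas_EFin.
  - apply/measurable_EFinP; apply: measurable_funM => //.
    exact: measurable_funD mq1 (measurable_q b).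
  move=> s _; rewrite lee_fin.
  have [s0|s0] := leP s 0.
    by rewrite [pw b s]pw_le0// mulr0 mulr_ge0// addr_ge0.
  have [s1|s1] := leP 1 s.
    by rewrite pw_le0 ?subr_le0// mul0r mulr_ge0// addr_ge0.
  have half (c x : R) : 0 < c -> 2^-1 <= x -> x < 1 -> x `^ (c - 1) <= 2.
    move=> c0 x2 x1; have x0 : 0 < x by rewrite (lt_le_trans _ x2).
    rewrite gt0_powRB1// ler_pdivrMr//.
    rewrite (@le_trans _ _ 1)//.
      by rewrite -(powRr0 x) ger_powR ?x0 ?ltW.
    by rewrite -(@ler_pM2l _ 2^-1)// mulrA mulVf// mul1r mulr1.
  have s1' : 0 < 1 - s < 1 by rewrite subr_gt0 s1 gtrBl s0.
  rewrite !pwE ?subr_gt0// !qE ?s0//.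
  have [s2|s2] := leP s 2^-1.
    rewrite (@le_trans _ _ (2 * s `^ (b - 1)))//.
      by rewrite ler_wpM2r ?powR_ge0// half//; lra.
    by rewrite ler_pM2l// lerDr powR_ge0.
  rewrite (@le_trans _ _ (2 * (1 - s) `^ (a - 1)))//.
    by rewrite mulrC ler_wpM2r ?powR_ge0// half//; lra.
  by rewrite ler_pM2l// lerDl powR_ge0.
under eq_integral do rewrite EFinM.
rewrite ge0_integralZl_EFin//; last 2 first.
- by move=> s _; rewrite lee_fin addr_ge0.
- apply/measurable_EFinP; exact: measurable_funD mq1 (measurable_q b).
under eq_integral do rewrite EFinD.
rewrite ge0_integralD//; last 4 first.
- by move=> s _; rewrite lee_fin.
- meas_EFin.
- by move=> s _; rewrite lee_fin.
- meas_EFin.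
rewrite (@integral_reflection _ (EFin \o q a))/=; last meas_EFin.
by rewrite !integral_q// -EFinD -EFinM ltry.
Qed.

Let eGamma a := (\int[mu]_t (pw a t * expR (- t))%:E)%E.

Let measurable_expRN : measurable_fun setT (fun t => expR (- t) : R).
Proof. by apply: measurableT_comp => //; exact: measurable_funN. Qed.

Let eGamma_ge0 a : (0 <= eGamma a)%E.
Proof. by apply: integral_ge0 => t _; rewrite lee_fin mulr_ge0 ?pw_ge0 ?expR_ge0. Qed.

(** Tonelli for pw a (t - s) pw b s exp(-t): integrating in s first gives the scaled beta integral,
    a power of t; integrating in t first gives the product of the two Gamma integrals. *)
Let eGamma_mul a b : 0 < a -> 0 < b ->
  (eGamma a * eGamma b = beta a b 1 * eGamma (a + b))%E.
Proof.
move=> a0 b0.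
pose h (z : R * R) := (pw a (z.1 - z.2) * pw b z.2 * expR (- z.1))%:E.
have h0 z : (0 <= h z)%E by rewrite lee_fin !mulr_ge0 ?pw_ge0 ?expR_ge0.
have mh : measurable_fun setT h.
  apply/measurable_EFinP; apply: measurable_funM; first apply: measurable_funM.
  - by apply: measurableT_comp => //; exact: measurable_funB.
  - exact: measurableT_comp.
  - by apply: (@measurableT_comp _ _ _ _ _ _ (fun t => expR (- t))).
have := @fubini_tonelli _ _ _ _ _ mu mu h mh h0.
rewrite [X in X = _ -> _](_ : _ = (beta a b 1 * eGamma (a + b))%E); last first.
  rewrite -[RHS]ge0_integralZl//; last 2 first.
  - apply/measurable_EFinP; apply: measurable_funM; first exact: measurable_pw.
    exact: measurable_expRN.
  - by move=> t _; rewrite lee_fin mulr_ge0 ?pw_ge0 ?expR_ge0.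
  apply: eq_integral => t _; rewrite /h /=.
  under eq_integral do rewrite mulrC EFinM.
  rewrite ge0_integralZl_EFin ?expR_ge0//; last 2 first.
  - by move=> s _; rewrite lee_fin mulr_ge0 ?pw_ge0.
  - meas_EFin.
  rewrite -/(beta a b t); have [t0|t0] := leP t 0.
    by rewrite beta_le0// pw_le0// mul0r !mule0.
  by rewrite beta_scale// pwE// mulrC EFinM muleA [RHS]muleC.
move=> ->; rewrite -[LHS]ge0_integralZl//; last 2 first.
- by apply/measurable_EFinP; apply: measurable_funM; [exact: measurable_pw|exact: measurable_expRN].
- by move=> t _; rewrite lee_fin mulr_ge0 ?pw_ge0 ?expR_ge0.
apply: eq_integral => s _; rewrite /h /=.
rewrite muleC -[LHS]ge0_integralZl_EFin ?mulr_ge0 ?pw_ge0 ?expR_ge0//; last 2 first.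
- by move=> t _; rewrite lee_fin mulr_ge0 ?pw_ge0 ?expR_ge0.
- by apply/measurable_EFinP; apply: measurable_funM; [exact: measurable_pw|exact: measurable_expRN].
rewrite -(ge0_integral_translation (- s)); last 2 first.
- apply: measurable_funeM; apply/measurable_EFinP; exact: measurable_funM.
- by move=> t; rewrite -EFinM lee_fin !mulr_ge0 ?pw_ge0 ?expR_ge0.
apply: eq_integral => t _; rewrite -EFinM; congr (_%:E).
rewrite (_ : - t = - s + - (t - s)); last by ring.
by rewrite expRD; ring.
Qed.

Let eGamma1 : eGamma 1 = 1%E.
Proof.
rewrite -(@integral_exponential_pdf R _ ltr01) /exponential_pdf.
rewrite [RHS](_ : _ = \int[mu]_(x in `[0%R, +oo[) (expR (- x))%:E)%E; last first.
  rewrite [RHS]integral_mkcond; apply: eq_integral => x _.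
  by rewrite /= !patchE; case: ifP => //; rewrite mul1r mulN1r.
rewrite -integral_itv_obnd_cbnd; last exact/measurable_EFinP/measurable_funTS.
rewrite [RHS]integral_mkcond; apply: eq_integral => x _.
rewrite patchE; case: ifPn => [/set_mem|/negP xP].
  by rewrite /= in_itv/= andbT => x0; rewrite pwE// subrr powRr0 mul1r.
rewrite pw_le0 ?mul0r// leNgt; apply/negP => x0; apply: xP.
by rewrite inE/= in_itv/= x0.
Qed.

(** Only the integral over [M, M + 1] is kept; there the integrand is t^a e^(-t) / t and each factor
    is bounded below. As [M] is arbitrary, this is a growth estimate doing the work of Stirling's
    formula. *)
Let eGamma_bound M a : 0 < M -> 0 < a ->
  (((expR (- (M + 1)) / (M + 1)) * M `^ a)%:E <= eGamma a)%E.
Proof.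
move=> M0 a0.
have M10 : 0 < M + 1 by rewrite addr_gt0.
have -> : ((expR (- (M + 1)) / (M + 1)) * M `^ a)%:E =
    (\int[mu]_(x in `[M, (M + 1)%R]) (expR (- (M + 1)) / (M + 1) * M `^ a)%:E)%E.
  rewrite integral_cst//= lebesgue_measure_itv/= lte_fin ltrDl ltr01.
  by rewrite -EFinB addrAC subrr add0r mule1.
rewrite integral_mkcond; apply: ge0_le_integral => //.
- move=> x _; rewrite erestrict_ge0// => y _.
  by rewrite lee_fin !mulr_ge0 ?powR_ge0 ?expR_ge0 ?invr_ge0 ?ltW.
- by apply/(measurable_restrictT _ _).1.
- by apply/measurable_EFinP; apply: measurable_funM; [exact: measurable_pw|exact: measurable_expRN].
move=> x _; rewrite patchE; case: ifPn => [/set_mem|_]; last first.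
  by rewrite lee_fin mulr_ge0 ?pw_ge0 ?expR_ge0.
rewrite /= in_itv/= => /andP[Mx xM].
have x0 : 0 < x by rewrite (lt_le_trans M0).
rewrite lee_fin pwE// gt0_powRB1//.
rewrite [leRHS]mulrC [leRHS]mulrA mulrAC.
apply: ler_pM; rewrite ?mulr_ge0 ?powR_ge0 ?expR_ge0 ?invr_ge0 ?(ltW M10)//.
  apply: ler_pM; rewrite ?powR_ge0 ?expR_ge0//; first by rewrite ler_expR lerN2.
  by apply: ge0_ler_powR; rewrite ?nnegrE ?(ltW a0) ?(ltW M0) ?(ltW x0).
by rewrite lef_pV2 ?posrE.
Qed.

Let eGamma_gt0 a : 0 < a -> (0 < eGamma a)%E.
Proof.
move=> a0; apply: lt_le_trans (eGamma_bound ltr01 a0).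
by rewrite lte_fin !mulr_gt0 ?expR_gt0 ?powR_gt0// invr_gt0 addr_gt0.
Qed.

Let beta1 a : 0 < a -> beta a 1 1 = (a^-1)%:E.
Proof.
move=> a0; rewrite -(integral_q a0).
rewrite -(@integral_reflection _ (EFin \o q a) 1)/=; last meas_EFin.
apply: eq_integral => s _; congr (_%:E).
have [s0|s0] := leP s 0.
  rewrite [pw 1 s]pw_le0// mulr0 /q patchE memNset//= in_itv/= gtrBl.
  by rewrite (ltNge 0 s) s0 andbF.
rewrite [pw 1 s]pwE// subrr powRr0 mulr1; have [s1|s1] := leP 1 s.
  rewrite pw_le0 ?subr_le0// /q patchE memNset//= in_itv/= subr_gt0.
  by rewrite (ltNge s 1) s1.
by rewrite pwE ?subr_gt0// qE// subr_gt0 s1 gtrBl.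
Qed.

Let eGammaS a : 0 < a -> eGamma (a + 1) = (a%:E * eGamma a)%E.
Proof.
move=> a0; have := eGamma_mul a0 ltr01.
rewrite eGamma1 mule1 beta1// => ->.
by rewrite muleA -EFinM divff ?gt_eqF// mul1e.
Qed.

(** For b < 1 the product of the Gamma integrals at b and 1 - b is a finite beta integral and the
    second factor is positive, so the first is finite. The recursion [eGammaS] reaches larger
    arguments. *)
Let eGamma_lty a : 0 < a -> (eGamma a < +oo)%E.
Proof.
have lt1 b : 0 < b -> b < 1 -> (eGamma b < +oo)%E.
  move=> b0 b1; have b1' : 0 < 1 - b by rewrite subr_gt0.
  have := eGamma_mul b0 b1'; rewrite subrKC eGamma1 mule1.
  move: (beta_lty b0 b1') => /[swap] <-.
  case: (eGamma b) (eGamma_ge0 b) => //= [x _ _|_]; first exact: ltry.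
  by rewrite gt0_mulye ?eGamma_gt0.
move=> a0; have [n] : exists n : nat, a < n.+1%:R.
  by exists (Num.truncn a); rewrite truncnS_gt.
elim: n a a0 => [|n IH] a a0 an; first exact: lt1.
have [a1|a1] := ltP a 1; first exact: lt1.
have [->|a1'] := eqVneq a 1; first by rewrite eGamma1 ltry.
have a10 : 0 < a - 1 by rewrite subr_gt0 lt_neqAle eq_sym a1'.
rewrite -(subrK 1 a) eGammaS// lte_mul_pinfty ?lee_fin ?(ltW a10)//.
by apply: IH => //; rewrite ltrBlDr natr1.
Qed.

Let eGamma_Gamma a : 0 < a -> eGamma a = (Gamma a)%:E.
Proof.
move=> a0; rewrite /Gamma /Rintegral integral_mkcond.
rewrite (_ : (\int[mu]_x _)%E = eGamma a); last first.
  apply: eq_integral => t _; rewrite patchE /pw patchE.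
  by case: ifP => //; rewrite mul0r.
by rewrite fineK// ge0_fin_numE// eGamma_lty.
Qed.

Lemma Gamma_gt0 a : 0 < a -> 0 < Gamma a.
Proof. by move=> a0; rewrite -lte_fin -eGamma_Gamma// eGamma_gt0. Qed.

Lemma GammaS a : 0 < a -> Gamma (a + 1) = a * Gamma a.
Proof.
move=> a0; have := eGammaS a0.
by rewrite !eGamma_Gamma// ?addr_gt0// -EFinM => -[].
Qed.

Lemma Gamma1 : Gamma 1 = 1 :> R.
Proof. by have := eGamma1; rewrite eGamma_Gamma// => -[]. Qed.

(** 1 / Gamma decays faster than every geometric sequence, which is what makes the Mittag-Leffler
    series converge everywhere. *)
Lemma Gamma_growth M : 0 < M ->
  exists2 C, 0 < C & forall a, 0 < a -> (Gamma a)^-1 <= C * (M `^ a)^-1.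
Proof.
move=> M0; exists (expR (- (M + 1)) / (M + 1))^-1.
  by rewrite invr_gt0 divr_gt0 ?expR_gt0 ?addr_gt0.
move=> a a0; rewrite -invfM lef_pV2 ?posrE ?Gamma_gt0//; last first.
  by rewrite !mulr_gt0 ?powR_gt0 ?expR_gt0 ?invr_gt0 ?addr_gt0.
by rewrite -lee_fin -eGamma_Gamma// eGamma_bound.
Qed.

Lemma integral_pw_convolution a b t : 0 < a -> 0 < b ->
  (\int[mu]_s (pw a (t - s) * pw b s)%:E
    = (Gamma a * Gamma b / Gamma (a + b) * pw (a + b) t)%:E)%E.
Proof.
move=> a0 b0; rewrite -/(beta a b t).
have [t0|t0] := leP t 0; first by rewrite beta_le0// pw_le0// mulr0.
rewrite beta_scale// pwE// [RHS]EFinM muleC; congr (_ * _)%E.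
have := eGamma_mul a0 b0; rewrite !eGamma_Gamma ?addr_gt0//.
have := beta_lty a0 b0; case: (beta a b 1) (beta_ge0 a b 1) => //= x _ _.
rewrite -!EFinM => -[->]; congr (_%:E).
by rewrite mulfK// gt_eqF// Gamma_gt0// addr_gt0.
Qed.

End Gamma_function.
#[export] Hint Resolve measurable_pw : core.

(** * Convolution on the half line *)

Definition on_half_line {R : realType} (f : R -> R) : R -> R :=
  f \_ `]0, +oo[%classic.
Local Notation pos := on_half_line.

(** Both factors vanish outside ]0, +oo[, so the values of [f] and [g] there are irrelevant and the
    integral effectively runs over ]0, t[. *)
HB.lock Definition convol {R : realType} (f g : R -> R) (t : R) : R :=
  \int[@lebesgue_measure R]_s (pos f (t - s) * pos g s).

(* Measurable functions on ]0, +oo[ that are O(t ^ (a - 1)) on every ]0, T],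
   for some a > 0. *)
Definition admissible {R : realType} (f : R -> R) : Prop :=
  measurable_fun (`]0, +oo[%classic : set R) f /\
  exists2 a : R, 0 < a & forall T : R, exists2 C : R, 0 <= C &
    forall t, 0 < t <= T -> `|f t| <= C * t `^ (a - 1).

Section convolution.
Context {R : realType}.
Local Notation mu := (@lebesgue_measure R).
Implicit Types (f g h : R -> R) (a b c s t u v T C : R).

Lemma posE f t : 0 < t -> pos f t = f t.
Proof. by move=> t0; rewrite /pos patchE mem_set//= in_itv/= t0. Qed.

Lemma pos_le0 f t : t <= 0 -> pos f t = 0.
Proof.
by move=> t0; rewrite /pos patchE memNset//= in_itv/= andbT; apply/negP; rewrite -leNgt.
Qed.

Lemma pos_pw a : pos (pw a) = pw a.
Proof.
by apply/funext => t; have [t0|t0] := leP t 0; [rewrite pos_le0// pw_le0|rewrite posE].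
Qed.

Lemma admissible_pos f : admissible f -> measurable_fun setT (pos f).
Proof. by move=> [mf _]; apply/(measurable_restrictT _ _).1. Qed.

Lemma admissible_dom f : admissible f ->
  exists2 a, 0 < a & forall T, exists2 C, 0 <= C &
    forall t, t <= T -> `|pos f t| <= C * pw a t.
Proof.
move=> [_ [a a0 fa]]; exists a => // T; have [C C0 fC] := fa T; exists C => // t tT.
have [t0|t0] := leP t 0; first by rewrite pos_le0// normr0 mulr_ge0 ?pw_ge0.
by rewrite posE// pwE// fC// t0.
Qed.

Lemma admissible_pw a : 0 < a -> admissible (pw a).
Proof.
move=> a0; split; first exact: (measurable_funS _ (@subsetT _ _)).
exists a => // T; exists 1 => // t /andP[t0 _].
by rewrite ger0_norm ?pw_ge0// mul1r pwE.
Qed.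

Lemma admissible_cst c : admissible (cst c).
Proof.
split=> //; exists 1 => // T; exists `|c| => // t _.
by rewrite subrr powRr0 mulr1.
Qed.

Lemma admissible_le f g : admissible g ->
  measurable_fun (`]0, +oo[%classic : set R) f ->
  (forall t, 0 < t -> `|f t| <= `|g t|) -> admissible f.
Proof.
move=> [_ [a a0 ga]] mf fg; split=> //; exists a => // T.
have [C C0 gC] := ga T; exists C => // t /andP[t0 tT].
by rewrite (le_trans (fg _ t0))// gC// t0.
Qed.

Lemma admissible_patch (A : set R) f : measurable A -> admissible f ->
  admissible (f \_ A).
Proof.
move=> mA Wf; apply: (admissible_le Wf).
  by apply/measurable_restrict => //; apply: measurable_funS Wf.1.
by move=> t _; rewrite patchE; case: ifP => // _; rewrite normr0.
Qed.

Lemma admissibleZ c f : admissible f -> admissible (fun t => c * f t).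
Proof.
move=> [mf [a a0 fa]]; split; first exact: measurable_funM.
exists a => // T; have [C C0 fC] := fa T; exists (`|c| * C); first exact: mulr_ge0.
by move=> t tT; rewrite normrM -mulrA ler_wpM2l// fC.
Qed.

Lemma admissibleN f : admissible f -> admissible (fun t => - f t).
Proof.
by move=> /(admissibleZ (-1)) Wf; under eq_fun do rewrite -mulN1r.
Qed.

Lemma admissible_norm f : admissible f -> admissible (fun t => `|f t|).
Proof.
move=> [mf [a a0 fa]]; split; first exact: measurableT_comp.
exists a => // T; have [C C0 fC] := fa T; exists C => // t tT.
by rewrite normr_id fC.
Qed.

Let dom_le a b T : 0 < a -> a <= b -> forall t, 0 < t <= T ->
  t `^ (b - 1) <= T `^ (b - a) * t `^ (a - 1).
Proof.
move=> a0 ab t /andP[t0 tT].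
have -> : b - 1 = (b - a) + (a - 1) by ring.
rewrite gt0_powRD// ler_wpM2r ?powR_ge0// ge0_ler_powR// ?subr_ge0// nnegrE ltW//.
exact: lt_le_trans tT.
Qed.

Lemma admissibleD f g : admissible f -> admissible g ->
  admissible (fun t => f t + g t).
Proof.
have wlg f' g' a b : measurable_fun (`]0, +oo[%classic : set R) f' ->
    measurable_fun (`]0, +oo[%classic : set R) g' -> 0 < a -> a <= b ->
    (forall T, exists2 C, 0 <= C & forall t, 0 < t <= T -> `|f' t| <= C * t `^ (a - 1)) ->
    (forall T, exists2 C, 0 <= C & forall t, 0 < t <= T -> `|g' t| <= C * t `^ (b - 1)) ->
    admissible (fun t => f' t + g' t).
  move=> mf mg a0 ab fa gb; split; first exact: measurable_funD.
  exists a => // T; have [C C0 fC] := fa T; have [D D0 gD] := gb T.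
  exists (C + D * T `^ (b - a)); first by rewrite addr_ge0 ?mulr_ge0 ?powR_ge0.
  move=> t tT; rewrite (le_trans (ler_normD _ _))// mulrDl lerD ?fC//.
  by rewrite (le_trans (gD _ tT))// -mulrA ler_wpM2l// dom_le.
move=> [mf [a a0 fa]] [mg [b b0 gb]]; have [ab|/ltW ba] := leP a b.
  exact: (wlg f g a b).
by under eq_fun do rewrite addrC; exact: (wlg g f b a).
Qed.

Lemma admissibleB f g : admissible f -> admissible g ->
  admissible (fun t => f t - g t).
Proof. by move=> Wf Wg; apply: admissibleD => //; exact: admissibleN. Qed.

Lemma admissible_sum (I : Type) (r : seq I) (P : pred I) (F : I -> R -> R) :
  (forall i, admissible (F i)) -> admissible (fun t => \sum_(i <- r | P i) F i t).
Proof.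
move=> WF; elim: r => [|i r IH].
  by under eq_fun do rewrite big_nil; exact: (admissible_cst 0).
under eq_fun do rewrite big_cons; case: (P i) => //.
exact: admissibleD.
Qed.

Let kern f g t s := pos f (t - s) * pos g s.

Let measurable_kern f g t : admissible f -> admissible g ->
  measurable_fun setT (kern f g t).
Proof.
move=> Wf Wg; apply: measurable_funM; last exact: admissible_pos.
by apply: measurableT_comp; [exact: admissible_pos|exact: measurable_funB].
Qed.

Let kern_dom f g : admissible f -> admissible g ->
  exists a b, [/\ 0 < a, 0 < b & forall T, exists2 C, 0 <= C & forall t s,
    t <= T -> `|kern f g t s| <= C * (pw a (t - s) * pw b s)].
Proof.
move=> /admissible_dom[a a0 fa] /admissible_dom[b b0 gb]; exists a, b; split=> // T.
have [C C0 fC] := fa T; have [D D0 gD] := gb T.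
exists (C * D); first exact: mulr_ge0.
move=> t s tT; rewrite /kern normrM.
have [s0|s0] := leP s 0.
  by rewrite [pos g s]pos_le0// normr0 mulr0 !mulr_ge0 ?pw_ge0.
have [ts|st] := leP t s.
  by rewrite [pos f _]pos_le0 ?subr_le0// normr0 mul0r !mulr_ge0 ?pw_ge0.
rewrite mulrACA ler_pM//; [apply: fC|apply: gD; rewrite (le_trans (ltW st))//].
by rewrite (le_trans _ tT)// gerBl ltW.
Qed.

Let measurable_pwpw a b t : measurable_fun setT (fun s => pw a (t - s) * pw b s).
Proof.
apply: measurable_funM; last exact: measurable_pw.
by apply: measurableT_comp; [exact: measurable_pw|exact: measurable_funB].
Qed.

(** Power bounds with exponents a and b majorise the integral by a beta integral, hence the exponent
    a + b. The constant is uniform for t <= T, as admissibility of the convolution requires. *)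
Let integral_abs_kern f g : admissible f -> admissible g ->
  exists2 c, 0 < c & forall T, exists2 C, 0 <= C & forall t, t <= T ->
    (\int[mu]_s (`|kern f g t s|)%:E <= (C * pw c t)%:E)%E.
Proof.
move=> Wf Wg; have [a [b [a0 b0 fg]]] := kern_dom Wf Wg.
exists (a + b); first exact: addr_gt0.
move=> T; have [C C0 fC] := fg T.
exists (C * (Gamma a * Gamma b / Gamma (a + b))).
  by rewrite mulr_ge0// divr_ge0 ?mulr_ge0// ltW// Gamma_gt0// addr_gt0.
move=> t tT; rewrite -mulrA [leRHS]EFinM -integral_pw_convolution//.
rewrite -ge0_integralZl_EFin//; last 2 first.
- by move=> s _; rewrite lee_fin mulr_ge0 ?pw_ge0.
- by apply/measurable_EFinP; exact: measurable_pwpw.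
apply: ge0_le_integral => //.
- by apply/measurable_EFinP; apply: measurableT_comp => //; exact: measurable_kern.
- by apply: measurable_funeM; apply/measurable_EFinP; exact: measurable_pwpw.
- by move=> s _; rewrite -EFinM lee_fin fC.
Qed.

Let integrable_kern f g t : admissible f -> admissible g ->
  mu.-integrable setT (EFin \o kern f g t).
Proof.
move=> Wf Wg; apply/integrableP; split.
  by apply/measurable_EFinP; exact: measurable_kern.
have [c c0 fc] := integral_abs_kern Wf Wg; have [C C0 fC] := fc t.
exact: le_lt_trans (fC t (lexx t)) (ltry _).
Qed.

Lemma convol_integral f g t : admissible f -> admissible g ->
  ((convol f g t)%:E = \int[mu]_s (pos f (t - s) * pos g s)%:E)%E.
Proof.
move=> Wf Wg; rewrite convol.unlock /Rintegral fineK//.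
exact: integrable_fin_num (integrable_kern _ _ _).
Qed.

Lemma convol_integrable f g t : admissible f -> admissible g ->
  mu.-integrable setT (fun s => (pos f (t - s) * pos g s)%:E).
Proof. by move=> Wf Wg; exact: integrable_kern. Qed.

Lemma convol_le0 f g t : t <= 0 -> convol f g t = 0.
Proof.
move=> t0; rewrite convol.unlock /Rintegral integral0_eq// => s _.
have [s0|s0] := leP s 0; first by rewrite [pos g s]pos_le0// mulr0.
by rewrite [pos f _]pos_le0 ?mul0r// subr_le0 (le_trans t0)// ltW.
Qed.

Lemma pos_convol f g : pos (convol f g) = convol f g.
Proof.
apply/funext => t; have [t0|t0] := leP t 0; first by rewrite pos_le0// convol_le0.
by rewrite posE.
Qed.

Lemma admissible_convol f g : admissible f -> admissible g ->
  admissible (convol f g).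
Proof.
move=> Wf Wg; split.
  apply: measurable_funTS.
  pose H (z : R * R) := (kern f g z.1 z.2)%:E.
  rewrite (_ : convol f g = fine \o (fun t => \int[mu]_s H (t, s))%E); last first.
    by apply/funext => t; rewrite convol.unlock.
  apply: measurableT_comp => //.
  apply: measurable_integral_snd; apply/measurable_EFinP; apply: measurable_funM.
    by apply: measurableT_comp; [exact: admissible_pos|exact: measurable_funB].
  by apply: measurableT_comp => //; exact: admissible_pos.
have [c c0 fc] := integral_abs_kern Wf Wg; exists c => // T.
have [C C0 fC] := fc T; exists C => // t /andP[t0 tT].
rewrite -lee_fin -(pwE c t0) (le_trans _ (fC t tT))//.
have -> : (`|convol f g t|)%:E = `|(convol f g t)%:E|%E by [].
rewrite convol_integral//; apply: le_abse_integral => //.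
by apply/measurable_EFinP; exact: measurable_kern.
Qed.

Lemma convolC f g t : admissible f -> admissible g -> convol f g t = convol g f t.
Proof.
move=> Wf Wg; rewrite convol.unlock /Rintegral; congr fine.
rewrite -(@integral_reflection _ _ t); last first.
  by apply/measurable_EFinP; exact: measurable_kern.
by apply: eq_integral => s _; rewrite subKr mulrC.
Qed.

Lemma eq_convol f f' g g' t : (forall s, 0 < s < t -> f s = f' s) ->
  (forall s, 0 < s < t -> g s = g' s) -> convol f g t = convol f' g' t.
Proof.
move=> ff gg; rewrite convol.unlock; apply: eq_Rintegral => s _.
have [s0|s0] := leP s 0; first by rewrite ![pos _ s]pos_le0// !mulr0.
have [ts|st] := leP t s; first by rewrite ![pos _ (t - s)]pos_le0 ?subr_le0// !mul0r.
rewrite !posE ?subr_gt0//; congr (_ * _); last by rewrite gg// s0.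
by rewrite ff// subr_gt0 st ltrBlDr ltrDl.
Qed.

Lemma convolDr f g h t : admissible f -> admissible g -> admissible h ->
  convol f (fun s => g s + h s) t = convol f g t + convol f h t.
Proof.
move=> Wf Wg Wh; rewrite convol.unlock -RintegralD//; last 2 first.
- exact: integrable_kern.
- exact: integrable_kern.
apply: eq_Rintegral => s _; rewrite -mulrDr; congr (_ * _).
by have [s0|s0] := leP s 0; [rewrite !pos_le0// addr0|rewrite !posE].
Qed.

Lemma convolZr c f g t : admissible f -> admissible g ->
  convol f (fun s => c * g s) t = c * convol f g t.
Proof.
move=> Wf Wg; rewrite convol.unlock -RintegralZl//; last exact: integrable_kern.
apply: eq_Rintegral => s _; rewrite mulrCA; congr (_ * _).
by have [s0|s0] := leP s 0; [rewrite !pos_le0// mulr0|rewrite !posE].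
Qed.

Lemma convolDl f g h t : admissible f -> admissible g -> admissible h ->
  convol (fun s => g s + h s) f t = convol g f t + convol h f t.
Proof.
by move=> Wf Wg Wh; rewrite ![convol _ f t]convolC// ?convolDr//; exact: admissibleD.
Qed.

Lemma convolZl c f g t : admissible f -> admissible g ->
  convol (fun s => c * g s) f t = c * convol g f t.
Proof.
by move=> Wf Wg; rewrite ![convol _ f t]convolC// ?convolZr//; exact: admissibleZ.
Qed.

Lemma convolBr f g h t : admissible f -> admissible g -> admissible h ->
  convol f (fun s => g s - h s) t = convol f g t - convol f h t.
Proof.
move=> Wf Wg Wh; rewrite convolDr//; last exact: admissibleN.
by under [X in _ + convol f X t]eq_fun do rewrite -mulN1r; rewrite convolZr// mulN1r.
Qed.

Lemma convolBl f g h t : admissible f -> admissible g -> admissible h ->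
  convol (fun s => g s - h s) f t = convol g f t - convol h f t.
Proof.
by move=> Wf Wg Wh; rewrite ![convol _ f t]convolC// ?convolBr//; exact: admissibleB.
Qed.

Lemma convol_sumr (I : Type) (r : seq I) (P : pred I) (F : I -> R -> R) f t :
  admissible f -> (forall i, admissible (F i)) ->
  convol f (fun s => \sum_(i <- r | P i) F i s) t = \sum_(i <- r | P i) convol f (F i) t.
Proof.
move=> Wf WF; elim: r => [|i r IH].
  under [X in convol f X]eq_fun do rewrite big_nil -[0](mul0r 0).
  by rewrite big_nil convolZr ?mul0r//; exact: (admissible_cst 0).
rewrite big_cons; under [X in convol f X]eq_fun do rewrite big_cons.
case: (P i) => //; rewrite convolDr ?IH//; exact: admissible_sum.
Qed.

Lemma ler_convol f f' g g' t : admissible f -> admissible f' ->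
  admissible g -> admissible g' ->
  (forall s, 0 < s < t -> 0 <= f s <= f' s) ->
  (forall s, 0 < s < t -> 0 <= g s <= g' s) -> convol f g t <= convol f' g' t.
Proof.
move=> Wf Wf' Wg Wg' ff gg; rewrite convol.unlock; apply: le_Rintegral => //.
- exact: integrable_kern.
- exact: integrable_kern.
move=> s _; have [s0|s0] := leP s 0; first by rewrite ![pos _ s]pos_le0// !mulr0.
have [ts|st] := leP t s; first by rewrite ![pos _ (t - s)]pos_le0 ?subr_le0// !mul0r.
have /ff/andP[? ?] : 0 < t - s < t by rewrite subr_gt0 st ltrBlDr ltrDl.
have /gg/andP[? ?] : 0 < s < t by rewrite s0.
by rewrite !posE ?subr_gt0// ler_pM.
Qed.

Lemma convol_ge0 f g t : (forall s, 0 < s < t -> 0 <= f s) ->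
  (forall s, 0 < s < t -> 0 <= g s) -> 0 <= convol f g t.
Proof.
move=> f0 g0; rewrite convol.unlock; apply: Rintegral_ge0 => s _.
have [s0|s0] := leP s 0; first by rewrite ![pos _ s]pos_le0// !mulr0.
have [ts|st] := leP t s; first by rewrite ![pos _ (t - s)]pos_le0 ?subr_le0// !mul0r.
rewrite !posE ?subr_gt0// mulr_ge0 ?f0 ?g0 ?s0//.
by rewrite subr_gt0 st ltrBlDr ltrDl.
Qed.

Lemma norm_convol f g t : admissible f -> admissible g ->
  `|convol f g t| <= convol (fun s => `|f s|) (fun s => `|g s|) t.
Proof.
move=> Wf Wg; rewrite convol.unlock (le_trans (le_normr_Rintegral _ _))//.
  exact: integrable_kern.
rewrite le_eqVlt; apply/orP; left; apply/eqP; apply: eq_Rintegral => s _.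
have [s0|s0] := leP s 0; first by rewrite ![pos _ s]pos_le0// !mulr0 normr0.
have [ts|st] := leP t s.
  by rewrite ![pos _ (t - s)]pos_le0 ?subr_le0// !mul0r normr0.
by rewrite !posE ?subr_gt0// normrM.
Qed.

(** Fubini for f(t - v) g(v - s) h(s); absolute integrability comes from the power bounds, whose
    iterated integral is again a beta integral. *)
Lemma convolA f g h t : admissible f -> admissible g -> admissible h ->
  convol f (convol g h) t = convol (convol f g) h t.
Proof.
move=> Wf Wg Wh.
pose H (z : R * R) := (pos f (t - z.1) * kern g h z.1 z.2)%:E.
have mH : measurable_fun setT H.
  apply/measurable_EFinP; apply: measurable_funM.
    by apply: measurableT_comp; [exact: admissible_pos|exact: measurable_funB].
  apply: measurable_funM.
    by apply: measurableT_comp; [exact: admissible_pos|exact: measurable_funB].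
  by apply: measurableT_comp => //; exact: admissible_pos.
have [c c0 gh] := integral_abs_kern Wg Wh; have [C C0 ghC] := gh t.
have [a a0 fa] := admissible_dom Wf; have [D D0 fD] := fa t.
have iH : (mu \x mu)%E.-integrable setT H.
  apply/integrable12ltyP => //.
  apply: (@le_lt_trans _ _ (\int[mu]_v ((D * C)%:E * (pw a (t - v) * pw c v)%:E)%E)%E).
    apply: ge0_le_integral => //.
    - by move=> v _; apply: integral_ge0.
    - apply: (measurable_integral_snd (h := fun z => `|H z|%E)).
      exact: measurableT_comp.
    - by apply: measurable_funeM; apply/measurable_EFinP; exact: measurable_pwpw.
    move=> v _; have -> : (\int[mu]_y `|H (v, y)|)%E =
        ((`|pos f (t - v)|)%:E * \int[mu]_y (`|kern g h v y|)%:E)%E.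
      rewrite -ge0_integralZl_EFin//; last first.
        by apply/measurable_EFinP; apply: measurableT_comp => //; exact: measurable_kern.
      by apply: eq_integral => s _; rewrite /H /= normrM EFinM.
    (* For v < 0 the argument t - v leaves the range on which the bound on [f] holds, but then the
       inner integrand vanishes. *)
    have [v0|v0] := leP v 0.
      rewrite (_ : \int[mu]_y _ = 0)%E ?mule0; last first.
        apply: integral0_eq => s _; rewrite /kern.
        have [s0|s0] := leP s 0; first by rewrite [pos h s]pos_le0// mulr0 normr0.
        by rewrite [pos g _]pos_le0 ?mul0r ?normr0// subr_le0 (le_trans v0)// ltW.
      by rewrite -EFinM lee_fin !mulr_ge0 ?pw_ge0.
    have [tv|vt] := leP t v.
      rewrite [pos f _]pos_le0 ?subr_le0// normr0 mul0e.
      by rewrite -EFinM lee_fin !mulr_ge0 ?pw_ge0.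
    rewrite -EFinM mulrACA EFinM lee_pmul//; first exact: integral_ge0.
      by rewrite lee_fin fD// gerBl ltW.
    by rewrite ghC// ltW.
  rewrite ge0_integralZl_EFin ?mulr_ge0//; last 2 first.
  - by move=> v _; rewrite lee_fin mulr_ge0 ?pw_ge0.
  - by apply/measurable_EFinP; exact: measurable_pwpw.
  by rewrite integral_pw_convolution// -EFinM ltry.
have := Fubini iH.
rewrite [LHS](_ : _ = (convol f (convol g h) t)%:E); last first.
  rewrite convol_integral//; last exact: admissible_convol.
  rewrite pos_convol; apply: eq_integral => v _; rewrite EFinM convol_integral//.
  by rewrite -integralZl//; exact: integrable_kern.
rewrite [RHS](_ : _ = (convol (convol f g) h t)%:E); first by move=> [].
rewrite convol_integral//; last exact: admissible_convol.
rewrite pos_convol; apply: eq_integral => s _; rewrite mulrC EFinM convol_integral//.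
rewrite -integralZl//; last exact: integrable_kern.
rewrite -(@integral_translation _ _ s); last exact: measurable_fun_pair1.
apply: eq_integral => v _; rewrite -EFinM /H /kern /=; congr (_%:E).
by rewrite addrK (addrC v) opprD addrA; ring.
Qed.

End convolution.

(* The Riemann-Liouville kernel: gk a * f is the fractional integral of order a. *)
HB.lock Definition gk {R : realType} (a t : R) : R := pw a t / Gamma a.

(* For c k = z ^ k this is t ^ (be - 1) E_{ga,be} (z t ^ ga). *)
HB.lock Definition mlker {R : realType} (ga be : R) (c : nat -> R) (t : R) : R :=
  limn (series (fun k => c k * gk (ga * k%:R + be) t)).

(** At most geometric growth: the natural class, since 1 / Gamma beats every geometric sequence. *)
Definition rapid {R : realType} (c : nat -> R) : Prop :=
  exists C r : R, [/\ 0 <= C, 0 <= r & forall k, `|c k| <= C * r ^+ k].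

(** As [gk 1] is 1 on the positive half line, this is the integral of |f| over ]0, T[; written as a
    convolution, it inherits the algebra of [convol]. *)
Definition l1 {R : realType} (f : R -> R) (T : R) : R :=
  convol (gk 1) (fun s => `|f s|) T.

Definition inL1 {R : realType} (f : R -> R) : Prop :=
  admissible f /\ exists B : R, forall T, l1 f T <= B.

(** * The semigroup of Riemann-Liouville kernels *)

Section gk_kernels.
Context {R : realType}.
Implicit Types (f g : R -> R) (a b t T : R).

Lemma gkE a t : 0 < t -> gk a t = t `^ (a - 1) / Gamma a.
Proof. by move=> t0; rewrite gk.unlock pwE. Qed.

Lemma gk_le0 a t : t <= 0 -> gk a t = 0.
Proof. by move=> t0; rewrite gk.unlock pw_le0// mul0r. Qed.

Lemma gk_ge0 a t : 0 < a -> 0 <= gk a t.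
Proof. by move=> a0; rewrite gk.unlock divr_ge0 ?pw_ge0// ltW// Gamma_gt0. Qed.

Lemma gk_gt0 a t : 0 < a -> 0 < t -> 0 < gk a t.
Proof. by move=> a0 t0; rewrite gk.unlock divr_gt0 ?pw_gt0// Gamma_gt0. Qed.

Lemma gk1 t : 0 < t -> gk 1 t = 1 :> R.
Proof. by move=> t0; rewrite gkE// subrr powRr0 Gamma1 divr1. Qed.

Let gk_fun a : gk a = (fun t => (Gamma a)^-1 * pw a t).
Proof. by apply/funext => t; rewrite gk.unlock mulrC. Qed.

Lemma admissible_gk a : 0 < a -> admissible (gk a).
Proof. by move=> a0; rewrite gk_fun; apply: admissibleZ; exact: admissible_pw. Qed.

Lemma measurable_gk a : measurable_fun setT (gk a).
Proof. by rewrite gk_fun; apply: measurable_funM => //; exact: measurable_pw. Qed.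

Lemma mulr_gk a t : 0 < a -> t * gk a t = a * gk (a + 1) t.
Proof.
move=> a0; have [t0|t0] := leP t 0; first by rewrite !gk_le0// !mulr0.
rewrite !(gkE _ t0) (GammaS a0) addrK (gt0_powRB1 _ t0).
move: (Gamma a) (Gamma_gt0 a0) => G G0.
by field; rewrite !gt_eqF.
Qed.

Lemma convol_pw a b t : 0 < a -> 0 < b ->
  convol (pw a) (pw b) t = Gamma a * Gamma b / Gamma (a + b) * pw (a + b) t.
Proof.
move=> a0 b0; apply: EFin_inj.
have [Wa Wb] := (admissible_pw a0, admissible_pw b0).
by rewrite convol_integral// !pos_pw integral_pw_convolution.
Qed.

(** Division by Gamma normalises the beta integral into the semigroup law of fractional
    integration. *)
Lemma convol_gk a b : 0 < a -> 0 < b -> convol (gk a) (gk b) = gk (a + b) :> (R -> R).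
Proof.
move=> a0 b0; apply/funext => t; rewrite !gk_fun.
have [Wa Wb] := (admissible_pw a0, admissible_pw b0).
rewrite convolZl//; last exact: admissibleZ.
rewrite convolZr// convol_pw//.
move: (Gamma a) (Gamma_gt0 a0) (Gamma b) (Gamma_gt0 b0) => A A0 B B0.
move: (Gamma (a + b)) (Gamma_gt0 (addr_gt0 a0 b0)) => G G0.
by field; rewrite !gt_eqF.
Qed.

Lemma convol1_gk a t : 0 < a -> convol (gk 1) (gk a) t = gk (a + 1) t.
Proof. by move=> a0; rewrite convol_gk// addrC. Qed.

End gk_kernels.

(** * Running L1 norms and Young's inequality *)

Section L1_norm.
Context {R : realType}.
Implicit Types (f g : R -> R) (c s t T : R).
Let W1 := admissible_gk (@ltr01 R).

Lemma l1_ge0 f T : 0 <= l1 f T.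
Proof. by apply: convol_ge0 => s s0; [rewrite gk_ge0|rewrite normr_ge0]. Qed.

Lemma le_l1 f g T : admissible f -> admissible g ->
  (forall s, 0 < s < T -> `|f s| <= `|g s|) -> l1 f T <= l1 g T.
Proof.
move=> Wf Wg fg; apply: ler_convol => //; [exact: admissible_norm|exact: admissible_norm| |].
  by move=> s _; rewrite gk_ge0/=.
by move=> s sT; rewrite normr_ge0 fg.
Qed.

Lemma l1D f g T : admissible f -> admissible g ->
  l1 (fun s => f s + g s) T <= l1 f T + l1 g T.
Proof.
move=> Wf Wg; have [Nf Ng] := (admissible_norm Wf, admissible_norm Wg).
rewrite /l1 -convolDr//; apply: ler_convol => //.
- by apply: admissible_norm; exact: admissibleD.
- exact: admissibleD.
- by move=> s _; rewrite gk_ge0/=.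
- by move=> s _; rewrite normr_ge0 ler_normD.
Qed.

Lemma l1Z c f T : admissible f -> l1 (fun s => c * f s) T = `|c| * l1 f T.
Proof.
move=> Wf; rewrite /l1 -convolZr//; last exact: admissible_norm.
by under [X in convol _ X]eq_fun do rewrite normrM.
Qed.

Lemma ler_l1 f s t : admissible f -> s <= t -> l1 f s <= l1 f t.
Proof.
move=> Wf st; have Nf := admissible_norm Wf.
rewrite /l1 -lee_fin !convol_integral//.
apply: le_integral; [by []|exact: convol_integrable|exact: convol_integrable|].
move=> x _; rewrite lee_fin ler_wpM2r//.
  by have [x0|x0] := leP x 0; [rewrite pos_le0|rewrite posE].
have [sx|xs] := leP s x.
  rewrite [leLHS]pos_le0 ?subr_le0//.
  have [y0|y0] := leP (t - x) 0; [by rewrite pos_le0|by rewrite posE// gk_ge0].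
have xt := lt_le_trans xs st.
by rewrite !posE ?subr_gt0// !gk1 ?subr_gt0.
Qed.

Lemma inL1_le f g : inL1 g -> admissible f ->
  (forall t, 0 < t -> `|f t| <= `|g t|) -> inL1 f.
Proof.
move=> [Wg [B gB]] Wf fg; split=> //; exists B => T.
by apply: le_trans (gB T); apply: le_l1 => // s /andP[s0 _]; exact: fg.
Qed.

Lemma inL1D f g : inL1 f -> inL1 g -> inL1 (fun s => f s + g s).
Proof.
move=> [Wf [B fB]] [Wg [C gC]]; split; first exact: admissibleD.
by exists (B + C) => T; rewrite (le_trans (l1D _ Wf Wg))// lerD.
Qed.

Lemma inL1Z c f : inL1 f -> inL1 (fun s => c * f s).
Proof.
move=> [Wf [B fB]]; split; first exact: admissibleZ.
by exists (`|c| * B) => T; rewrite l1Z// ler_wpM2l.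
Qed.

Lemma inL1N f : inL1 f -> inL1 (fun s => - f s).
Proof. by move=> /(inL1Z (-1)); under eq_fun do rewrite mulN1r. Qed.

Lemma inL1B f g : inL1 f -> inL1 g -> inL1 (fun s => f s - g s).
Proof. by move=> Lf Lg; apply: inL1D => //; exact: inL1N. Qed.

(** Young's inequality: 1 * |f * g| <= (1 * |f|) * |g|, and the running integral of |f| is at most
    its value at T. *)
Lemma l1_convol f g T : admissible f -> admissible g ->
  l1 (convol f g) T <= l1 f T * l1 g T.
Proof.
move=> Wf Wg; have [Nf Ng] := (admissible_norm Wf, admissible_norm Wg).
apply: (@le_trans _ _ (convol (l1 f) (fun s => `|g s|) T)).
  rewrite -convolA//; apply: ler_convol => //.
  - by apply: admissible_norm; exact: admissible_convol.
  - exact: admissible_convol.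
  - by move=> s _; rewrite gk_ge0/=.
  - by move=> s _; rewrite normr_ge0 norm_convol.
have -> : l1 f T * l1 g T = convol (fun s => l1 f T * gk 1 s) (fun s => `|g s|) T.
  by rewrite convolZl.
apply: ler_convol => //; [exact: admissible_convol|exact: admissibleZ|..].
  move=> s /andP[s0 sT]; rewrite l1_ge0 gk1// mulr1 ler_l1 ?(ltW sT)//.
by move=> s _; rewrite normr_ge0/=.
Qed.

Lemma inL1_convol f g : inL1 f -> inL1 g -> inL1 (convol f g).
Proof.
move=> [Wf [B fB]] [Wg [C gC]]; split; first exact: admissible_convol.
exists (B * C) => T; rewrite (le_trans (l1_convol _ Wf Wg))//.
by rewrite ler_pM ?l1_ge0.
Qed.

Lemma convol1_integral f T : admissible f ->
  ((convol (gk 1) f T)%:E = \int[@lebesgue_measure R]_(s in `]0%R, T[) (f s)%:E)%E.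
Proof.
move=> Wf; rewrite convol_integral//.
rewrite [RHS]integral_mkcond; apply: eq_integral => s _.
rewrite patchE; have [s0|s0] := leP s 0.
  rewrite [X in _ * X]pos_le0// mulr0 memNset//= in_itv/=.
  by rewrite (ltNge 0 s) s0.
have [Ts|sT] := leP T s.
  rewrite pos_le0 ?subr_le0// mul0r memNset//= in_itv/=.
  by rewrite (ltNge s T) Ts andbF.
rewrite mem_set/= ?in_itv/= ?s0//.
by rewrite !posE ?subr_gt0// gk1 ?subr_gt0// mul1r.
Qed.

Lemma l1_integral f T : admissible f ->
  ((l1 f T)%:E = \int[@lebesgue_measure R]_(s in `]0%R, T[) (`|f s|)%:E)%E.
Proof. by move=> /admissible_norm; exact: convol1_integral. Qed.

Lemma inL1_powR f C a D b : admissible f -> 0 <= C -> 0 <= D -> 0 < a -> 0 < b ->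
  (forall t, 0 < t < 1 -> `|f t| <= C * t `^ (a - 1)) ->
  (forall t, 1 <= t -> `|f t| <= D * t `^ (- b - 1)) -> inL1 f.
Proof.
move=> Wf C0 D0 a0 b0 fC fD; split=> //; exists (C / a + D / b) => T.
(* Enlarging T beyond 1 lets the interval be split at 1. *)
apply: (@le_trans _ _ (l1 f (Num.max T 2))); first by rewrite ler_l1// le_max lexx.
have : 1 < Num.max T 2 by rewrite lt_max (ltr1n R 2) orbT.
move: (Num.max T 2) => {}T T1; rewrite -lee_fin l1_integral//.
have mf (A : set R) : measurable A -> (A `<=` `]0%R, +oo[)%classic ->
    measurable_fun A (fun s : R => (`|f s|)%:E).
  move=> mA A0; apply/measurable_EFinP; apply: measurableT_comp => //.
  by apply: measurable_funS Wf.1.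
have mp (c p : R) (A : set R) : measurable_fun A (fun s : R => (c * s `^ p)%:E).
  by apply/measurable_EFinP; apply: measurable_funM => //; apply: measurable_funTS.
have sub01 : ((`]0%R, 1%R[ : set R) `<=` `]0%R, +oo[)%classic.
  by move=> x /=; rewrite !in_itv/= => /andP[->].
have sub1T : ((`[1%R, T[ : set R) `<=` `]0%R, +oo[)%classic.
  by move=> x /=; rewrite !in_itv/= andbT => /andP[+ _]; exact: lt_le_trans.
rewrite (_ : `]0, T[%classic = (`]0%R, 1%R[ `|` `[1%R, T[)%classic); last first.
  apply/seteqP; split => x /=; rewrite !in_itv/=.
    by move=> /andP[-> ->]/=; rewrite andbT; case: (ltP x 1); [left|right].
  by case=> /andP[x0 xT]; rewrite ?x0 ?(lt_trans xT T1)// (lt_le_trans ltr01 x0).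
rewrite ge0_integral_setU//=; last 2 first.
- by apply: mf; [exact: measurableU|by rewrite subUset].
- apply/disj_setPS => x [] /=; rewrite !in_itv/= => /andP[_ x1] /andP[].
  by rewrite leNgt x1.
rewrite EFinD leeD//.
  apply: (@le_trans _ _ (\int[@lebesgue_measure R]_(s in `]0%R, 1%R[)
      (C%:E * (s `^ (a - 1))%:E))%E).
    by apply: ge0_le_integral => //; do ?[exact: mf|exact: mp].
  rewrite ge0_integralZl_EFin//; last 2 first.
  - by move=> s _; rewrite lee_fin powR_ge0.
  - by apply/measurable_EFinP; apply: measurable_funTS.
  by rewrite ge0_integral_powR// powR1 -EFinM div1r.
apply: (@le_trans _ _ (\int[@lebesgue_measure R]_(s in `[1%R, T])
    (D%:E * (s `^ (- b - 1))%:E))%E).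
  apply: (@le_trans _ _ (\int[@lebesgue_measure R]_(s in `[1%R, T[)
      (D%:E * (s `^ (- b - 1))%:E))%E).
    apply: ge0_le_integral => //; do ?[exact: mf|exact: mp].
    by move=> s /=; rewrite in_itv/= => /andP[s1 _]; rewrite -EFinM lee_fin fD.
  apply: ge0_subset_integral => //; first exact: mp.
    by move=> s _; rewrite -EFinM lee_fin mulr_ge0 ?powR_ge0.
  by move=> x /=; rewrite !in_itv/= => /andP[-> /ltW].
rewrite ge0_integralZl_EFin//; last 2 first.
- by move=> s _; rewrite lee_fin powR_ge0.
- by apply/measurable_EFinP; apply: measurable_funTS.
rewrite integral_powR_cc ?oppr_eq0 ?(gt_eqF b0)// -EFinB -EFinM lee_fin ler_wpM2l//.
by rewrite powR1 invrN !mulrN opprK mul1r addrC gerBl divr_ge0 ?powR_ge0 ?(ltW b0).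
Qed.

End L1_norm.

(** * Convergence, bounds and continuity of Mittag-Leffler kernels *)

Section mittag_leffler_kernels.
Context {R : realType}.
Implicit Types (c d : nat -> R) (ga be b r t T K : R).

Lemma rapidD c d : rapid c -> rapid d -> rapid (fun k => c k + d k).
Proof.
move=> [C [r [C0 r0 cr]]] [D [s [D0 s0 ds]]].
exists (C + D), (Num.max r s); split; [exact: addr_ge0|by rewrite le_max r0|] => k.
rewrite (le_trans (ler_normD _ _))// mulrDl lerD//.
  rewrite (le_trans (cr k))// ler_wpM2l// lerXn2r ?nnegrE ?le_max ?r0 ?lexx//.
rewrite (le_trans (ds k))// ler_wpM2l// lerXn2r ?nnegrE ?le_max ?s0 ?lexx ?orbT//.
Qed.

Lemma rapid_le c d : rapid d -> (forall k, `|c k| <= `|d k|) -> rapid c.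
Proof.
move=> [C [r [C0 r0 cr]]] cd; exists C, r; split=> // k.
exact: le_trans (cd k) (cr k).
Qed.

Lemma rapidZ (x : R) c : rapid c -> rapid (fun k => x * c k).
Proof.
move=> [C [r [C0 r0 cr]]]; exists (`|x| * C), r; split=> //; first exact: mulr_ge0.
by move=> k; rewrite normrM -mulrA ler_wpM2l.
Qed.

Lemma rapidN c : rapid c -> rapid (fun k => - c k).
Proof. by move=> rc; apply: rapid_le rc _ => k; rewrite normrN. Qed.

Lemma rapidB c d : rapid c -> rapid d -> rapid (fun k => c k - d k).
Proof. by move=> rc rd; apply: rapidD => //; exact: rapidN. Qed.

Lemma rapid_shift c : rapid c -> rapid (fun k => c k.+1).
Proof.
move=> [C [r [C0 r0 cr]]]; exists (C * r), r; split=> //; first exact: mulr_ge0.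
by move=> k; rewrite (le_trans (cr _))// exprS mulrA.
Qed.

Lemma rapid_geo (x : R) : rapid (fun k => x ^+ k).
Proof. by exists 1, `|x|; split=> // k; rewrite normrX mul1r. Qed.

Lemma rapid_sum (I : Type) (s : seq I) (P : pred I) (F : I -> nat -> R) :
  (forall i, rapid (F i)) -> rapid (fun k => \sum_(i <- s | P i) F i k).
Proof.
move=> rF; elim: s => [|i s IH].
  by exists 0, 0; split=> // k; rewrite big_nil normr0 mul0r.
under eq_fun do rewrite big_cons; case: (P i) => //; exact: rapidD.
Qed.

Let pow_le2 n : n.+1%:R <= 2 ^+ n :> R.
Proof. by rewrite -natrX ler_nat ltn_expl. Qed.

Lemma rapid_convolution c d : rapid c -> rapid d ->
  rapid (fun n => \sum_(k < n.+1) c k * d (n - k)%N).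
Proof.
move=> [C [r [C0 r0 cr]]] [D [s [D0 s0 ds]]].
pose m := Num.max r s.
have [rm sm] : r <= m /\ s <= m by rewrite !le_max !lexx orbT.
have m0 : 0 <= m by rewrite (le_trans r0).
exists (C * D), (2 * m); split; rewrite ?mulr_ge0// => n.
rewrite (le_trans (ler_norm_sum _ _ _))//.
apply: (@le_trans _ _ (\sum_(k < n.+1) C * D * m ^+ n)).
  apply: ler_sum => k _; have kn : (k <= n)%N by rewrite -ltnS.
  rewrite normrM -[in leRHS](subnKC kn) exprD mulrACA ler_pM//.
    by rewrite (le_trans (cr k))// ler_wpM2l// lerXn2r ?nnegrE.
  by rewrite (le_trans (ds _))// ler_wpM2l// lerXn2r ?nnegrE.
rewrite sumr_const card_ord -[leLHS]mulr_natr -mulrA ler_wpM2l ?mulr_ge0//.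
by rewrite mulrC exprMn ler_wpM2r ?exprn_ge0// pow_le2.
Qed.

(** Cauchy estimates at every radius, a form stable under term-by-term differentiation. *)
Let entire (a : nat -> R) :=
  forall K, 0 < K -> exists2 D, 0 <= D & forall k, `|a k| * K ^+ k <= D.

Let coef ga be c k := c k / Gamma (ga * k%:R + be).

Let entire_coef ga be c : 0 < ga -> 0 < be -> rapid c -> entire (coef ga be c).
Proof.
move=> ga0 be0 [C [r [C0 r0 cr]]] K K0.
(* [M] satisfies M^ga = q > r K, so the decay M^(- ga k - be) of 1 / Gamma beats (r K)^k; the added
   1 keeps q positive when r = 0. *)
pose q := r * K + 1; have q0 : 0 < q by rewrite ltr_wpDl// mulr_ge0// ltW.
pose M := q `^ ga^-1; have M0 : 0 < M by rewrite powR_gt0.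
have [G G0 GM] := Gamma_growth M0.
exists (C * (G * (M `^ be)^-1)); first by rewrite mulr_ge0// mulr_ge0 ?(ltW G0)// invr_ge0 powR_ge0.
move=> k; have gk0 : 0 < ga * k%:R + be by rewrite ltr_wpDl// mulr_ge0// ltW.
have Mk : M `^ (ga * k%:R + be) = q ^+ k * M `^ be.
  rewrite gt0_powRD// /M -powRrM mulrA mulVf ?gt_eqF// mul1r powR_mulrn//.
  exact: ltW.
rewrite /coef normrM normfV (gtr0_norm (Gamma_gt0 gk0)) mulrAC.
have := GM _ gk0; rewrite Mk invfM mulrA => GMk.
apply: (@le_trans _ _ ((C * r ^+ k * K ^+ k) * (G * q ^- k * (M `^ be)^-1))).
  rewrite ler_pM// ?mulr_ge0 ?exprn_ge0 ?(ltW K0) ?invr_ge0 ?(ltW (Gamma_gt0 _))//.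
  by rewrite ler_wpM2r ?exprn_ge0// ltW.
rewrite -[C * _ * _]mulrA -exprMn -!mulrA ler_wpM2l//.
rewrite [leLHS]mulrCA ler_wpM2l ?(ltW G0)// mulrA ler_piMl ?invr_ge0 ?powR_ge0//.
rewrite ler_pdivrMr ?exprn_gt0// mul1r lerXn2r ?nnegrE ?mulr_ge0 ?(ltW K0) ?(ltW q0)//.
by rewrite /q lerDl.
Qed.

(** Comparison with a geometric series of ratio 1 / 2, using the estimate at twice a radius larger
    than |x|. *)
Let entire_cvg a (x : R) : entire a ->
  cvgn [normed series (fun k => a k * x ^+ k)].
Proof.
move=> /(_ (2 * (`|x| + 1))) []; first by rewrite mulr_gt0// ltr_wpDl.
move=> D D0 aD; apply: (series_le_cvg (v_ := geometric D 2^-1)).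
- by move=> k; exact: normr_ge0.
- by move=> k; rewrite /= mulr_ge0 ?exprn_ge0.
- move=> k /=; rewrite normrM normrX exprVn ler_pdivlMr ?exprn_gt0// -mulrA -exprMn.
  apply: le_trans (aD k); rewrite ler_wpM2l// lerXn2r ?nnegrE ?mulr_ge0 ?addr_ge0//.
  by rewrite mulrC ler_wpM2l// lerDl.
- by apply: is_cvg_geometric_series; rewrite gtr0_norm// invf_lt1// ltr1n.
Qed.

Let term ga be c t k : 0 < t ->
  c k * gk (ga * k%:R + be) t = t `^ (be - 1) * (coef ga be c k * (t `^ ga) ^+ k).
Proof.
move=> t0; rewrite gkE// /coef.
have -> : ga * k%:R + be - 1 = (be - 1) + ga * k%:R by ring.
rewrite (gt0_powRD (be - 1) _ t0) (powRrM t ga) (powR_mulrn _ (powR_ge0 _ _)).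
by move: (Gamma _)^-1 => G; ring.
Qed.

Let term_norm_cvg ga be c t : 0 < ga -> 0 < be -> rapid c ->
  cvgn [normed series (fun k => c k * gk (ga * k%:R + be) t)].
Proof.
move=> ga0 be0 rc; have [t0|t0] := leP t 0.
  rewrite (_ : [normed series _] = cst 0); first exact: is_cvg_cst.
  apply/funext => n; rewrite /normed_series_of /series /= big1// => k _.
  by rewrite gk_le0// mulr0 normr0.
have := @entire_cvg _ (t `^ ga) (entire_coef ga0 be0 rc).
move=> /(is_cvg_seriesZ (k := t `^ (be - 1))); set F := _ *: _.
rewrite (_ : F = (fun k => `|c k * gk (ga * k%:R + be) t|))//.
apply/funext => k; rewrite term// [RHS]normrM.
by rewrite [X in _ = X * _]ger0_norm ?powR_ge0.
Qed.

Lemma mlker_series_cvg ga be c t : 0 < ga -> 0 < be -> rapid c ->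
  series (fun k => c k * gk (ga * k%:R + be) t) @ \oo --> mlker ga be c t.
Proof.
by move=> ga0 be0 rc; rewrite mlker.unlock; apply: normed_cvg; exact: term_norm_cvg.
Qed.

Lemma mlker_le0 ga be c t : t <= 0 -> mlker ga be c t = 0.
Proof.
move=> t0; rewrite mlker.unlock (_ : series _ = cst 0) ?lim_cst//.
by apply/funext => n; rewrite /series/= big1// => k _; rewrite gk_le0// mulr0.
Qed.

Lemma mlker_norm_le ga be c t : 0 < ga -> 0 < be -> rapid c ->
  `|mlker ga be c t| <= mlker ga be (fun k => `|c k|) t.
Proof.
move=> ga0 be0 rc; rewrite mlker.unlock (le_trans (lim_series_norm _))//.
  exact: term_norm_cvg.
rewrite le_eqVlt; apply/orP; left; apply/eqP; congr (limn _); congr series.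
apply/funext => k; rewrite /= normrM (ger0_norm (gk_ge0 _ _))//.
by rewrite ltr_wpDl// mulr_ge0// ltW.
Qed.

Let mlkerE ga be c t : 0 < ga -> 0 < be -> rapid c -> 0 < t ->
  mlker ga be c t = t `^ (be - 1) * limn (pseries (coef ga be c) (t `^ ga)).
Proof.
move=> ga0 be0 rc t0; rewrite mlker.unlock.
have pcvg : cvgn (pseries (coef ga be c) (t `^ ga)).
  by apply: normed_cvg; exact: entire_cvg (entire_coef ga0 be0 rc).
transitivity (t `^ (be - 1) *: (limn (pseries (coef ga be c) (t `^ ga)) : R^o)) => //.
rewrite -lim_seriesZ//.
by congr (limn (series _)); apply/funext => k; exact: term.
Qed.

(** With coefficients replaced by their absolute values the power series increases with t, so its
    sum at T^ga serves on all of ]0, T]. *)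
Lemma mlker_bound ga be c T : 0 < ga -> 0 < be -> rapid c ->
  exists2 C, 0 <= C & forall t, 0 < t <= T ->
    `|mlker ga be c t| <= C * t `^ (be - 1).
Proof.
move=> ga0 be0 rc.
have ra : rapid (fun k => `|c k|) by apply: rapid_le rc _ => k; rewrite normr_id.
pose p := pseries (coef ga be (fun k => `|c k|)).
have c0 k : 0 <= coef ga be (fun k => `|c k|) k.
  by rewrite divr_ge0// ltW// Gamma_gt0// ltr_wpDl// mulr_ge0// ltW.
have pcvg x : 0 <= x -> cvgn (p x).
  by move=> x0; apply: normed_cvg; exact: entire_cvg (entire_coef ga0 be0 ra).
exists (limn (p (T `^ ga))).
  apply: limr_ge; first by apply: pcvg; rewrite powR_ge0.
  by apply: nearW => n; apply: sumr_ge0 => k _; rewrite mulr_ge0 ?exprn_ge0 ?powR_ge0.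
move=> t /andP[t0 tT]; rewrite (le_trans (mlker_norm_le _ _ _ _))// mlkerE// mulrC.
rewrite ler_wpM2r ?powR_ge0//; apply: ler_lim; [by apply: pcvg; rewrite powR_ge0..|].
apply: nearW => n; apply: ler_sum => k _; rewrite ler_wpM2l// lerXn2r ?nnegrE ?powR_ge0//.
by apply: ge0_ler_powR; rewrite ?nnegrE ?(ltW ga0) ?(ltW t0)// (le_trans (ltW t0)).
Qed.

Lemma admissible_mlker ga be c : 0 < ga -> 0 < be -> rapid c ->
  admissible (mlker ga be c).
Proof.
move=> ga0 be0 rc; split; last by exists be => // T; exact: mlker_bound.
apply: (measurable_fun_cvg
  (h := fun n t => series (fun k => c k * gk (ga * k%:R + be) t) n)).
  move=> n; rewrite /series/=; apply: measurable_sum => k.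
  by apply: measurable_funM => //; apply: measurable_funTS; exact: measurable_gk.
by move=> t _; exact: mlker_series_cvg.
Qed.

(** The factor k + 1 from differentiation is at most 2^(k + 1) and is absorbed by doubling the
    radius. *)
Let entire_diffs a : entire a -> entire (pseries_diffs a).
Proof.
move=> ea K K0; have [|D D0 aD] := ea (2 * K); first by rewrite mulr_gt0.
exists (D / K); first by rewrite divr_ge0// ltW.
move=> k; rewrite /pseries_diffs ler_pdivlMr// (le_trans _ (aD k.+1))//.
rewrite normrM normr_nat -mulrA -exprSr exprMn mulrA.
rewrite ler_wpM2r ?exprn_ge0 ?(ltW K0)// mulrC ler_wpM2l//.
by rewrite (le_trans (pow_le2 k))// ler_eXn2l// ltr1n.
Qed.

Let entire_pseries_cvg a (x : R) : entire a -> cvgn (pseries a x).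
Proof.
by move=> ea; apply: normed_cvg; exact: entire_cvg.
Qed.

Lemma mlker_continuous ga be c t : 0 < ga -> 0 < be -> rapid c -> 0 < t ->
  {for t, continuous (mlker ga be c)}.
Proof.
move=> ga0 be0 rc t0; have ea := entire_coef ga0 be0 rc.
suff : {for t, continuous (fun t => t `^ (be - 1) * limn (pseries (coef ga be c) (t `^ ga)))}.
  rewrite /prop_for /continuous_at /= -(mlkerE ga0 be0 rc t0); apply: cvg_trans; apply: near_eq_cvg.
  by near=> s; rewrite mlkerE//; near: s; exact: lt_nbhsr.
apply: continuousM; first exact: continuous_powR_gt0.
apply: (@continuous_comp _ _ _ (@powR R ^~ ga) (fun x => limn (pseries (coef ga be c) x))).
  exact: continuous_powR_gt0.
apply: differentiable_continuous; apply/derivable1_diffP.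
pose K := t `^ ga + 1.
have : is_derive (t `^ ga) 1 (fun x => limn (pseries (coef ga be c) x))
    (limn (pseries (pseries_diffs (coef ga be c)) (t `^ ga))).
  apply: (@pseries_snd_diffs _ _ K).
  - exact: entire_pseries_cvg.
  - by apply: entire_pseries_cvg; exact: entire_diffs.
  - by apply: entire_pseries_cvg; apply: entire_diffs; exact: entire_diffs.
  - by rewrite !ger0_norm ?powR_ge0 ?addr_ge0 ?powR_ge0// ltrDl.
by case.
Unshelve. all: by end_near. Qed.

End mittag_leffler_kernels.

(** * Operations on kernels read off their coefficient sequences *)

Section mittag_leffler_algebra.
Context {R : realType}.
Local Notation mu := (@lebesgue_measure R).
Implicit Types (f g : R -> R) (c d : nat -> R) (a ga be b r t x : R).

Let gaS ga be k : 0 < ga -> 0 < be -> 0 < ga * k%:R + be.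
Proof. by move=> ga0 be0; rewrite ltr_wpDl// mulr_ge0// ltW. Qed.

Let mlker_lim ga be c t (u : nat -> R) (l : R) :
  (forall n, series (fun k => c k * gk (ga * k%:R + be) t) n = u n) ->
  u @ \oo --> l -> mlker ga be c t = l.
Proof. by rewrite mlker.unlock => /funext -> /cvg_lim; exact. Qed.

Lemma eq_mlker ga be c d : c =1 d -> mlker ga be c = mlker ga be d.
Proof. by move=> /funext ->. Qed.

Lemma mlkerD ga be c d t : 0 < ga -> 0 < be -> rapid c -> rapid d ->
  mlker ga be (fun k => c k + d k) t = mlker ga be c t + mlker ga be d t.
Proof.
move=> ga0 be0 rc rd; apply: mlker_lim; last first.
  by apply: cvgD; apply: mlker_series_cvg; [| |exact: rc| | |exact: rd].
move=> n; rewrite -[RHS]/(series _ n + series _ n) /series /= -big_split.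
by apply: eq_bigr => k _; rewrite mulrDl.
Qed.

Lemma mlkerZ ga be x c t : 0 < ga -> 0 < be -> rapid c ->
  mlker ga be (fun k => x * c k) t = x * mlker ga be c t.
Proof.
move=> ga0 be0 rc; apply: mlker_lim; last first.
  by apply: cvgM; [exact: cvg_cst|exact: (mlker_series_cvg (c := c))].
move=> n; rewrite /series /= mulr_sumr.
by apply: eq_bigr => k _; rewrite mulrA.
Qed.

Lemma mlkerB ga be c d t : 0 < ga -> 0 < be -> rapid c -> rapid d ->
  mlker ga be (fun k => c k - d k) t = mlker ga be c t - mlker ga be d t.
Proof.
move=> ga0 be0 rc rd; rewrite mlkerD//; last exact: rapidN.
congr (_ + _); rewrite -mulN1r -mlkerZ//.
by congr (mlker _ _ _ _); apply/funext => k; rewrite mulN1r.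
Qed.

Lemma mlker0 ga be t : mlker ga be (fun=> 0) t = 0.
Proof.
apply: mlker_lim; last exact: cvg_cst.
by move=> n; rewrite /series/= big1// => k _; rewrite mul0r.
Qed.

Lemma mlker_sum (I : Type) (s : seq I) (P : pred I) (F : I -> nat -> R) ga be t :
  0 < ga -> 0 < be -> (forall i, rapid (F i)) ->
  mlker ga be (fun k => \sum_(i <- s | P i) F i k) t =
  \sum_(i <- s | P i) mlker ga be (F i) t.
Proof.
move=> ga0 be0 rF; elim: s => [|i s IH].
  by under eq_fun do rewrite big_nil; rewrite mlker0 big_nil.
rewrite big_cons; under eq_fun do rewrite big_cons.
case: (P i) => //; rewrite mlkerD ?IH//; exact: rapid_sum.
Qed.

(** Taking off the first term shifts the sequence and raises the exponent by ga; the Volterra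
    equations for the kernels below come from this. *)
Lemma mlker_shift ga be c t : 0 < ga -> 0 < be -> rapid c ->
  mlker ga be c t = c 0%N * gk be t + mlker ga (be + ga) (fun k => c k.+1) t.
Proof.
move=> ga0 be0 rc; apply: mlker_lim => //; rewrite -cvg_shiftS.
have be1 : 0 < be + ga by rewrite addr_gt0.
rewrite (_ : [sequence _]_n = (fun n => c 0%N * gk be t +
    series (fun k => c k.+1 * gk (ga * k%:R + (be + ga)) t) n)).
  apply: cvgD; first exact: cvg_cst.
  by apply: mlker_series_cvg => //; exact: rapid_shift.
apply/funext => n; rewrite /= /series /= big_nat_recl//= mulr0 add0r.
congr (_ + _); apply: eq_bigr => k _.
by rewrite -natr1; congr (_ * gk _ _); ring.
Qed.

Lemma mulr_mlker ga be c t : 0 < ga -> 0 < be -> rapid c ->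
  t * mlker ga be c t = mlker ga (be + 1) (fun k => (ga * k%:R + be) * c k) t.
Proof.
move=> ga0 be0 rc; apply/esym/mlker_lim; last first.
  by apply: cvgM; [exact: cvg_cst|exact: (mlker_series_cvg (c := c))].
move=> n; rewrite /series /= mulr_sumr.
apply: eq_bigr => k _; rewrite mulrCA mulr_gk ?gaS// addrA.
by rewrite mulrCA mulrA.
Qed.

(** Terms are grouped by residue modulo q: a geometric sequence of ratio w turns into geometric
    sequences of ratio w^q, at order q ga. *)
Lemma mlker_decimate (q : nat) ga be c t : (0 < q)%N -> 0 < ga -> 0 < be -> rapid c ->
  mlker ga be c t =
  \sum_(l < q) mlker (q%:R * ga) (ga * l%:R + be) (fun k => c (q * k + l)%N) t.
Proof.
move=> q0 ga0 be0 rc.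
have rq l : rapid (fun k => c (q * k + l)%N).
  move: rc => [C [r [C0 r0 cr]]]; exists (C * r ^+ l), (r ^+ q); split.
  - by rewrite mulr_ge0// exprn_ge0.
  - exact: exprn_ge0.
  - by move=> k; rewrite (le_trans (cr _))// exprD -exprM mulrA mulrAC.
have qga0 : 0 < q%:R * ga by rewrite mulr_gt0// ltr0n.
pose F i := c i * gk (ga * i%:R + be) t.
have sumF n : series F (q * n)%N = \sum_(l < q)
    series (fun k => c (q * k + l)%N * gk (q%:R * ga * k%:R + (ga * l%:R + be)) t) n.
  elim: n => [|n IH].
    by rewrite muln0 /series/= big_nil big1// => l _; rewrite big_nil.
  rewrite mulnS series_addn IH -[X in \sum_(X <= _ < _) _]add0n big_addn addnK big_mkord.
  under [RHS]eq_bigr do rewrite seriesSr.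
  rewrite big_split/=; congr (_ + _); apply: eq_bigr => l _.
  rewrite /F addnC natrD natrM; congr (_ * gk _ _); ring.
have lq : (fun n => series F (q * n)%N) @ \oo --> mlker ga be c t.
  apply: (@cvg_comp _ _ _ (fun n => (q * n)%N) (series F)); last exact: mlker_series_cvg.
  move=> P [m _ mP]; exists m => // n /= mn; apply: mP => /=.
  by rewrite (leq_trans mn)// leq_pmull.
have := cvg_lim _ lq; move=> <-//; apply/cvg_lim => //.
under eq_fun do rewrite sumF.
apply: cvg_big => [|l _]; first exact: add_continuous.
by apply: mlker_series_cvg => //; exact: gaS.
Qed.

Lemma EFin_mlker ga be c t : 0 < ga -> 0 < be -> rapid c ->
  ((mlker ga be c t)%:E = \sum_(k <oo) (c k * gk (ga * k%:R + be) t)%:E)%E.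
Proof.
move=> ga0 be0 rc; apply/esym/cvg_lim => //.
rewrite (_ : (fun n => _) = EFin \o series (fun k => c k * gk (ga * k%:R + be) t)).
  by apply: cvg_EFin; [exact: nearW|exact: mlker_series_cvg].
by apply/funext => n; rewrite /= sumEFin.
Qed.

Lemma mlker_ge0 ga be c t : 0 < ga -> 0 < be -> rapid c -> (forall k, 0 <= c k) ->
  0 <= mlker ga be c t.
Proof.
move=> ga0 be0 rc c0; rewrite -lee_fin EFin_mlker//.
by apply: nneseries_ge0 => k _ _; rewrite lee_fin mulr_ge0// gk_ge0// gaS.
Qed.

Lemma pos_mlker ga be c : on_half_line (mlker ga be c) = mlker ga be c.
Proof.
apply/funext => t; have [t0|t0] := leP t 0; last by rewrite posE.
by rewrite pos_le0// mlker_le0.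
Qed.

Lemma pos_gk a : on_half_line (gk a) = gk a :> (R -> R).
Proof.
apply/funext => t; have [t0|t0] := leP t 0; last by rewrite posE.
by rewrite pos_le0// gk_le0.
Qed.

(** Summation along antidiagonals is an interchange of sums once the k-th row is shifted right by k
    and padded with zeros. *)
Lemma nneseries_cauchy (u : nat -> nat -> \bar R) : (forall i j, 0 <= u i j)%E ->
  (\sum_(k <oo) \sum_(j <oo) u k j = \sum_(n <oo) \sum_(k < n.+1) u k (n - k)%N)%E.
Proof.
move=> u0; pose v k n := if (k <= n)%N then u k (n - k)%N else 0%E.
have v0 k n : (0 <= v k n)%E by rewrite /v; case: ifP.
transitivity (\sum_(k <oo) \sum_(n <oo) v k n)%E.
  apply: eq_eseriesr => k _.
  rewrite [RHS](nneseries_split 0 k)//.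
  rewrite add0n big_mkord big1 ?add0e; last first.
    by move=> i _; rewrite /v leqNgt ltn_ord.
  rewrite -[RHS]nneseries_addn//.
  by apply: eq_eseriesr => j _; rewrite /v leq_addl addnK.
rewrite nneseries_interchange//; apply: eq_eseriesr => n _.
rewrite (nneseries_split 0 n.+1)//.
rewrite add0n eseries0 ?adde0; last by move=> k nk _; rewrite /v leqNgt nk.
by rewrite big_mkord; apply: eq_bigr => k _; rewrite /v -ltnS ltn_ord.
Qed.

(** Nonnegative data allow term-by-term integration by monotone convergence. *)
Let EFin_convol_mlker f ga b d t : 0 < ga -> 0 < b -> rapid d ->
  (forall k, 0 <= d k) -> admissible f -> on_half_line f = f -> (forall s, 0 <= f s) ->
  ((convol f (mlker ga b d) t)%:E =
   \sum_(j <oo) (d j * convol f (gk (ga * j%:R + b)) t)%:E)%E.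
Proof.
move=> ga0 b0 rd d0 Wf pf f0.
have Wg j : admissible (gk (ga * j%:R + b)) by apply: admissible_gk; exact: gaS.
have mft : measurable_fun setT (fun s : R => f (t - s)).
  apply: measurableT_comp; last exact: measurable_funB.
  by rewrite -pf; exact: admissible_pos.
have ff j s : 0 <= f (t - s) * (d j * gk (ga * j%:R + b) s).
  by rewrite mulr_ge0// mulr_ge0// gk_ge0// gaS.
rewrite convol_integral//; last exact: admissible_mlker.
rewrite pf pos_mlker.
transitivity (\int[mu]_s \sum_(j <oo) (f (t - s) * (d j * gk (ga * j%:R + b) s))%:E)%E.
  apply: eq_integral => s _; rewrite EFinM EFin_mlker// -nneseriesZl//.
  by move=> j _; rewrite lee_fin mulr_ge0// gk_ge0// gaS.
rewrite integral_nneseries//; last 2 first.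
- move=> j; apply/measurable_EFinP; apply: measurable_funM => //.
  by apply: measurable_funM => //; exact: measurable_gk.
- by move=> j s _; rewrite lee_fin.
apply: eq_eseriesr => j _; rewrite -convolZr//.
rewrite convol_integral//; last exact: admissibleZ.
apply: eq_integral => s _; rewrite pf; congr (_ * _)%:E.
by have [s0|s0] := leP s 0; [rewrite pos_le0// gk_le0// mulr0|rewrite posE].
Qed.

Let convol_gk_mlker_ge0 a ga b d t : 0 < a -> 0 < ga -> 0 < b -> rapid d ->
  (forall k, 0 <= d k) ->
  convol (gk a) (mlker ga b d) t = mlker ga (a + b) d t.
Proof.
move=> a0 ga0 b0 rd d0; apply: EFin_inj.
rewrite EFin_convol_mlker//; [|exact: admissible_gk|exact: pos_gk|by move=> s; exact: gk_ge0].
rewrite EFin_mlker ?addr_gt0//; apply: eq_eseriesr => j _.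
by rewrite convol_gk ?gaS// addrCA.
Qed.

Let convol_mlker_ge0 ga be b c d t : 0 < ga -> 0 < be -> 0 < b ->
  rapid c -> rapid d -> (forall k, 0 <= c k) -> (forall k, 0 <= d k) ->
  convol (mlker ga be c) (mlker ga b d) t =
  mlker ga (be + b) (fun n => \sum_(k < n.+1) c k * d (n - k)%N) t.
Proof.
move=> ga0 be0 b0 rc rd c0 d0; apply: EFin_inj.
have bb : 0 < be + b by rewrite addr_gt0.
have Wc := admissible_mlker ga0 be0 rc.
have Wd := admissible_mlker ga0 b0 rd.
rewrite convolC// EFin_convol_mlker//; last 2 first.
- exact: pos_mlker.
- by move=> s; exact: mlker_ge0.
rewrite EFin_mlker//; last exact: rapid_convolution.
transitivity (\sum_(k <oo) \sum_(j <oo)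
    (c k * d j * gk (ga * (k + j)%:R + (be + b)) t)%:E)%E.
  apply: eq_eseriesr => k _.
  rewrite convolC//; last by apply: admissible_gk; exact: gaS.
  have gk0 := gaS k ga0 be0; have gkb0 := addr_gt0 gk0 b0.
  rewrite convol_gk_mlker_ge0// EFinM (EFin_mlker t ga0 gkb0 rd) -nneseriesZl.
    apply: eq_eseriesr => j _; rewrite -EFinM -mulrA natrD.
    by congr (_ * (_ * gk _ _))%:E; ring.
  by move=> j _; rewrite lee_fin mulr_ge0// gk_ge0// gaS.
rewrite nneseries_cauchy; last first.
  by move=> i j; rewrite lee_fin !mulr_ge0// gk_ge0// gaS.
apply: eq_eseriesr => n _; rewrite sumEFin mulr_suml; congr (_%:E).
by apply: eq_bigr => k _; rewrite subnKC// -ltnS.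
Qed.

(** The nonnegative case comes from monotone convergence; both sides are bilinear, so splitting each
    sequence into positive and negative parts gives the general one. *)
Lemma convol_mlker ga be b c d : 0 < ga -> 0 < be -> 0 < b ->
  rapid c -> rapid d ->
  convol (mlker ga be c) (mlker ga b d) =
  mlker ga (be + b) (fun n => \sum_(k < n.+1) c k * d (n - k)%N).
Proof.
move=> ga0 be0 b0 rc rd; apply/funext => t.
have bb : 0 < be + b by rewrite addr_gt0.
pose p (e : nat -> R) k := Num.max (e k) 0.
pose m (e : nat -> R) k := Num.max (- e k) 0.
have pmE e : e = (fun k => p e k - m e k).
  by apply/funext => k; rewrite /p /m; case: (leP (e k) 0); case: (leP (- e k) 0); lra.
have p0 e k : 0 <= p e k by rewrite /p le_max lexx orbT.
have m0 e k : 0 <= m e k by rewrite /m le_max lexx orbT.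
have rp e : rapid e -> rapid (p e).
  move=> re; apply: rapid_le re _ => k; rewrite ger0_norm// /p ge_max normr_ge0.
  by rewrite ler_norm.
have rm e : rapid e -> rapid (m e).
  move=> re; apply: rapid_le re _ => k; rewrite ger0_norm// /m ge_max normr_ge0.
  by rewrite -normrN ler_norm.
have [[[rpc rmc] rpd] rmd] := (rp _ rc, rm _ rc, rp _ rd, rm _ rd).
have dE (e : nat -> R) b' : rapid e -> 0 < b' ->
    mlker ga b' e = (fun t => mlker ga b' (p e) t - mlker ga b' (m e) t).
  move=> re b'0; apply/funext => s; rewrite -mlkerB//; [|exact: rp|exact: rm].
  by rewrite -pmE.
rewrite (dE c)// (dE d)//.
have Wpc := admissible_mlker ga0 be0 rpc.
have Wmc := admissible_mlker ga0 be0 rmc.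
have Wpd := admissible_mlker ga0 b0 rpd.
have Wmd := admissible_mlker ga0 b0 rmd.
rewrite convolBl//; last exact: admissibleB.
rewrite !convolBr// !convol_mlker_ge0//.
rewrite -!mlkerB//; try by [apply: rapid_convolution|do ?apply: rapidB; exact: rapid_convolution].
congr (mlker _ _ _ t); apply/funext => n; rewrite -!sumrB; apply: eq_bigr => k _.
by rewrite [in RHS](pmE c) [in RHS](pmE d); ring.
Qed.

(** The unit for the Cauchy product; its kernel is a Riemann-Liouville kernel, which makes
    convolution with [gk] an instance of [convol_mlker]. *)
Let delta0 (k : nat) : R := (k == 0)%:R.

Let rapid_delta0 : rapid delta0.
Proof.
exists 1, 1; split=> // k; rewrite expr1n mulr1 /delta0.
by case: eqP; rewrite ?normr1 ?normr0.
Qed.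

Lemma gk_mlker ga b : 0 < ga -> 0 < b -> gk b = mlker ga b delta0.
Proof.
move=> ga0 b0; apply/funext => t; rewrite mlker_shift//.
by rewrite (@eq_mlker _ _ _ (fun=> 0))// mlker0 /delta0 eqxx mul1r addr0.
Qed.

Lemma convol_mlker_gk ga be b c : 0 < ga -> 0 < be -> 0 < b -> rapid c ->
  convol (mlker ga be c) (gk b) = mlker ga (be + b) c.
Proof.
move=> ga0 be0 b0 rc; rewrite (gk_mlker ga0 b0) convol_mlker//.
apply: eq_mlker => n; rewrite big_ord_recr/= subnn /delta0 eqxx mulr1.
rewrite big1 ?add0r// => k _; rewrite subn_eq0 leqNgt ltn_ord/= mulr0//.
Qed.

Lemma convol_gk_mlker ga be b c : 0 < ga -> 0 < be -> 0 < b -> rapid c ->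
  convol (gk b) (mlker ga be c) = mlker ga (b + be) c.
Proof.
move=> ga0 be0 b0 rc; rewrite addrC -convol_mlker_gk//; apply/funext => t.
by rewrite convolC//; [exact: admissible_gk|exact: admissible_mlker].
Qed.

End mittag_leffler_algebra.

(** * The scalar relaxation kernel: positivity and integrability *)

Section relaxation.
Context {R : realType}.
Context (ga c : R) (ga0 : 0 < ga) (ga1 : ga <= 1) (c0 : 0 < c).
Implicit Types (be s t T : R).

Let geo k : R := (- c) ^+ k.
Let rgeo : rapid geo. Proof. exact: rapid_geo. Qed.
Let g : R -> R := gk ga.
Let Wg : admissible g. Proof. exact: admissible_gk. Qed.
Let W1 := admissible_gk (@ltr01 R).
Let r := mlker ga ga geo.
Let Wr : admissible r. Proof. exact: admissible_mlker. Qed.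

Let mlker_geo be : 0 < be ->
  mlker ga be geo = (fun t => gk be t - c * mlker ga (be + ga) geo t).
Proof.
move=> be0; apply/funext => t; rewrite mlker_shift// /geo expr0 mul1r.
congr (_ + _); rewrite -mulNr -mlkerZ//; last exact: addr_gt0.
by congr (mlker _ _ _ _); apply/funext => k; rewrite exprS.
Qed.

Let g_gt0 t : 0 < t -> 0 < g t. Proof. exact: gk_gt0. Qed.
Let g_ge0 t : 0 <= g t. Proof. exact: gk_ge0. Qed.

Let g_le s t : 0 < s -> s <= t -> g t <= g s.
Proof.
move=> s0 st; rewrite /g !gkE//; last exact: lt_le_trans st.
by rewrite ler_wpM2r ?invr_ge0 ?(ltW (Gamma_gt0 _))// le0_ler_powR// subr_le0.
Qed.

(* Log-convexity of g: the ratio g (t - s) / g t decreases with t. *)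
Let g_ratio s t T : 0 < s < t -> t <= T -> g (T - s) * g t <= g T * g (t - s).
Proof.
move=> /andP[s0 st] tT; have t0 := lt_trans s0 st; have T0 := lt_le_trans t0 tT.
have [ts Ts] : 0 < t - s /\ 0 < T - s by rewrite !subr_gt0; split=> //; exact: lt_le_trans tT.
rewrite /g !gkE// mulrACA [leRHS]mulrACA ler_wpM2r//.
  by rewrite mulr_ge0 ?invr_ge0 ?(ltW (Gamma_gt0 _)).
rewrite -powRM ?(ltW Ts) ?(ltW t0)// -powRM ?(ltW T0) ?(ltW ts)//.
apply: le0_ler_powR; [exact: mulr_gt0| |by rewrite subr_le0].
by rewrite mulrBl mulrBr lerD2l lerN2 [leRHS]mulrC ler_wpM2l ?(ltW s0).
Qed.

Let relaxE t : r t = g t - c * convol g r t.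
Proof. by rewrite /r {1}mlker_geo// convol_gk_mlker. Qed.

(** Near 0 the term t^(ga - 1) / Gamma(ga) dominates the correction, which is O(t^(2 ga - 1)). *)
Let relax_small : exists2 d, 0 < d & forall t, 0 < t < d -> 0 < r t.
Proof.
have gg0 : 0 < ga + ga by exact: addr_gt0.
have [C C0 rC] := mlker_bound 1 ga0 gg0 rgeo.
have G0 := Gamma_gt0 ga0.
have e0 : 0 < (Gamma ga)^-1 / (c * C + 1).
  by rewrite divr_gt0 ?invr_gt0// ltr_wpDl// mulr_ge0// ltW.
have [d d0 dP] := powR_small e0 ga0.
exists (Num.min d 1); first by rewrite lt_min d0/=.
move=> t /andP[t0]; rewrite lt_min => /andP[td t1].
rewrite relaxE /r convol_gk_mlker// subr_gt0.
apply: (@le_lt_trans _ _ (c * (C * t `^ (ga + ga - 1)))).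
  rewrite ler_wpM2l ?(ltW c0)// (le_trans (ler_norm _))// rC// t0 ltW//.
have -> : t `^ (ga + ga - 1) = t `^ ga * t `^ (ga - 1) by rewrite -addrA (gt0_powRD ga (ga - 1) t0).
rewrite /g gkE// !mulrA [X in _ < X]mulrC.
rewrite ltr_pM2r ?powR_gt0//.
have : t `^ ga < (Gamma ga)^-1 / (c * C + 1) by rewrite dP// t0 ltW.
rewrite ltr_pdivlMr; last by rewrite ltr_wpDl// mulr_ge0// ltW.
by apply: le_lt_trans; rewrite mulrC ler_wpM2l ?powR_ge0// lerDl.
Qed.

Let relax_cont t : 0 < t -> {for t, continuous r}.
Proof. by move=> t0; exact: mlker_continuous. Qed.

(** Log-convexity carries the history on ]0, s[ from time t back to time s: g(t - x) / g(t) <= g(s -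
    x) / g(s), weighted by r(x) >= 0. *)
Let head_convol_le s t : 0 < s <= t -> (forall x, 0 < x < s -> 0 <= r x) ->
  g s * convol g (r \_ `]-oo, s[%classic) t <= g t * convol g r s.
Proof.
move=> /andP[s0 st] r0.
have Wp : admissible (r \_ `]-oo, s[%classic) by exact: admissible_patch.
rewrite -!convolZr// -lee_fin !convol_integral//; try exact: admissibleZ.
apply: le_integral; [by []|by apply: convol_integrable => //; exact: admissibleZ..|].
move=> x _; rewrite lee_fin.
have [x0|x0] := leP x 0; first by rewrite ![on_half_line _ x]pos_le0// !mulr0.
have [sx|xs] := leP s x.
  rewrite [in leRHS]pos_le0 ?subr_le0// mul0r [X in _ * X]posE// patchE.
  by rewrite memNset ?mulr0//= in_itv/= (ltNge x s) sx.
rewrite !posE ?subr_gt0 ?(lt_le_trans xs st)// patchE mem_set/= ?in_itv//=.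
rewrite !mulrA ler_wpM2r ?r0 ?x0// [leRHS]mulrC; apply: g_ratio => //.
by rewrite x0.
Qed.

(** [gk (ga + 1) d] is the integral of g over ]0, d[, a window longer than t - s. *)
Let tail_convol_le s t d M : 0 < s <= t -> t - s < d -> 0 <= M ->
  (forall x, s <= x < t -> r x <= M) ->
  convol g (r \_ `[s, +oo[%classic) t <= M * gk (ga + 1) d.
Proof.
move=> /andP[s0 st] std M0 rM.
have Wp : admissible (r \_ `[s, +oo[%classic) by exact: admissible_patch.
have -> : M * gk (ga + 1) d = convol (fun x => M * gk 1 x) g d.
  by rewrite convolZl// convol1_gk.
rewrite convolC// -lee_fin !convol_integral//; try exact: admissibleZ.
apply: le_integral; [by []|by apply: convol_integrable => //; exact: admissibleZ..|].
move=> x _; rewrite lee_fin.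
have [x0|x0] := leP x 0; first by rewrite ![on_half_line _ x]pos_le0// !mulr0.
rewrite ler_wpM2r//; first by rewrite posE.
have R0 : 0 <= on_half_line (fun x => M * gk 1 x) (d - x).
  have [y0|y0] := leP (d - x) 0; [by rewrite pos_le0|].
  by rewrite posE// mulr_ge0// gk_ge0.
have [tx|xt] := leP t x; first by rewrite pos_le0 ?subr_le0.
rewrite posE ?subr_gt0// patchE; case: ifPn => [/set_mem/=|//].
rewrite in_itv/= andbT => stx.
have xd : x < d by rewrite (le_lt_trans _ std)// lerBrDr addrC -lerBrDr.
by rewrite posE ?subr_gt0// gk1 ?subr_gt0// mulr1 rM// stx ltrBlDr ltrDl.
Qed.

(** Let z be the first point with r <= 0 and m a maximum point of r on a short interval [z - h, z].
    By log-convexity the history before m weighs at z, relative to g, no more than it did at m, so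
    r(z) <= 0 must be due to the stretch from m to z. There r <= r(m), and so short a stretch
    contributes too little. *)
Lemma relax_gt0 t : 0 < t -> 0 < r t.
Proof.
move=> t0; rewrite ltNge; apply/negP => rt.
pose S := [set x : R | 0 < x /\ r x <= 0].
have [d d0 dP] := relax_small.
have Sd : lbound S d.
  move=> x [x0 rx]; rewrite leNgt; apply/negP => xd.
  by move: rx; rewrite leNgt dP// x0.
have iS : has_inf S by split; [exists t|exists d].
pose z := inf S.
have z0 : 0 < z by rewrite (lt_le_trans d0)// lb_le_inf//; exists t.
have r_gt0 x : 0 < x < z -> 0 < r x.
  move=> /andP[x0 xz]; rewrite ltNge; apply/negP => rx.
  by move: xz; rewrite ltNge => /negP; apply; apply: ge_inf => //; exists d.
have rz : r z <= 0.
  rewrite leNgt; apply/negP => rz.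
  have /= : \forall x \near z, 0 < r x by apply: (cvgr_gt _ (relax_cont z0)).
  move=> [e /= e0 eP]; have [x [x0 rx] xe] := inf_adherent e0 iS.
  have zx : z <= x by apply: ge_inf => //; exists d.
  move: rx; rewrite leNgt => /negP; apply; apply: eP.
  by rewrite /ball_/= distrC ger0_norm ?subr_ge0// ltrBlDl.
(* This threshold makes (2 h)^ga / Gamma(ga + 1), the integral of g over ]0, 2 h[, smaller than 1 /
   (2 c). *)
have e0 : 0 < Gamma (ga + 1) / (2 * c) by rewrite divr_gt0 ?Gamma_gt0 ?addr_gt0 ?mulr_gt0.
have [e e1 eP] := powR_small e0 ga0.
(* h <= z / 2 keeps m >= z / 2, where g(m) <= 2 g(z). *)
pose h := Num.min (e / 2) (z / 2).
have h0 : 0 < h by rewrite lt_min !divr_gt0.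
have [he hz] : h <= e / 2 /\ h <= z / 2 by rewrite !ge_min !lexx orbT.
have zh0 : 0 < z - h by lra.
have [m mI mP] : exists2 m, m \in `[z - h, z] & forall x, x \in `[z - h, z] -> r x <= r m.
  apply: EVT_max; first by lra.
  apply: continuous_in_subspaceT => x /set_mem/=; rewrite in_itv/= => /andP[x0 _].
  by apply: relax_cont; rewrite (lt_le_trans zh0).
have M0 : 0 < r m.
  apply: (@lt_le_trans _ _ (r (z - h))); first by apply: r_gt0; rewrite zh0; lra.
  by apply: mP; rewrite in_itv/= lexx; lra.
move: mI; rewrite in_itv/= => /andP[zhm].
rewrite le_eqVlt => /predU1P[mz|mz]; first by move: M0; rewrite mz ltNge rz.
have m0 : 0 < m by lra.
have m0z : 0 < m <= z by rewrite m0 ltW.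
have H1 : g m * convol g (r \_ `]-oo, m[%classic) z <= g z * convol g r m.
  apply: head_convol_le => // x /andP[x0 xm]; apply/ltW/r_gt0.
  by rewrite x0 (lt_trans xm).
have H2 : convol g (r \_ `[m, +oo[%classic) z <= r m * gk (ga + 1) (2 * h).
  apply: tail_convol_le => //; [by lra|exact: ltW|].
  by move=> x /andP[mx xz]; apply: mP; rewrite in_itv/= (le_trans zhm)//= ltW.
have H3 : convol g r z = convol g (r \_ `]-oo, m[%classic) z +
    convol g (r \_ `[m, +oo[%classic) z.
  rewrite -convolDr//; try exact: admissible_patch.
  apply: eq_convol => // x _; rewrite !patchE.
  have [xm|mx] := ltP x m.
    by rewrite mem_set/= ?in_itv//= memNset/= ?in_itv/= ?addr0// andbT leNgt xm.
  have -> : (x \in `]-oo, m[%classic) = false.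
    by apply/negbTE/negP; rewrite inE/= in_itv/= ltNge mx.
  by rewrite mem_set/= ?add0r// in_itv/= mx.
have gz0 := g_gt0 z0; have gm0 := g_gt0 m0.
have gmz : g m <= 2 * g z.
  rewrite /g !gkE// mulrA ler_wpM2r ?invr_ge0 ?(ltW (Gamma_gt0 _))//.
  apply: (@le_trans _ _ ((z / 2) `^ (ga - 1))).
    by apply: le0_ler_powR; [lra|lra|rewrite subr_le0].
  rewrite powRM ?(ltW z0)// mulrC ler_wpM2r ?powR_ge0//.
  rewrite -powR_inv1// -powRrM mulN1r opprB.
  by rewrite -[leRHS](@powRr1 R 2)// ler_powR ?ler1n// gerBl ltW.
have G2 : 2 * c * gk (ga + 1) (2 * h) < 1.
  rewrite gkE ?mulr_gt0// addrK mulrA ltr_pdivrMr ?Gamma_gt0 ?addr_gt0// mul1r.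
  rewrite mulrC -ltr_pdivlMr ?mulr_gt0// eP// mulr_gt0//=.
  by lra.
move: (gk (ga + 1) (2 * h)) H2 G2 (@gk_ge0 R (ga + 1) (2 * h) (addr_gt0 ga0 ltr01)).
move=> G H2 G2 G0.
have := relaxE z; have := relaxE m; rewrite H3.
move: (convol g r m) (convol g _ z) (convol g _ z) H1 H2 => X B A H1 H2 Em Ez.
(* [K1] is r(z) <= 0; [K2] inserts the head and tail bounds; [K3] uses the equation at m; [K4] uses
   g(m) <= 2 g(z) to bring out the factor 2 c G < 1. *)
have K1 : g z <= c * (A + B) by rewrite -subr_le0 -Ez.
have K2 : g z * g m <= c * (g z * X) + c * (g m * (r m * G)).
  rewrite -mulrDr (le_trans (ler_wpM2r (ltW gm0) K1))// -mulrA ler_wpM2l ?(ltW c0)//.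
  by rewrite mulrC mulrDr lerD// ler_wpM2l// ltW.
have K3 : g z * r m <= c * (g m * (r m * G)).
  have -> : g z * r m = g z * g m - c * (g z * X) by rewrite Em; ring.
  by rewrite lerBlDl.
have K4 : c * (g m * (r m * G)) <= (2 * c * G) * (g z * r m).
  rewrite (_ : _ * (g z * r m) = c * (2 * g z * (r m * G))); last by ring.
  rewrite ler_wpM2l ?(ltW c0)// ler_wpM2r// mulr_ge0// ltW//.
have : g z * r m < g z * r m.
  apply: le_lt_trans K3 (le_lt_trans K4 _).
  by rewrite gtr_pMl// mulr_gt0.
by rewrite ltxx.
Qed.

(** Positivity gives c (g * r) <= g, and since g is nonincreasing, g(T) times the integral of r is
    at most (g * r)(T); dividing by g(T) leaves 1 / c. *)
Lemma relax_l1 T : l1 r T <= c^-1.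
Proof.
have [T0|T0] := leP T 0; first by rewrite /l1 convol_le0// invr_ge0 ltW.
have H : g T * l1 r T <= convol g r T.
  rewrite /l1 -convolZl//; last exact: admissible_norm.
  apply: ler_convol => //; [exact: admissibleZ|exact: admissible_norm|..].
    move=> s /andP[s0 sT]; rewrite gk1// mulr1 g_ge0/= g_le// ltW//.
  by move=> s /andP[s0 _]; rewrite normr_ge0 (gtr0_norm (relax_gt0 s0)) lexx.
have := ltW (relax_gt0 T0); rewrite relaxE subr_ge0 => K.
have gT0 := g_gt0 T0.
rewrite -[c^-1]mul1r ler_pdivlMr// -(ler_pM2l gT0) mulr1 mulrA.
by apply: le_trans K; rewrite mulrC ler_wpM2l ?(ltW c0).
Qed.

(** The relaxation function E_ga(-c t^ga). *)
Let u := mlker ga 1 geo.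

Let uE t : 0 < t -> u t = 1 - c * l1 r t.
Proof.
move=> t0; rewrite /u mlker_geo// gk1// -convol_gk_mlker//.
congr (_ - _ * _); apply: eq_convol => // s /andP[s0 _].
by rewrite (gtr0_norm (relax_gt0 s0)).
Qed.

Let u_ge0 t : 0 <= u t.
Proof.
have [t0|t0] := leP t 0; first by rewrite /u mlker_le0.
by rewrite uE// subr_ge0 mulrC -ler_pdivlMr// mul1r relax_l1.
Qed.

Let u_le1 t : u t <= 1.
Proof.
have [t0|t0] := leP t 0; first by rewrite /u mlker_le0.
by rewrite uE// gerBl mulr_ge0 ?l1_ge0// ltW.
Qed.

Let Wu : admissible u. Proof. exact: admissible_mlker. Qed.

(** u is nonincreasing, so u(t) times the integral of g up to t is at most (g * u)(t) = (1 - u(t)) /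
    c. Hence u(t) = O(t^(-ga)). *)
Let u_decay t : 0 < t -> c * u t * gk (ga + 1) t <= 1.
Proof.
move=> t0; have E : u t = 1 - c * convol g u t.
  by rewrite {1}/u mlker_geo// gk1// /g /u convol_gk_mlker// (addrC ga 1).
have H : u t * gk (ga + 1) t <= convol g u t.
  have -> : u t * gk (ga + 1) t = convol (fun s => u t * gk 1 s) g t.
    by rewrite convolZl// convol1_gk.
  rewrite [leRHS]convolC//; apply: ler_convol => //; first exact: admissibleZ.
    move=> s /andP[s0 st]; rewrite gk1// mulr1 u_ge0/= !uE// lerD2l lerN2.
    by rewrite ler_wpM2l ?(ltW c0)// ler_l1// ltW.
  by move=> s _; rewrite g_ge0/=.
rewrite -mulrA (le_trans (ler_wpM2l (ltW c0) H))//.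
by move: (u_ge0 t); rewrite E subr_ge0.
Qed.

(** For be < ga the kernel v has no fixed sign. But v <= p with p = [gk be] u, because [gk be] is
    nonincreasing, so |v| <= 2 p - v. The running integral of v is [gk be] * u >= 0, and p is
    integrable by the decay of u. *)
Lemma relax_inL1 be : 0 < be -> be <= ga -> inL1 (mlker ga be geo).
Proof.
move=> be0; rewrite le_eqVlt => /predU1P[->|bega].
  by split=> //; exists c^-1 => T; exact: relax_l1.
set v := mlker ga be geo.
have Wv : admissible v by exact: admissible_mlker.
have Wb := admissible_gk be0.
pose p t := gk be t * u t.
have p0 t : 0 <= p t by rewrite mulr_ge0 ?gk_ge0.
have p_le t : p t <= gk be t by rewrite ler_piMr ?gk_ge0.
have Wp : admissible p.
  apply: (admissible_le Wb).
    by apply: measurable_funM; [exact: measurable_funTS (measurable_gk _)|exact: Wu.1].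
  by move=> t _; rewrite !ger0_norm ?gk_ge0.
have vE t : v t = gk be t - c * convol (gk be) r t.
  by rewrite /v {1}mlker_geo// convol_gk_mlker.
have v_le t : 0 < t -> `|v t| <= 2 * p t - v t.
  move=> t0; have n0 : gk be t * l1 r t <= convol (gk be) r t.
    rewrite /l1 -convolZl//; last exact: admissible_norm.
    apply: ler_convol => //; [exact: admissibleZ|exact: admissible_norm|..].
      move=> s /andP[s0 st]; rewrite gk1// mulr1 gk_ge0//= !gkE//.
      rewrite ler_wpM2r ?invr_ge0 ?(ltW (Gamma_gt0 _))//.
      by apply: le0_ler_powR => //; [exact: ltW|rewrite subr_le0 (le_trans (ltW bega))].
    by move=> s /andP[s0 _]; rewrite normr_ge0 (gtr0_norm (relax_gt0 s0)) lexx.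
  have vp : v t <= p t.
    rewrite vE /p uE// mulrBr mulr1 lerD2l lerN2 mulrCA ler_wpM2l// ltW//.
  have := p0 t; rewrite ler_norml; lra.
have Lp : inL1 p.
  have [G0 G1] := (Gamma_gt0 be0, Gamma_gt0 (addr_gt0 ga0 ltr01)).
  apply: (@inL1_powR _ _ (Gamma be)^-1 be (Gamma (ga + 1) / c / Gamma be) (ga - be)) => //.
  - by rewrite invr_ge0 ltW.
  - by rewrite !divr_ge0 ?ltW.
  - by rewrite subr_gt0.
  - move=> t /andP[t0 _]; rewrite ger0_norm// (le_trans (p_le t))// gkE//.
    by rewrite mulrC.
  move=> t t1; have t0 : 0 < t by rewrite (lt_le_trans ltr01).
  rewrite ger0_norm// /p gkE//.
  have := u_decay t0; rewrite gkE// addrK mulrA ler_pdivrMr// mul1r => K.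
  have -> : - (ga - be) - 1 = (be - 1) - ga by ring.
  rewrite (gt0_powRD (be - 1) (- ga) t0) powRN.
  have tg0 : 0 < t `^ ga by rewrite powR_gt0.
  have {}K : u t <= Gamma (ga + 1) / c / t `^ ga.
    by rewrite ler_pdivlMr// ler_pdivlMr// mulrC mulrA.
  apply: (@le_trans _ _ (t `^ (be - 1) / Gamma be * (Gamma (ga + 1) / c / t `^ ga))).
    by rewrite ler_wpM2l ?divr_ge0 ?powR_ge0 ?(ltW G0).
  by move: (Gamma be)^-1 => x; rewrite le_eqVlt; apply/orP; left; apply/eqP; ring.
have L1v T : l1 v T <= 2 * l1 p T.
  have -> : 2 * l1 p T = convol (gk 1) (fun s => 2 * p s) T.
    rewrite convolZr//; congr (_ * _); apply: eq_convol => // s _.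
    by rewrite ger0_norm.
  have V0 : 0 <= convol (gk 1) v T.
    rewrite /v convol_gk_mlker// addrC -convol_gk_mlker//.
    by rewrite -/u; apply: convol_ge0 => s _; [exact: gk_ge0|exact: u_ge0].
  apply: (@le_trans _ _ (convol (gk 1) (fun s => 2 * p s - v s) T)).
    apply: ler_convol => //; [exact: admissible_norm| |by move=> s _; rewrite gk_ge0/=|].
      by apply: admissibleB => //; exact: admissibleZ.
    by move=> s /andP[s0 _]; rewrite normr_ge0 v_le.
  by rewrite convolBr//; [rewrite gerBl|exact: admissibleZ].
split=> //; have [_ [B pB]] := Lp; exists (2 * B) => T.
by rewrite (le_trans (L1v T))// ler_wpM2l.
Qed.

End relaxation.

(** * Complex coefficient sequences *)

Section complex_coefficients.
Context {R : realType}.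
Implicit Types (x y l mu : R[i]) (z w : nat -> R[i]) (ga be b t T : R).
Local Notation Re := complex.Re.
Local Notation Im := complex.Im.
Local Notation normc := Normc.normc.

Lemma ReD x y : Re (x + y) = Re x + Re y. Proof. by case: x; case: y. Qed.
Lemma ImD x y : Im (x + y) = Im x + Im y. Proof. by case: x; case: y. Qed.
Lemma ReM x y : Re (x * y) = Re x * Re y - Im x * Im y.
Proof. by case: x; case: y. Qed.
Lemma ImM x y : Im (x * y) = Re x * Im y + Im x * Re y.
Proof. by case: x => a b'; case: y => c d. Qed.

Lemma Re_sum (I : Type) (s : seq I) (P : pred I) (F : I -> R[i]) :
  Re (\sum_(i <- s | P i) F i) = \sum_(i <- s | P i) Re (F i).
Proof. by elim/big_rec2: _ => // i x y _ <-; rewrite ReD. Qed.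

Lemma Im_sum (I : Type) (s : seq I) (P : pred I) (F : I -> R[i]) :
  Im (\sum_(i <- s | P i) F i) = \sum_(i <- s | P i) Im (F i).
Proof. by elim/big_rec2: _ => // i x y _ <-; rewrite ImD. Qed.

Lemma normcX x n : normc (x ^+ n) = normc x ^+ n.
Proof. by elim: n => [|n IH]; [exact: Normc.normc1|rewrite !exprS Normc.normcM IH]. Qed.

Lemma normc_ge0 x : 0 <= normc x.
Proof. by case: x => a b'; rewrite sqrtr_ge0. Qed.

Lemma normc_sqr x : normc x ^+ 2 = Re x ^+ 2 + Im x ^+ 2.
Proof. by case: x => a b' /=; rewrite sqr_sqrtr// addr_ge0 ?sqr_ge0. Qed.

Lemma Re_le_normc x : `|Re x| <= normc x.
Proof.
rewrite -(@ler_pXn2r _ 2) ?nnegrE ?normc_ge0//.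
by rewrite normc_sqr real_normK ?num_real// lerDl sqr_ge0.
Qed.

Lemma Im_le_normc x : `|Im x| <= normc x.
Proof.
rewrite -(@ler_pXn2r _ 2) ?nnegrE ?normc_ge0//.
by rewrite normc_sqr real_normK ?num_real// lerDr sqr_ge0.
Qed.

Definition reseq z k := Re (z k).
Definition imseq z k := Im (z k).

Definition rapidC z := rapid (reseq z) /\ rapid (imseq z).

Definition cauchyC z w n := \sum_(k < n.+1) z k * w (n - k)%N.

(** Real and imaginary parts are kept as two real kernels, so that no complex integral occurs. *)
Definition cL1 ga be z := inL1 (mlker ga be (reseq z)) /\ inL1 (mlker ga be (imseq z)).

Lemma rapidC_normc z (C r : R) : 0 <= C -> 0 <= r ->
  (forall k, normc (z k) <= C * r ^+ k) -> rapidC z.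
Proof.
move=> C0 r0 zC; split; exists C, r; split=> // k.
  exact: le_trans (Re_le_normc _) (zC k).
exact: le_trans (Im_le_normc _) (zC k).
Qed.

Lemma rapidC_geo x : rapidC (fun k => x ^+ k).
Proof.
apply: (@rapidC_normc _ 1 (normc x)) => //; first exact: normc_ge0.
by move=> k; rewrite normcX mul1r.
Qed.

Lemma rapidCD z w : rapidC z -> rapidC w -> rapidC (fun k => z k + w k).
Proof.
move=> [rz iz] [rw iw]; split; rewrite /reseq /imseq.
  by under eq_fun do rewrite ReD; exact: rapidD.
by under eq_fun do rewrite ImD; exact: rapidD.
Qed.

Lemma rapidCZ x z : rapidC z -> rapidC (fun k => x * z k).
Proof.
move=> [rz iz]; split; rewrite /reseq /imseq.
  by under eq_fun do rewrite ReM; apply: rapidB; exact: rapidZ.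
by under eq_fun do rewrite ImM; apply: rapidD; exact: rapidZ.
Qed.

Lemma rapidC_shift z : rapidC z -> rapidC (fun k => z k.+1).
Proof.
by move=> [rz iz]; split; [exact: (rapid_shift rz)|exact: (rapid_shift iz)].
Qed.

Let re_cauchy z w : reseq (cauchyC z w) = fun n =>
  (\sum_(k < n.+1) reseq z k * reseq w (n - k)%N) -
  (\sum_(k < n.+1) imseq z k * imseq w (n - k)%N).
Proof.
apply/funext => n; rewrite /reseq /imseq Re_sum -sumrB.
by apply: eq_bigr => k _; rewrite ReM.
Qed.

Let im_cauchy z w : imseq (cauchyC z w) = fun n =>
  (\sum_(k < n.+1) reseq z k * imseq w (n - k)%N) +
  (\sum_(k < n.+1) imseq z k * reseq w (n - k)%N).
Proof.
apply/funext => n; rewrite /reseq /imseq Im_sum -big_split.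
by apply: eq_bigr => k _; rewrite ImM.
Qed.

Lemma eq_cL1 ga be z w : z =1 w -> cL1 ga be z -> cL1 ga be w.
Proof. by move=> /funext ->. Qed.

Lemma cL1D ga be z w : 0 < ga -> 0 < be -> rapidC z -> rapidC w ->
  cL1 ga be z -> cL1 ga be w -> cL1 ga be (fun k => z k + w k).
Proof.
move=> ga0 be0 [rz iz] [rw iw] [Lz Mz] [Lw Mw]; split; rewrite /reseq /imseq.
  under eq_fun do rewrite ReD; rewrite (_ : mlker _ _ _ =
    (fun t => mlker ga be (reseq z) t + mlker ga be (reseq w) t)); first exact: inL1D.
  by apply/funext => t; rewrite mlkerD.
under eq_fun do rewrite ImD; rewrite (_ : mlker _ _ _ =
  (fun t => mlker ga be (imseq z) t + mlker ga be (imseq w) t)); first exact: inL1D.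
by apply/funext => t; rewrite mlkerD.
Qed.

Lemma cL1Z ga be x z : 0 < ga -> 0 < be -> rapidC z ->
  cL1 ga be z -> cL1 ga be (fun k => x * z k).
Proof.
move=> ga0 be0 [rz iz] [Lz Mz]; split; rewrite /reseq /imseq.
  under eq_fun do rewrite ReM; rewrite (_ : mlker _ _ _ =
    (fun t => Re x * mlker ga be (reseq z) t - Im x * mlker ga be (imseq z) t)).
    by apply: inL1B; exact: inL1Z.
  by apply/funext => t; rewrite mlkerB ?mlkerZ//; exact: rapidZ.
under eq_fun do rewrite ImM; rewrite (_ : mlker _ _ _ =
  (fun t => Re x * mlker ga be (imseq z) t + Im x * mlker ga be (reseq z) t)).
  by apply: inL1D; exact: inL1Z.
by apply/funext => t; rewrite mlkerD ?mlkerZ//; exact: rapidZ.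
Qed.

Lemma cL1_cauchy ga be b z w : 0 < ga -> 0 < be -> 0 < b -> rapidC z -> rapidC w ->
  cL1 ga be z -> cL1 ga b w -> cL1 ga (be + b) (cauchyC z w).
Proof.
move=> ga0 be0 b0 [rz iz] [rw iw] [Lz Mz] [Lw Mw].
have bb : 0 < be + b by rewrite addr_gt0.
split; rewrite ?re_cauchy ?im_cauchy.
  rewrite (_ : mlker _ _ _ = (fun t =>
    convol (mlker ga be (reseq z)) (mlker ga b (reseq w)) t -
    convol (mlker ga be (imseq z)) (mlker ga b (imseq w)) t)).
    by apply: inL1B; exact: inL1_convol.
  by apply/funext => t; rewrite mlkerB ?convol_mlker//; exact: rapid_convolution.
rewrite (_ : mlker _ _ _ = (fun t =>
  convol (mlker ga be (reseq z)) (mlker ga b (imseq w)) t +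
  convol (mlker ga be (imseq z)) (mlker ga b (reseq w)) t)).
  by apply: inL1D; exact: inL1_convol.
by apply/funext => t; rewrite mlkerD ?convol_mlker//; exact: rapid_convolution.
Qed.

Lemma cL1_shift ga be z : 0 < ga -> 0 < be -> rapidC z -> z 0%N = 0 ->
  cL1 ga (be + ga) (fun k => z k.+1) -> cL1 ga be z.
Proof.
move=> ga0 be0 [rz iz] z0 [L M]; split.
  rewrite (_ : mlker _ _ _ = mlker ga (be + ga) (reseq (fun k => z k.+1)))//.
  by apply/funext => t; rewrite mlker_shift// /reseq z0 mul0r add0r.
rewrite (_ : mlker _ _ _ = mlker ga (be + ga) (imseq (fun k => z k.+1)))//.
by apply/funext => t; rewrite mlker_shift// /imseq z0 mul0r add0r.
Qed.

End complex_coefficients.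

(** * Kernels of geometric sequences with ratio in the open left half plane *)

Section complex_relaxation.
Context {R : realType}.
Local Notation Re := complex.Re.
Local Notation Im := complex.Im.
Local Notation normc := Normc.normc.
Context (ga be : R) (mu : R[i]).
Hypothesis ga0 : 0 < ga.
Hypothesis ga1 : ga <= 1.
Hypothesis be0 : 0 < be.
Hypothesis bega : be <= ga.
Hypothesis mu0 : Re mu < 0.

(** Since |mu + c|^2 = c^2 + 2 c Re mu + |mu|^2, any c above |mu|^2 / (2 |Re mu|) gives |mu + c| <
    c. *)
Let c := normc mu ^+ 2 / (2 * - Re mu) + 1.
Let nu := mu + Complex c 0.

Let c0 : 0 < c.
Proof.
by rewrite ltr_wpDl// divr_ge0 ?sqr_ge0// mulr_ge0// oppr_ge0 ltW.
Qed.

Let nu_lt : normc nu < c.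
Proof.
rewrite -(@ltr_pXn2r _ 2) ?nnegrE ?normc_ge0 ?(ltW c0)// normc_sqr ReD ImD /= addr0.
have : c * (2 * - Re mu) = Re mu ^+ 2 + Im mu ^+ 2 + 2 * - Re mu.
  rewrite -normc_sqr /c mulrDl mul1r divfK//.
  by rewrite mulf_neq0// oppr_eq0 lt_eqF.
by move: (Re mu) (Im mu) c mu0 => x y d x0; nra.
Qed.

Let geo k : R := (- c) ^+ k.
Let r := mlker ga ga geo.
Let v := mlker ga be geo.
Let a : nat -> R := reseq (fun k => mu ^+ k).
Let b : nat -> R := imseq (fun k => mu ^+ k).
Let x1 := mlker ga be a.
Let x2 := mlker ga be b.
Let ra : rapid a. Proof. by case: (rapidC_geo mu). Qed.
Let rb : rapid b. Proof. by case: (rapidC_geo mu). Qed.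
Let rgeo : rapid geo. Proof. exact: rapid_geo. Qed.
Let Wr : admissible r. Proof. exact: admissible_mlker. Qed.
Let Wv : admissible v. Proof. exact: admissible_mlker. Qed.
Let W1 : admissible x1. Proof. exact: admissible_mlker. Qed.
Let W2 : admissible x2. Proof. exact: admissible_mlker. Qed.

(** The cofactor of mu + c in mu^(n + 1) - (-c)^(n + 1). Being a Cauchy product, it makes [powS] the
    coefficient form of x = v + nu (r * x). *)
Let S n : R[i] := \sum_(k < n.+1) Complex (geo k) 0 * mu ^+ (n - k).

Let geoC k : Complex (geo k) 0 = (- Complex c 0) ^+ k :> R[i].
Proof.
elim: k => [|k IH]; first by rewrite expr0 /geo expr0.
rewrite exprS -IH /geo exprS; apply/eqP; rewrite eq_complex/=.
by apply/andP; split; apply/eqP; ring.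
Qed.

Let powS n : mu ^+ n.+1 = Complex (geo n.+1) 0 + nu * S n.
Proof.
have -> : nu * S n = mu ^+ n.+1 - (- Complex c 0) ^+ n.+1.
  rewrite subrXX opprK /nu; congr (_ * _); apply: eq_bigr => k _.
  by rewrite geoC mulrC.
by rewrite geoC addrC subrK.
Qed.

Let ReS n : Re (S n) = \sum_(k < n.+1) geo k * a (n - k)%N.
Proof. by rewrite Re_sum; apply: eq_bigr => k _; rewrite ReM/= mul0r subr0. Qed.

Let ImS n : Im (S n) = \sum_(k < n.+1) geo k * b (n - k)%N.
Proof. by rewrite Im_sum; apply: eq_bigr => k _; rewrite ImM/= mul0r addr0. Qed.

Let X1 := convol r x1.
Let X2 := convol r x2.

Let X1E : X1 = mlker ga (be + ga) (fun n => Re (S n)).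
Proof. by rewrite /X1 convol_mlker// addrC; apply: eq_mlker => n; rewrite ReS. Qed.

Let X2E : X2 = mlker ga (be + ga) (fun n => Im (S n)).
Proof. by rewrite /X2 convol_mlker// addrC; apply: eq_mlker => n; rewrite ImS. Qed.

Let rReS : rapid (fun n => Re (S n)).
Proof. by under eq_fun do rewrite ReS; exact: rapid_convolution. Qed.

Let rImS : rapid (fun n => Im (S n)).
Proof. by under eq_fun do rewrite ImS; exact: rapid_convolution. Qed.

Let bg0 : 0 < be + ga. Proof. exact: addr_gt0. Qed.

Let x1E t : x1 t = v t + (Re nu * X1 t - Im nu * X2 t).
Proof.
suff <- : x1 t - v t = Re nu * X1 t - Im nu * X2 t by rewrite addrC subrK.
rewrite /x1 /v -mlkerB// mlker_shift//; last exact: rapidB.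
rewrite /a /reseq /geo !expr0 subrr mul0r add0r X1E X2E -!mlkerZ// -mlkerB//.
- by congr (mlker _ _ _ _); apply/funext => n; rewrite powS ReD ReM/= addrC addKr.
- exact: rapidZ.
- exact: rapidZ.
Qed.

Let x2E t : x2 t = Re nu * X2 t + Im nu * X1 t.
Proof.
rewrite /x2 mlker_shift// /b /imseq !expr0 mul0r add0r X1E X2E -!mlkerZ// -mlkerD//.
- by congr (mlker _ _ _ _); apply/funext => n; rewrite powS ImD ImM/= add0r.
- exact: rapidZ.
- exact: rapidZ.
Qed.

(** The Euclidean modulus rather than |x1| + |x2|: losing a constant factor would destroy the
    contraction |nu| < c. *)
Let m t := normc (Complex (x1 t) (x2 t)).

Let m0 t : 0 <= m t. Proof. exact: normc_ge0. Qed.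

Let x1m t : `|x1 t| <= m t. Proof. exact: (Re_le_normc (Complex (x1 t) (x2 t))). Qed.
Let x2m t : `|x2 t| <= m t. Proof. exact: (Im_le_normc (Complex (x1 t) (x2 t))). Qed.

Let Wm : admissible m.
Proof.
apply: (@admissible_le _ _ (fun t => `|x1 t| + `|x2 t|)).
- by apply: admissibleD; exact: admissible_norm.
- rewrite (_ : m = (fun t => (x1 t ^+ 2 + x2 t ^+ 2) `^ 2^-1)); last first.
    by apply/funext => t; rewrite powR12_sqrt// addr_ge0 ?sqr_ge0.
  apply: (@measurableT_comp _ _ _ _ _ _ (@powR R ^~ 2^-1)).
    exact: measurable_powR.
  by apply: measurable_funD; apply: measurable_funX; [exact: W1.1|exact: W2.1].
- move=> t _; rewrite ger0_norm// ger0_norm ?addr_ge0//.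
  rewrite -(@ler_pXn2r _ 2) ?nnegrE ?addr_ge0// normc_sqr/=.
  rewrite -[x1 t ^+ 2]real_normK ?num_real// -[x2 t ^+ 2]real_normK ?num_real//.
  by rewrite sqrrD addrAC lerDl mulrn_wge0// mulr_ge0.
Qed.

(** Cauchy-Schwarz under the integral: with rho the left side, rho^2 is the convolution of r with
    X1(t) x1 + X2(t) x2, which is at most rho m pointwise, and r > 0. *)
Let X_le t : normc (Complex (X1 t) (X2 t)) <= convol r m t.
Proof.
set rho := normc _; have rho0 : 0 <= rho by exact: normc_ge0.
have C0 : 0 <= convol r m t.
  by apply: convol_ge0 => s /andP[s0 _]; [exact/ltW/relax_gt0|exact: m0].
move: rho0; rewrite le_eqVlt => /predU1P[<-//|rho0].
rewrite -(ler_pM2l rho0) -expr2 normc_sqr/= !expr2 -!convolZr// -convolDr//;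
  do ?exact: admissibleZ.
apply: le_trans (ler_norm _) _.
apply: le_trans (norm_convol _ _ _) _ => //.
  by apply: admissibleD; exact: admissibleZ.
apply: ler_convol => //; do ?[exact: admissible_norm|exact: admissibleZ].
- by apply: admissible_norm; apply: admissibleD; exact: admissibleZ.
- by move=> s /andP[s0 _]; rewrite normr_ge0 gtr0_norm ?lexx//; exact: relax_gt0.
move=> s _; rewrite normr_ge0/=.
rewrite -(@ler_pXn2r _ 2) ?nnegrE ?mulr_ge0 ?(ltW rho0)//.
rewrite real_normK ?num_real// exprMn /rho /m !normc_sqr/=.
rewrite -subr_ge0 (_ : _ - _ = (X1 t * x2 s - X2 t * x1 s) ^+ 2) ?sqr_ge0//.
by ring.
Qed.

Let m_le t : m t <= `|v t| + normc nu * convol r m t.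
Proof.
have -> : m t = normc (Complex (v t) 0 + nu * Complex (X1 t) (X2 t)).
  rewrite /m x1E x2E; congr normc; case: nu => p q; apply/eqP; rewrite eq_complex/=.
  by apply/andP; split; apply/eqP; ring.
apply: le_trans (le_normcD _ _) _; rewrite Normc.normcM lerD//.
  by rewrite /= expr0n/= addr0 sqrtr_sqr.
by rewrite ler_wpM2l ?normc_ge0.
Qed.

(** The running integral of m is at most V plus |nu| / c times itself; it is finite for each T, so
    the last term can be absorbed. *)
Lemma cL1_half_plane : cL1 ga be (fun k => mu ^+ k).
Proof.
have [_ [V vV]] : inL1 v by exact: relax_inL1.
have q1 : 0 < 1 - normc nu / c by rewrite subr_gt0 ltr_pdivrMr// mul1r.
have Lm : inL1 m.
  split=> //; exists (V / (1 - normc nu / c)) => T; rewrite ler_pdivlMr//.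
  have Wnv := admissible_norm Wv.
  have Wrm : admissible (convol r m) by exact: admissible_convol.
  have H : l1 m T <= l1 v T + normc nu * l1 (convol r m) T.
    rewrite -[normc nu]ger0_norm ?normc_ge0// -l1Z//.
    apply: (@le_trans _ _ (l1 (fun t => `|v t| + normc nu * convol r m t) T)).
      apply: le_l1 => //; first by apply: admissibleD => //; exact: admissibleZ.
      by move=> s _; rewrite (ger0_norm (m0 _)) (le_trans (m_le s))// ler_norm.
    apply: le_trans (l1D _ _ _) _ => //; first exact: admissibleZ.
    by rewrite lerD2r; apply: le_l1 => // s _; rewrite normr_id.
  have H2 : l1 (convol r m) T <= c^-1 * l1 m T.
    apply: le_trans (l1_convol _ Wr Wm) _.
    by rewrite ler_wpM2r ?l1_ge0//; exact: relax_l1.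
  have := le_trans H (lerD (vV T) (ler_wpM2l (normc_ge0 nu) H2)).
  by rewrite mulrBr mulr1 lerBlDr mulrA mulrC.
by split; apply: (inL1_le Lm) => // t _; rewrite [leRHS]ger0_norm.
Qed.

End complex_relaxation.

(** * Arguments of roots and powers *)

Section arguments.
Context {R : realType}.
Local Notation Re := complex.Re.
Local Notation Im := complex.Im.
Local Notation normc := Normc.normc.
Implicit Types (l w : R[i]) (al : R).

Lemma polar_exp (n t : R) (k : nat) :
  (Complex (n * cos t) (n * sin t)) ^+ k =
  Complex (n ^+ k * cos (k%:R * t)) (n ^+ k * sin (k%:R * t)).
Proof.
elim: k => [|k IH]; first by rewrite !expr0 mul0r cos0 sin0 mulr1 mulr0.
rewrite exprS IH exprS -natr1 mulrDl mul1r cosD sinD.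
by apply/eqP; rewrite eq_complex/=; apply/andP; split; apply/eqP; ring.
Qed.

Lemma abs_arg_le_pi l : l != 0 -> `|arg l| <= pi.
Proof.
by move=> /argP[/andP[a1 a2] _]; rewrite ler_norml a2 andbT ltW.
Qed.

Lemma Re_exp l k : l != 0 ->
  Re (l ^+ k) = normc l ^+ k * cos (k%:R * `|arg l|).
Proof.
move=> l0; rewrite {1}(argP l0).2 polar_exp/=; congr (_ * _).
by rewrite -[RHS]cos_norm normrM normr_id -normrM cos_norm.
Qed.

Lemma normc_gt0 l : l != 0 -> 0 < normc l.
Proof.
move=> l0; rewrite lt_neqAle normc_ge0 andbT eq_sym.
by apply: contra l0 => /eqP/Normc.eq0_normc ->.
Qed.

(** If p |arg w| were below |arg(w^p)| <= pi, two distinct points of [0, pi] would have the same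
    cosine. *)
Lemma arg_root_ge w p : w ^+ p != 0 -> (0 < p)%N ->
  `|arg (w ^+ p)| <= p%:R * `|arg w|.
Proof.
move=> wp0 p0; have w0 : w != 0.
  by apply: contra wp0 => /eqP ->; rewrite expr0n gtn_eqF.
rewrite leNgt; apply/negP => lt; have piW := abs_arg_le_pi wp0.
have := Re_exp 1 wp0; rewrite expr1 expr1 mul1r normcX (Re_exp p w0).
have np : normc w ^+ p != 0 by rewrite expf_neq0// gt_eqF// normc_gt0.
move=> /(mulfI np) E; have := @ltr_cos R (p%:R * `|arg w|) `|arg (w ^+ p)|.
rewrite !in_itv/= mulr_ge0// normr_ge0 piW (le_trans (ltW lt))// => /(_ isT isT).
by rewrite lt E ltxx.
Qed.

(* For p large, every p-th root w of l has a power w ^ q in the open left half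
   plane with q * (al / p) <= 1: the least q with q |arg w| > pi / 2 is at most
   pi / (2 |arg w|) + 1 <= p pi / (2 |arg l|) + 1. *)
Lemma exists_root_order al l : 0 < al < 1 -> Lambda al l ->
  exists2 p, (0 < p)%N & forall w, w ^+ p = l ->
    exists q, [/\ (0 < q)%N, q%:R * (al / p%:R) <= 1 & Re (w ^+ q) < 0].
Proof.
move=> /andP[al0 al1] [l0 theta]; set th := `|arg l| in theta.
have pi0 := pi_gt0 R.
have th0 : 0 < th by rewrite (le_lt_trans _ theta)// !mulr_ge0 ?(ltW al0) ?(ltW pi0)// invr_ge0.
(* The condition |arg l| > al pi / 2 leaves this positive room; p is so large that rounding q up
   costs at most al / p <= gap. *)
pose gap := 1 - pi * al / (2 * th).
have gap0 : 0 < gap by rewrite subr_gt0 ltr_pdivrMr ?mulr_gt0// mul1r; lra.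
pose p := (Num.truncn (al / gap)).+1.
have p0 : 0 < p%:R :> R by rewrite ltr0n.
have pgap : al / p%:R <= gap.
  have : al / gap < p%:R by exact: truncnS_gt.
  by rewrite ltr_pdivrMr// ler_pdivrMr// mulrC => /ltW.
exists p => // w wp.
have psi : th <= p%:R * `|arg w| by rewrite /th -wp arg_root_ge// wp.
set ps := `|arg w| in psi.
have w0 : w != 0 by apply: contra l0 => /eqP w0; rewrite -wp w0 expr0n.
have ps0 : 0 < ps by rewrite -(pmulr_rgt0 _ p0) (lt_le_trans th0).
have Re_lt q : pi / 2 < q%:R * ps -> q%:R * ps <= pi -> Re (w ^+ q) < 0.
  move=> h1 h2; rewrite Re_exp// pmulr_rlt0 ?exprn_gt0 ?normc_gt0//.
  have [pa pb] : (0 <= pi / 2 :> R) /\ (pi / 2 <= pi :> R) by split; lra.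
  have := @ltr_cos R (pi / 2) (q%:R * ps).
  rewrite !in_itv/= pa pb h2 mulr_ge0 ?(ltW ps0)//.
  by move=> /(_ isT isT); rewrite cos_pihalf h1.
(* If w is already in the left half plane, q = 1 works. Otherwise |arg w| <= pi / 2, so the first
   multiple of |arg w| beyond pi / 2 does not pass pi. *)
have [ps2|ps2] := ltP (pi / 2) ps.
  exists 1%N; split=> //; last by apply: Re_lt; rewrite mul1r// abs_arg_le_pi.
  rewrite mul1r (le_trans pgap)// /gap gerBl divr_ge0// mulr_ge0 ?(ltW al0) ?(ltW pi0) ?(ltW th0)//.
pose x := pi / (2 * ps).
have x0 : 0 <= x by rewrite divr_ge0 ?mulr_ge0 ?(ltW pi0) ?(ltW ps0).
pose k := Num.truncn x.
have kx : k%:R <= x by rewrite truncn_le.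
have xk : x < k.+1%:R by exact: truncnS_gt.
have xps : x * ps = pi / 2.
  by rewrite /x invfM mulrA mulfVK// gt_eqF.
exists k.+1; split=> //.
  rewrite -natr1 mulrDl mul1r -lerBrDr.
  apply: (@le_trans _ _ (pi * al / (2 * th))); last by rewrite -[leLHS](subKr 1) lerB.
  rewrite (le_trans (ler_wpM2r _ kx))//; first by rewrite divr_ge0 ?ltW.
  rewrite /x mulf_div ler_pM2l ?mulr_gt0// lef_pV2 ?posrE ?mulr_gt0//.
  by rewrite -mulrA ler_pM2l// mulrC.
apply: Re_lt; first by rewrite -xps ltr_pM2r.
rewrite -natr1 mulrDl mul1r (le_trans (lerD (ler_wpM2r (ltW ps0) kx) ps2))// xps.
by rewrite -splitr.
Qed.

End arguments.

(** * Linear recurrences and geometric sequences with ratio in the sector *)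

Section recurrences.
Context {R : realType}.
Local Notation Re := complex.Re.
Local Notation Im := complex.Im.
Implicit Types (l mu x : R[i]) (z w : nat -> R[i]) (ga be al t T : R).

(** Subtracting z(0) l^n leaves a sequence vanishing at 0 whose shift is the Cauchy product of l^k
    and w. Its kernel of exponent 2 al is a convolution of two integrable ones, and [cL1_shift]
    brings the exponent back to al. *)
Lemma cL1_recurrence al l z w : 0 < al -> rapidC z -> rapidC w ->
  cL1 al al (fun k => l ^+ k) -> cL1 al al w ->
  (forall n, z n.+1 = l * z n + w n) -> cL1 al al z.
Proof.
move=> al0 rz rw Ll Lw zE.
have rl := rapidC_geo l.
pose y k := z k + - z 0%N * l ^+ k.
have ry : rapidC y by apply: rapidCD => //; exact: rapidCZ.
have yE n : y n.+1 = cauchyC (fun k => l ^+ k) w n.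
  elim: n => [|n IH].
    rewrite /y zE /cauchyC big_ord_recl big_ord0 expr0 expr1 subn0 mul1r addr0.
    by rewrite mulNr mulrC addrAC subrr add0r.
  have -> : y n.+2 = l * y n.+1 + w n.+1 by rewrite /y zE [l ^+ n.+2]exprS; ring.
  rewrite IH /cauchyC [in RHS]big_ord_recl expr0 mul1r subn0 addrC; congr (_ + _).
  by rewrite mulr_sumr; apply: eq_bigr => k _; rewrite exprS mulrA.
apply: (@eq_cL1 _ _ _ (fun k => z 0%N * l ^+ k + y k)).
  by move=> k; rewrite /y mulNr addrC subrK.
apply: cL1D => //; [exact: rapidCZ|exact: cL1Z|].
apply: cL1_shift => //; first by rewrite /y expr0 mulr1 subrr.
by under eq_fun do rewrite yE; exact: cL1_cauchy.
Qed.

(** The operators shift - l are applied one at a time, matching the induction in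
    [cL1_annihilated]. *)
Fixpoint annihilates (s : seq R[i]) z : Prop :=
  if s is l :: s' then annihilates s' (fun n => z n.+1 - l * z n)
  else forall n, z n = 0.

Lemma cL1_annihilated al (s : seq R[i]) z : 0 < al -> rapidC z ->
  {in s, forall l, cL1 al al (fun k => l ^+ k)} -> annihilates s z -> cL1 al al z.
Proof.
move=> al0; elim: s z => [|l s IH] z rz Ls /=.
  move=> z0; apply: (@eq_cL1 _ _ _ (fun k => 0 * z k)).
    by move=> k; rewrite mul0r z0.
  have L0 : cL1 al al (fun=> 0).
    have E : mlker al al (fun=> 0 : R) = cst 0 by apply/funext => t; rewrite mlker0.
    have I0 : inL1 (cst (0 : R)).
      split; first exact: admissible_cst.
      exists 0 => T; rewrite /l1; under [X in convol _ X]eq_fun do rewrite normr0 -(mul0r 0).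
      by rewrite convolZr ?mul0r//; [exact: admissible_gk|exact: (admissible_cst 0)].
    by split; rewrite /reseq /imseq /= E.
  by under eq_fun do rewrite mul0r.
move=> zs; have rw : rapidC (fun n => z n.+1 - l * z n).
  apply: rapidCD; first exact: rapidC_shift.
  by under eq_fun do rewrite -mulNr; exact: rapidCZ.
apply: (@cL1_recurrence al l z (fun n => z n.+1 - l * z n)) => //.
- by apply: Ls; rewrite mem_head.
- by apply: IH => // m ms; apply: Ls; rewrite inE ms orbT.
- by move=> n; rewrite addrC subrK.
Qed.

(** [p] evaluated at the shift operator and applied to [z]. *)
Definition poly_act (p : {poly R[i]}) z n := \sum_(i < size p) p`_i * z (n + i)%N.

Let poly_actE N (p : {poly R[i]}) z n : (size p <= N)%N ->
  poly_act p z n = \sum_(i < N) p`_i * z (n + i)%N.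
Proof.
move=> pN; rewrite /poly_act (big_ord_widen _ (fun i => p`_i * z (n + i)%N) pN).
rewrite big_mkcond; apply: eq_bigr => i _; case: ltnP => // pi.
by rewrite nth_default// mul0r.
Qed.

Let poly_actM l (p : {poly R[i]}) z n :
  poly_act (('X - l%:P) * p) z n = poly_act p (fun n => z n.+1 - l * z n) n.
Proof.
have sz : (size (('X - l%:P) * p)%R <= (size p).+1)%N.
  by rewrite (leq_trans (size_polyMleq _ _))// size_XsubC.
rewrite (poly_actE _ _ sz) /poly_act.
under eq_bigr do rewrite mulrBl coefB coefCM mulrBl.
rewrite sumrB big_ord_recl coefXM eqxx mul0r add0r.
under eq_bigr do rewrite lift0 coefXM/=.
rewrite [X in _ - X]big_ord_recr/= nth_default// mulr0 mul0r addr0 -sumrB.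
apply: eq_bigr => i _; rewrite addnS; ring.
Qed.

Lemma annihilates_prod (s : seq R[i]) z :
  (forall n, poly_act (\prod_(l <- s) ('X - l%:P)) z n = 0) -> annihilates s z.
Proof.
elim: s z => [|l s IH] z /= H.
  by move=> n; have := H n; rewrite big_nil /poly_act size_poly1 big_ord1 coef1 mul1r addn0.
by apply: IH => n; rewrite -poly_actM; have := H n; rewrite big_cons.
Qed.

(** Over an algebraically closed field the annihilating polynomial splits, which reduces the matter
    to first-order recurrences. *)
Lemma cL1_poly_act al (p : {poly R[i]}) z : 0 < al -> p \is monic -> rapidC z ->
  (forall l, root p l -> cL1 al al (fun k => l ^+ k)) ->
  (forall n, poly_act p z n = 0) -> cL1 al al z.
Proof.
move=> al0 /monicP pm rz Lp; have [s ps] := closed_field_poly_normal p.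
rewrite pm scale1r in ps; rewrite ps => /annihilates_prod; apply: cL1_annihilated => //.
by move=> l ls; apply: Lp; rewrite ps root_prod_XsubC.
Qed.

Lemma inL1_sum (I : Type) (s : seq I) (P : pred I) (F : I -> R -> R) :
  (forall i, P i -> inL1 (F i)) -> inL1 (fun t => \sum_(i <- s | P i) F i t).
Proof.
move=> LF; elim: s => [|i s IH].
  rewrite (_ : (fun t => _) = fun t => 0 * gk 1 t); last first.
    by apply/funext => t; rewrite big_nil mul0r.
  split; first by apply: admissibleZ; exact: admissible_gk.
  by exists 0 => T; rewrite l1Z ?normr0 ?mul0r//; exact: admissible_gk.
rewrite (_ : (fun t => _) = if P i then (fun t => F i t + \sum_(j <- s | P j) F j t)
  else fun t => \sum_(j <- s | P j) F j t); last first.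
  by apply/funext => t; rewrite big_cons; case: (P i).
by case: ifP => // Pi; apply: inL1D => //; exact: LF.
Qed.

Lemma cL1_decimate (q : nat) ga be z : (0 < q)%N -> 0 < ga -> 0 < be -> rapidC z ->
  (forall j, (j < q)%N ->
    cL1 (q%:R * ga) (ga * j%:R + be) (fun k => z (q * k + j)%N)) ->
  cL1 ga be z.
Proof.
move=> q0 ga0 be0 [rz iz] H; split.
  rewrite (_ : mlker _ _ _ = (fun t => \sum_(j < q)
    mlker (q%:R * ga) (ga * j%:R + be) (reseq (fun k => z (q * k + j)%N)) t)).
    by apply: inL1_sum => j _; case: (H j (ltn_ord j)).
  by apply/funext => t; rewrite (mlker_decimate t q0 ga0 be0 rz).
rewrite (_ : mlker _ _ _ = (fun t => \sum_(j < q)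
  mlker (q%:R * ga) (ga * j%:R + be) (imseq (fun k => z (q * k + j)%N)) t)).
  by apply: inL1_sum => j _; case: (H j (ltn_ord j)).
by apply/funext => t; rewrite (mlker_decimate t q0 ga0 be0 iz).
Qed.

(** Residue j modulo q carries the sequence l^j (l^q)^k at order q ga and exponent ga (j + 1) <= q
    ga, within reach of the half-plane case. *)
Lemma cL1_power_half_plane ga l (q : nat) : 0 < ga -> (0 < q)%N ->
  q%:R * ga <= 1 -> Re (l ^+ q) < 0 -> cL1 ga ga (fun k => l ^+ k).
Proof.
move=> ga0 q0 qga Rel; apply: (cL1_decimate q0) => // [|j jq]; first exact: rapidC_geo.
have q0' : 0 < q%:R * ga by rewrite mulr_gt0// ltr0n.
have b0 : 0 < ga * j%:R + ga by rewrite ltr_wpDl// mulr_ge0// ltW.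
apply: (@eq_cL1 _ _ _ (fun k => l ^+ j * (l ^+ q) ^+ k)).
  by move=> k; rewrite exprD exprM mulrC.
apply: cL1Z => //; first exact: rapidC_geo.
apply: cL1_half_plane => //.
by rewrite -{2}[ga]mulr1 -mulrDr natr1 mulrC ler_pM2r// ler_nat.
Qed.

(** A sequence supported on the residue p - 1 has a single nonzero piece modulo p, and with ga = al
    / p its exponent is ga (p - 1) + ga = al. *)
Let mlker_upsample (p : nat) al (c d : nat -> R) : (0 < p)%N -> 0 < al -> rapid c ->
  (forall k j, (j < p)%N -> c (p * k + j)%N = if j == p.-1 then d k else 0) ->
  mlker (al / p%:R) (al / p%:R) c = mlker al al d.
Proof.
move=> p0 al0 rc cE; have p0' : 0 < p%:R :> R by rewrite ltr0n.
have ga0 : 0 < al / p%:R by rewrite divr_gt0.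
apply/funext => t; rewrite (mlker_decimate t p0 ga0 ga0 rc).
have pp : (p.-1 < p)%N by rewrite prednK.
rewrite (bigD1 (Ordinal pp))//= big1 ?addr0.
  rewrite (_ : p%:R * _ = al); last by rewrite mulrCA divff ?mulr1// gt_eqF.
  rewrite (_ : _ + _ = al); last first.
    by rewrite -{2}[al / _]mulr1 -mulrDr natr1 prednK// divfK// gt_eqF.
  by congr (mlker _ _ _ _); apply/funext => k; rewrite cE// eqxx.
move=> j jp; rewrite (_ : (fun k => _) = fun=> 0) ?mlker0//.
by apply/funext => k; rewrite cE// ifN.
Qed.

Lemma cL1_geometric al l : 0 < al < 1 -> Lambda al l -> cL1 al al (fun k => l ^+ k).
Proof.
move=> al01 Ll; have /andP[al0 _] := al01.
have [p p0 roots] := exists_root_order al01 Ll.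
have p0' : 0 < p%:R :> R by rewrite ltr0n.
have ga0 : 0 < al / p%:R by rewrite divr_gt0.
(* The coefficients of 1 / (X ^ p - l), whose kernel for al / p is the kernel
   of 1 / (X - l) for al. *)
pose z n : R[i] := if (n %% p == p.-1)%N then l ^+ (n %/ p) else 0.
have zE k j : (j < p)%N -> z (p * k + j)%N = if j == p.-1 then l ^+ k else 0.
  move=> jp; rewrite /z mulnC modnMDl modn_small// divnMDl// divn_small// addn0.
  by [].
have zS n : z (n + p)%N = l * z n.
  rewrite /z modnDr divnDr// divnn p0 addn1.
  by case: ifP => _; rewrite ?mulr0// exprS.
have rz : rapidC z.
  apply: (@rapidC_normc _ _ 1 (Normc.normc l + 1)) => //.
    by rewrite addr_ge0// normc_ge0.
  move=> k; rewrite mul1r /z; case: ifP => _; last first.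
    by rewrite Normc.normc0 exprn_ge0// addr_ge0// normc_ge0.
  rewrite normcX; apply: (@le_trans _ _ ((Normc.normc l + 1) ^+ (k %/ p))).
    by rewrite lerXn2r ?nnegrE ?addr_ge0 ?normc_ge0// lerDl.
  by rewrite ler_weXn2l ?leq_div// lerDr normc_ge0.
have [Lz Mz] : cL1 (al / p%:R) (al / p%:R) z.
  apply: (@cL1_poly_act _ ('X^p - l%:P)) => //.
  - by rewrite monicXnsubC.
  - move=> w; rewrite /root !hornerE subr_eq0 => /eqP /roots[q [q0 qga Rew]].
    exact: cL1_power_half_plane Rew.
  - move=> n; have sz : (size ('X^p - l%:P : {poly R[i]})%R <= p.+1)%N by rewrite size_XnsubC.
    have [p' pE] : exists p', p = p'.+1 by exists p.-1; rewrite prednK.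
    rewrite (poly_actE _ _ sz) pE big_ord_recl big_ord_recr/= big1; last first.
      move=> i _; rewrite coefB coefXn coefC /= /bump/= add1n eqSS ltn_eqF//.
      by rewrite subr0 mul0r.
    have -> : ('X^(p'.+1) - l%:P : {poly R[i]})`_0 = - l.
      by rewrite coefB coefXn coefC; exact: sub0r.
    have -> : ('X^(p'.+1) - l%:P : {poly R[i]})`_(bump 0 p') = 1.
      by rewrite coefB coefXn coefC eqxx; exact: subr0.
    have -> : bump 0 p' = p by rewrite pE.
    by rewrite addn0 add0r mul1r mulNr (zS n) addrC subrr.
split.
  rewrite -(@mlker_upsample p al (reseq z))//; first by case: rz.
  by move=> k j jp; rewrite /reseq zE//; case: ifP.
rewrite -(@mlker_upsample p al (imseq z))//; first by case: rz.
by move=> k j jp; rewrite /imseq zE//; case: ifP.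
Qed.

End recurrences.

(** * Integrability of the matrix kernel *)

Section matrix_kernel.
Context {R : realType}.
Context (s : nat) (A : 'M[R]_s.+1) (al : R).
Hypothesis al01 : 0 < al < 1.
Hypothesis spA : spectrum A `<=` Lambda al.
Implicit Types (i j k : 'I_s.+1).

Let al0 : 0 < al. Proof. by case/andP: al01. Qed.

Definition mxentry i j (n : nat) : R := (A ^+ n) i j.

Lemma rapid_mxentry i j : rapid (mxentry i j).
Proof.
pose C : R := \sum_a \sum_b `|A a b|.
have C0 : 0 <= C by apply: sumr_ge0 => a _; apply: sumr_ge0.
suff H n a b : `|(A ^+ n) a b| <= 1 * (s.+1%:R * C + 1) ^+ n.
  by exists 1, (s.+1%:R * C + 1); split=> [//||n]; [rewrite addr_ge0// mulr_ge0|exact: H].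
have D0 : 0 <= s.+1%:R * C + 1 by rewrite addr_ge0// mulr_ge0.
rewrite mul1r; elim: n a b => [|n IH] a b.
  by rewrite !expr0 mxE; case: eqP; rewrite ?normr1 ?normr0.
rewrite exprS mxE exprS (le_trans (ler_norm_sum _ _ _))//.
apply: (@le_trans _ _ (\sum_(k < s.+1) C * (s.+1%:R * C + 1) ^+ n)).
  apply: ler_sum => k _; rewrite normrM ler_pM// /C (bigD1 a)//= (bigD1 k)//=.
  by rewrite -addrA lerDl addr_ge0// sumr_ge0// => c _; exact: sumr_ge0.
rewrite sumr_const card_ord -[leLHS]mulr_natl mulrA ler_wpM2r ?exprn_ge0//.
by rewrite lerDl.
Qed.

Lemma inL1_mxentry i j : inL1 (mlker al al (mxentry i j)).
Proof.
pose Ac := map_mx (real_complex R) A.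
pose z n : R[i] := (Ac ^+ n) i j.
have zE n : z n = Complex (mxentry i j n) 0.
  by rewrite /z /Ac -rmorphXn /= mxE.
have rz : rapidC z.
  split; rewrite /reseq /imseq.
    by under eq_fun do rewrite zE; exact: rapid_mxentry.
  by under eq_fun do rewrite zE; exists 0, 0; split=> // k; rewrite normr0 mul0r.
suff [L _] : cL1 al al z.
  rewrite (_ : mlker _ _ _ = mlker al al (reseq z))//.
  by congr mlker; apply/funext => n; rewrite /reseq zE.
apply: (@cL1_poly_act _ al (char_poly Ac)) => //.
- exact: char_poly_monic.
- by move=> l; rewrite -eigenvalue_root_char => /spA; exact: cL1_geometric.
move=> n; have : Ac ^+ n * horner_mx Ac (char_poly Ac) = 0.
  by rewrite Cayley_Hamilton mulr0.
move=> /matrixP/(_ i j); rewrite [RHS]mxE => <-.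
rewrite -{2}(coefK (char_poly Ac)) poly_def /poly_act rmorph_sum/= mulr_sumr summxE.
apply: eq_bigr => k _; rewrite -mul_polyC rmorphM/= horner_mx_C rmorphXn/= horner_mx_X.
by rewrite -mulmxE mul_scalar_mx -scalemxAr mxE /z exprD -mulmxE.
Qed.

End matrix_kernel.

(** * Weighted estimates for scalar kernels *)

Section kernel_bounds.
Context {R : realType}.
Implicit Types (f g : R -> R) (s t T B C D : R).
Let W1 := admissible_gk (@ltr01 R).

Lemma convol_le_add f g f1 g1 f2 g2 t : admissible f -> admissible g ->
  admissible f1 -> admissible g1 -> admissible f2 -> admissible g2 ->
  (forall s, 0 < s < t ->
    f (t - s) * g s <= f1 (t - s) * g1 s + f2 (t - s) * g2 s) ->
  convol f g t <= convol f1 g1 t + convol f2 g2 t.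
Proof.
move=> Wf Wg Wf1 Wg1 Wf2 Wg2 H; rewrite convol.unlock -RintegralD//; last 2 first.
- exact: convol_integrable.
- exact: convol_integrable.
apply: le_Rintegral => //; first exact: convol_integrable.
  have := integrableD measurableT (convol_integrable t Wf1 Wg1) (convol_integrable t Wf2 Wg2).
  by apply: eq_integrable => // s _; rewrite -EFinD.
move=> s _; have [s0|s0] := leP s 0.
  by rewrite ![on_half_line _ s]pos_le0// !mulr0 addr0.
have [ts|st] := leP t s.
  by rewrite ![on_half_line _ (t - s)]pos_le0 ?subr_le0// !mul0r addr0.
by rewrite !posE ?subr_gt0// H// s0.
Qed.

Lemma norm_convol_le_l1 f g B t : admissible f -> admissible g -> 0 <= B ->
  (forall s, 0 < s -> `|f s| <= B) -> `|convol f g t| <= B * l1 g t.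
Proof.
move=> Wf Wg B0 fB; apply: le_trans (norm_convol _ _ _) _ => //.
rewrite /l1 -convolZl//; last exact: admissible_norm.
apply: ler_convol => //; do ?[exact: admissible_norm|exact: admissibleZ].
  by move=> s /andP[s0 _]; rewrite normr_ge0 gk1// mulr1 fB.
by move=> s _; rewrite normr_ge0/=.
Qed.

(* Split at t / 2: K is O(1 / t) on one half, the weight O(t ^ (a - 1)) on the
   other. *)
Lemma weighted_kernel_bound (K : R -> R) (a B D : R) : 0 < a <= 1 -> admissible K ->
  (forall T, l1 K T <= B) -> (forall t, 0 < t -> t * `|K t| <= D) ->
  forall t, 0 < t ->
    convol (fun s => `|K s|) (pw a) t <= (2 * (D / a) + 2 * B) * t `^ (a - 1).
Proof.
move=> /andP[a0 a1] WK KB KD t t0; have NK := admissible_norm WK.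
have Wa := admissible_pw a0.
have D0 : 0 <= D by apply: le_trans (KD 1 ltr01); rewrite mul1r.
apply: (@le_trans _ _ (convol (fun s => 2 * D / t * gk 1 s) (pw a) t +
    convol (fun s => 2 * t `^ (a - 1) * `|K s|) (gk 1) t)).
  apply: convol_le_add => //; do ?exact: admissibleZ.
  move=> s /andP[s0 st]; have ts0 : 0 < t - s by rewrite subr_gt0.
  rewrite !gk1// !mulr1.
  have [s2|s2] := leP (2 * s) t.
    rewrite -[leLHS]addr0 lerD ?mulr_ge0 ?powR_ge0// ler_wpM2r ?pw_ge0//.
    rewrite ler_pdivlMr// (le_trans _ (ler_wpM2l _ (KD _ ts0)))//.
    by rewrite mulrA mulrC ler_wpM2r//; lra.
  have tV : 0 <= t^-1 by rewrite invr_ge0 ltW.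
  rewrite -[leLHS]add0r lerD ?mulr_ge0 ?pw_ge0//.
  rewrite mulrC ler_wpM2r// pwE//.
  apply: (@le_trans _ _ ((2^-1 * t) `^ (a - 1))).
    by apply: le0_ler_powR; [rewrite mulr_gt0|lra|rewrite subr_le0].
  rewrite powRM ?(ltW t0)// ler_wpM2r ?powR_ge0//.
  rewrite -powR_inv1// -powRrM mulN1r opprB.
  by rewrite -[leRHS](@powRr1 R 2)// ler_powR ?ler1n// gerBl ltW.
rewrite !convolZl// [convol _ (gk 1) t]convolC// -/(l1 K t).
have -> : convol (gk 1) (pw a) t = t `^ a / a.
  have -> : pw a = (fun s => Gamma a * gk a s).
    by apply/funext => s; rewrite gk.unlock mulrC divfK// gt_eqF// Gamma_gt0.
  rewrite convolZr ?convol1_gk//; last exact: admissible_gk.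
  rewrite gkE// addrK GammaS//.
  by move: (Gamma a) (Gamma_gt0 a0) => G G0; field; rewrite !gt_eqF.
rewrite [leRHS]mulrDl lerD//; last first.
  by rewrite -mulrA [X in 2 * X]mulrC mulrA ler_wpM2r ?powR_ge0// ler_wpM2l.
rewrite gt0_powRB1// le_eqVlt; apply/orP; left; apply/eqP; field.
by rewrite !gt_eqF.
Qed.

End kernel_bounds.

(** * Bounds for the entries of the matrix kernel *)

Section matrix_kernel_bounds.
Context {R : realType}.
Context (s : nat) (A : 'M[R]_s.+1) (al : R).
Hypothesis al01 : 0 < al < 1.
Hypothesis spA : spectrum A `<=` Lambda al.
Implicit Types (i j k l m : 'I_s.+1) (t : R).

Let al0 : 0 < al. Proof. by case/andP: al01. Qed.
Let al1 : al < 1. Proof. by case/andP: al01. Qed.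
Let W1 := admissible_gk (@ltr01 R).

Definition mlmx i j : R -> R := mlker al al (mxentry A i j).

Lemma admissible_mlmx i j : admissible (mlmx i j).
Proof. by apply: admissible_mlker => //; exact: rapid_mxentry. Qed.

Lemma mlmx_l1 : exists2 B, 0 <= B & forall i j T, l1 (mlmx i j) T <= B.
Proof.
have /(_ _)/cid-/all_sig[B HB] : forall ij : 'I_s.+1 * 'I_s.+1,
    exists B, forall T, l1 (mlmx ij.1 ij.2) T <= B.
  by move=> [i j]; have [_] := inL1_mxentry al01 spA i j.
exists (\sum_ij `|B ij|) => [|i j T]; first exact: sumr_ge0.
rewrite (le_trans (HB (i, j) T))// (bigD1 (i, j))//=.
by rewrite (le_trans (ler_norm _))// lerDl sumr_ge0.
Qed.

(* The kernel of s ^ (al - 1) (s ^ al - A)^-1, i.e. E_al (t ^ al A). *)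
Definition mlmx1 i j : R -> R := mlker al 1 (mxentry A i j).

Lemma admissible_mlmx1 i j : admissible (mlmx1 i j).
Proof. by apply: admissible_mlker => //; exact: rapid_mxentry. Qed.

Lemma convol_mlmx_gk i j : convol (mlmx i j) (gk (1 - al)) = mlmx1 i j.
Proof.
rewrite /mlmx convol_mlker_gk ?subr_gt0//; last exact: rapid_mxentry.
by rewrite addrC subrK.
Qed.

(** Once A^0 is peeled off, what remains is the integral of K times A; thus integrability of K
    bounds E_al(t^al A). *)
Lemma mlmx1E i j t : 0 < t ->
  mlmx1 i j t = (i == j)%:R + \sum_m convol (gk 1) (mlmx i m) t * A m j.
Proof.
move=> t0; have rA := rapid_mxentry A.
rewrite /mlmx1 mlker_shift// gk1// mulr1 /mxentry expr0 mxE; congr (_ + _).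
have al1' : 0 < 1 + al by rewrite addr_gt0.
rewrite (_ : mlker _ _ _ = mlker al (1 + al)
    (fun n => \sum_m A m j * mxentry A i m n)); last first.
  congr mlker; apply/funext => n; rewrite exprSr mxE.
  by apply: eq_bigr => m _; rewrite mulrC.
rewrite mlker_sum//; last by move=> m; exact: rapidZ.
by apply: eq_bigr => m _; rewrite mlkerZ// convol_gk_mlker// mulrC.
Qed.

Lemma mlmx1_bound : exists2 B, 0 <= B & forall i j t, 0 < t -> `|mlmx1 i j t| <= B.
Proof.
have [B B0 KB] := mlmx_l1.
pose C := \sum_i \sum_j `|A i j|.
exists (1 + s.+1%:R * (B * C)).
  by rewrite addr_ge0// !mulr_ge0// sumr_ge0// => i _; exact: sumr_ge0.
move=> i j t t0; rewrite mlmx1E// (le_trans (ler_normD _ _))// lerD//.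
  by case: eqP => _; rewrite ?normr1 ?normr0.
rewrite (le_trans (ler_norm_sum _ _ _))//.
apply: (@le_trans _ _ (\sum_(m < s.+1) B * C)); last first.
  by rewrite sumr_const card_ord -[leLHS]mulr_natl.
apply: ler_sum => m _; rewrite normrM ler_pM//.
  apply: le_trans (KB i m t); rewrite -[leRHS]mul1r.
  apply: norm_convol_le_l1 => //; first exact: admissible_mlmx.
  by move=> x x0; rewrite gk1// normr1.
rewrite /C (bigD1 m)//= (bigD1 j)//= -addrA lerDl addr_ge0 ?sumr_ge0// => k _.
exact: sumr_ge0.
Qed.

(* t K(t) = al (E_al * K)(t), which is bounded. *)
Lemma mlmx_decay : exists2 D, 0 <= D & forall i j t, 0 < t -> t * `|mlmx i j t| <= D.
Proof.
have rA := rapid_mxentry A.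
have [B B0 KB] := mlmx_l1; have [U U0 HU] := mlmx1_bound.
exists (al * (s.+1%:R * (U * B))); first by rewrite !mulr_ge0 ?(ltW al0).
move=> i j t t0; rewrite -[X in X * _](ger0_norm (ltW t0)) -normrM /mlmx mulr_mlker//.
have al10 : 0 < 1 + al by rewrite addr_gt0.
(* Multiplication by t brings the weight al (n + 1), and n + 1 counts the factorisations A^n = A^m
   A^(n - m), which form a Cauchy product. *)
rewrite (_ : mlker _ _ _ = mlker al (1 + al) (fun n => al * \sum_l
    \sum_(m < n.+1) mxentry A i l m * mxentry A l j (n - m)%N)); last first.
  rewrite addrC; congr mlker; apply/funext => n.
  rewrite -{2}[al]mulr1 -mulrDr natr1 -mulrA; congr (_ * _).
  rewrite exchange_big/= mulr_natl -[n.+1 in LHS]card_ord -sumr_const.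
  apply: eq_bigr => m _; have mn : (m <= n)%N by rewrite -ltnS.
  by rewrite /mxentry -{1}(subnKC mn) exprD mxE.
rewrite mlkerZ//; last by apply: rapid_sum => l; exact: rapid_convolution.
rewrite normrM ger0_norm ?(ltW al0)// ler_wpM2l ?(ltW al0)//.
rewrite mlker_sum//; last by move=> l; exact: rapid_convolution.
rewrite (le_trans (ler_norm_sum _ _ _))//.
apply: (@le_trans _ _ (\sum_(l < s.+1) U * B)); last first.
  by rewrite sumr_const card_ord -[leLHS]mulr_natl.
apply: ler_sum => l _; rewrite -convol_mlker//.
apply: (@le_trans _ _ (U * l1 (mlmx l j) t)); last by rewrite ler_wpM2l.
apply: norm_convol_le_l1 => //; [exact: admissible_mlmx1|exact: admissible_mlmx|].
by move=> x x0; exact: HU.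
Qed.

Lemma mlmx_weighted : exists2 C, 0 <= C & forall i j t, 0 < t ->
  convol (fun x => `|mlmx i j x|) (pw al) t <= C * t `^ (al - 1).
Proof.
have [B B0 KB] := mlmx_l1; have [D D0 KD] := mlmx_decay.
exists (2 * (D / al) + 2 * B).
  by rewrite addr_ge0// mulr_ge0// divr_ge0// ltW.
move=> i j t t0; apply: weighted_kernel_bound => //.
- by rewrite al0 ltW.
- exact: admissible_mlmx.
- by move=> x x0; exact: KD.
Qed.

(** Up to 1 this is the local bound of the series; beyond 1 it follows from the decay D / t, as 1 /
    t <= t^(al - 1). *)
Lemma mlmx_pw_bound : exists2 C, 0 <= C & forall i j t, 0 < t ->
  `|mlmx i j t| <= C * t `^ (al - 1).
Proof.
have [D D0 KD] := mlmx_decay.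
have /(_ _)/cid2-/all_sig[B HB] : forall ij : 'I_s.+1 * 'I_s.+1,
    exists2 B, 0 <= B & forall t, 0 < t <= 1 -> `|mlmx ij.1 ij.2 t| <= B * t `^ (al - 1).
  by move=> [i j]; apply: mlker_bound => //; exact: rapid_mxentry.
exists (D + \sum_ij B ij).
  by rewrite addr_ge0// sumr_ge0// => ij _; case: (HB ij).
move=> i j t t0; have [t1|t1] := leP t 1.
  have [_ /(_ t)] := HB (i, j); rewrite t0 t1 => /(_ isT)/le_trans; apply.
  rewrite ler_wpM2r ?powR_ge0// (bigD1 (i, j))//= addrCA lerDl addr_ge0//.
  by rewrite sumr_ge0// => ij _; case: (HB ij).
apply: (@le_trans _ _ (D / t)); first by rewrite ler_pdivlMr// mulrC KD.
rewrite ler_pM ?invr_ge0 ?(ltW t0)//.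
  by rewrite lerDl sumr_ge0// => ij _; case: (HB ij).
by rewrite gt0_powRB1// ler_peMl ?invr_ge0 ?(ltW t0)// -(powRr0 t) ler_powR// ltW.
Qed.

End matrix_kernel_bounds.

(** * Equivalence of norms *)

Section norms.
Context {R : realType} {s : nat} (N : 'cV[R]_s.+1 -> R).
Hypothesis hN : is_norm N.
Implicit Types (x y : 'cV[R]_s.+1) (M : 'M[R]_s.+1).

Lemma is_norm0 : N 0 = 0.
Proof. by rewrite -(scale0r 0) (is_normZ hN) normr0 mul0r. Qed.

Lemma is_normN x : N (- x) = N x.
Proof. by rewrite -scaleN1r (is_normZ hN) normrN1 mul1r. Qed.

Lemma is_norm_ge0 x : 0 <= N x.
Proof.
have := is_normD hN x (- x); rewrite subrr is_norm0 is_normN -mulr2n.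
by rewrite pmulrn_lge0.
Qed.

Lemma is_norm_le_sum : exists2 C, 0 <= C & forall x, N x <= C * \sum_k `|x k 0|.
Proof.
exists (\sum_k N (delta_mx k 0)) => [|x]; first by apply: sumr_ge0 => k _; exact: is_norm_ge0.
apply: (@le_trans _ _ (\sum_k `|x k 0| * N (delta_mx k 0))); last first.
  rewrite mulr_sumr; apply: ler_sum => k _; rewrite mulrC ler_wpM2r//.
  by rewrite (bigD1 k)//= lerDl sumr_ge0// => l _; exact: is_norm_ge0.
rewrite {1}(matrix_sum_delta x); elim/big_ind2 : _ => [|y a z b ya zb|k _].
- by rewrite is_norm0.
- exact: le_trans (is_normD hN _ _) (lerD ya zb).
- by rewrite big_ord1 (is_normZ hN).
Qed.

(** N is Lipschitz for the sup norm, hence attains a positive minimum on the compact sup-norm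
    sphere, and homogeneity does the rest. Transposing puts the sphere among row vectors, where
    [bounded_closed_compact] applies. *)
Lemma coord_le_is_norm : exists2 c, 0 < c & forall x k, `|x k 0| <= c * N x.
Proof.
have [C C0 NC] := is_norm_le_sum.
pose f (v : 'rV[R]_s.+1) := N v^T.
have coordl (v : 'rV[R]_s.+1) k : `|v 0 k| <= `|v|.
  by rewrite [leRHS]/Num.Def.normr/= mx_normrE; exact: (le_bigmax _ _ (0, k)).
have fB v w : `|f v - f w| <= C * s.+1%:R * `|v - w|.
  have fD v' w' : f v' - f w' <= f (v' - w').
    rewrite lerBlDr (le_trans _ (is_normD hN _ _))//.
    by rewrite /f linearB/= subrK.
  apply: (@le_trans _ _ (f (v - w))).
    rewrite ler_norml fD andbT lerNl opprB (le_trans (fD _ _))//.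
    by rewrite -opprB /f linearN/= is_normN.
  rewrite (le_trans (NC _))// -mulrA ler_wpM2l//.
  apply: (@le_trans _ _ (\sum_(k < s.+1) `|v - w|)); last first.
    by rewrite sumr_const card_ord -[leLHS]mulr_natl.
  by apply: ler_sum => k _; rewrite mxE.
pose S := [set v : 'rV[R]_s.+1 | `|v| = 1].
have cS : compact S.
  apply: bounded_closed_compact.
    by exists 1; split=> // r r1 v /= ->; exact: ltW.
  have -> : S = (fun v : 'rV[R]_s.+1 => `|v|) @^-1` [set 1] by [].
  apply: preimage_closed; last exact: closed_eq.
  by move=> v _; exact: norm_continuous.
have cf : continuous f.
  move=> v; apply/(@cvgrPdist_le _ _ _ _ (nbhs_filter v)) => e e0.
  have d0 : 0 < e / (C * s.+1%:R + 1) by rewrite divr_gt0// ltr_wpDl// mulr_ge0.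
  near=> w; rewrite (le_trans (fB _ _))//.
  apply: (@le_trans _ _ ((C * s.+1%:R + 1) * `|v - w|)).
    by rewrite ler_wpM2r// lerDl.
  rewrite -ler_pdivlMl ?ltr_wpDl ?mulr_ge0// mulrC.
  by near: w; exact: cvgr_dist_le.
have [||v0 v0S v0min] := @compact_EVT_min _ _ f S _ cS.
- exists (`|const_mx 1 : 'rV[R]_s.+1|^-1 *: const_mx 1); rewrite /S /=.
  rewrite mx_normZ normfV normr_id mulVf// normr_eq0.
  by apply/eqP => /rowP/(_ 0); rewrite !mxE => /eqP; rewrite oner_eq0.
- exact: continuous_subspaceT.
have m0 : 0 < f v0.
  rewrite lt_neqAle is_norm_ge0 andbT eq_sym; apply/eqP => /(is_norm_eq0 hN).
  move=> /(congr1 trmx); rewrite trmxK linear0 => v00.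
  by move: v0S; rewrite inE /S/= v00 normr0 => /eqP; rewrite eq_sym oner_eq0.
exists (f v0)^-1 => [|x k]; first by rewrite invr_gt0.
have [->|x0] := eqVneq x 0; first by rewrite mxE normr0 is_norm0 mulr0.
rewrite mulrC ler_pdivlMr//.
have nx : 0 < `|x^T|.
  rewrite normr_gt0; apply: contra x0 => /eqP /(congr1 trmx).
  by rewrite trmxK linear0 => ->.
have := v0min (`|x^T|^-1 *: x^T); rewrite inE /S/= mx_normZ normfV normr_id.
rewrite mulVf ?gt_eqF// => /(_ erefl).
rewrite {2}/f linearZ/= trmxK (is_normZ hN) normfV normr_id.
rewrite ler_pdivlMl// => xN; apply: le_trans xN; rewrite ler_wpM2r ?is_norm_ge0//.
by have := coordl x^T k; rewrite mxE.
Unshelve. all: by end_near. Qed.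

(** The entry is the i-th coordinate of M applied to the j-th basis vector. *)
Lemma entry_le_induced_norm : exists2 c, 0 <= c &
  forall M i j, `|M i j| <= c * induced_norm N M.
Proof.
have [C C0 NC] := is_norm_le_sum; have [c c0 Nc] := coord_le_is_norm.
pose E := \sum_j N (delta_mx j 0).
have E0 : 0 <= E by apply: sumr_ge0 => k _; exact: is_norm_ge0.
exists (c * E) => [|M i j]; first by rewrite mulr_ge0// ltW.
have NM x : N x = 1 -> N (M *m x) <= induced_norm N M.
  move=> x1; apply: ub_le_sup; last by exists x.
  (* An explicit upper bound over the unit sphere of N: [sup] dominates its set only when the set is
     bounded above. *)
  exists (C * \sum_k \sum_l `|M k l| * c) => _ [y /= y1 <-].
  rewrite (le_trans (NC _))// ler_wpM2l//; apply: ler_sum => k _.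
  rewrite mxE (le_trans (ler_norm_sum _ _ _))//; apply: ler_sum => l _.
  by rewrite normrM ler_wpM2l//; have := Nc y l; rewrite y1 mulr1.
have NMx x : N (M *m x) <= induced_norm N M * N x.
  have [->|x0] := eqVneq x 0; first by rewrite mulmx0 is_norm0 mulr0.
  have nx : 0 < N x.
    rewrite lt_neqAle is_norm_ge0 andbT eq_sym.
    by apply: contra x0 => /eqP /(is_norm_eq0 hN) ->.
  have := NM ((N x)^-1 *: x); rewrite (is_normZ hN) ger0_norm ?invr_ge0 ?(ltW nx)//.
  rewrite mulVf ?gt_eqF// => /(_ erefl); rewrite -scalemxAr (is_normZ hN).
  by rewrite ger0_norm ?invr_ge0 ?(ltW nx)// ler_pdivrMl// mulrC.
have I0 : 0 <= induced_norm N M.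
  rewrite -(@pmulr_lge0 _ (N (delta_mx j 0))) ?(le_trans _ (NMx _)) ?is_norm_ge0//.
  rewrite lt_neqAle is_norm_ge0 andbT eq_sym; apply/eqP => /(is_norm_eq0 hN).
  by move=> /matrixP/(_ j 0); rewrite !mxE !eqxx/= => /eqP; rewrite oner_eq0.
have -> : M i j = (M *m (delta_mx j 0 : 'cV_s.+1)) i 0.
  by have /matrixP/(_ i 0) := colE j M; rewrite mxE.
rewrite (le_trans (Nc _ _))// -mulrA ler_wpM2l ?(ltW c0)// (le_trans (NMx _))//.
rewrite mulrC ler_wpM2r// /E (bigD1 j)//= lerDl sumr_ge0// => l _.
exact: is_norm_ge0.
Qed.

End norms.

Lemma cvg_mx_entry {R : realType} {T : Type} {F : set_system T} {FF : Filter F}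
    (m n : nat) (f : T -> 'M[R]_(m, n)) (l : 'M[R]_(m, n)) :
  (forall i j, f x i j @[x --> F] --> l i j) -> f x @[x --> F] --> l.
Proof.
move=> fl; apply/cvgrPdist_le => e e0; near=> x.
rewrite [leLHS]/Num.Def.normr/= mx_normrE (bigmax_le _ (ltW e0))//= => i _.
rewrite !mxE; move: i; near: x; apply: filter_forall => /= i.
by have /cvgrPdist_le/(_ _ e0) := fl i.1 i.2.
Unshelve. all: by end_near. Qed.

Lemma entry_cvg {R : realType} {T : Type} {F : set_system T} {FF : Filter F}
    (m n : nat) (f : T -> 'M[R]_(m, n)) (l : 'M[R]_(m, n)) i j :
  f x @[x --> F] --> l -> f x i j @[x --> F] --> l i j.
Proof.
by move=> fl; apply: (@continuous_cvg _ _ _ _ _ f (fun M => M i j)) fl; exact: coord_continuous.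
Qed.

(** The integral of a nonnegative function is a supremum over simple functions below it, which is
    monotone in any integrand. This serves for the integrand with the norm in the hypothesis on g,
    whose measurability is not established. *)
Lemma ge0_le_integral_nonmeasurable {d} {T : measurableType d} {R : realType}
    (mu : {measure set T -> \bar R}) (D : set T) (f g : T -> \bar R) :
  (forall x, D x -> (0 <= f x)%E) -> (forall x, D x -> (f x <= g x)%E) ->
  (\int[mu]_(x in D) f x <= \int[mu]_(x in D) g x)%E.
Proof.
move=> f0 fg; rewrite !ge0_integralE//; last first.
  by move=> x Dx; apply: le_trans (fg x Dx); exact: f0.
apply: ereal_sup_le => _ [h /= hf <-]; exists h => //= x.
apply: le_trans (hf x) _; rewrite !patchE; case: ifPn => // /set_mem; exact: fg.
Qed.

(** The factor t^(al - 1) merges with the m-th power of t^al A into the exponent al m + al - 1 of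
    the fractional kernel. *)
Lemma mittag_leffler_mlmx {R : realType} (s : nat) (A : 'M[R]_s.+1) (al : R) i j t :
  0 < al -> 0 < t ->
  t `^ (al - 1) * mittag_leffler al al (t `^ al *: A) i j = mlmx A al i j t.
Proof.
move=> al0 t0; have rA := rapid_mxentry A i j.
pose L : 'M[R]_s.+1 := \matrix_(i, j) (t `^ (1 - al) * mlmx A al i j t).
have -> : mittag_leffler al al (t `^ al *: A) = L; last first.
  rewrite mxE mulrA -gt0_powRD// (_ : al - 1 + (1 - al) = 0) ?powRr0 ?mul1r//.
  by ring.
apply/cvg_lim => //; apply: cvg_mx_entry => k l.
rewrite [L k l]mxE; have := @mlker_series_cvg _ _ _ _ t al0 al0 (rapid_mxentry A k l).
move=> /(cvgM (cvg_cst (t `^ (1 - al)))); apply: cvg_trans; apply: near_eq_cvg.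
apply: nearW => n; rewrite /series/= summxE mulr_sumr; apply: eq_bigr => m _.
rewrite mxE exprZn mxE /mxentry gkE//.
move: (Gamma _) => G.
have -> : t `^ al ^+ m = t `^ (1 - al) * t `^ (al * m%:R + al - 1).
  rewrite -gt0_powRD// -powR_mulrn ?powR_ge0// -powRrM; congr (_ `^ _); ring.
ring.
Qed.

(** * Continuous and weighted functions on the half line *)

Section half_line_functions.
Context {R : realType}.
Implicit Types (f q : R -> R) (t T a : R).
Local Notation mu := (@lebesgue_measure R).
Let W1 := admissible_gk (@ltr01 R).

Lemma measurable_half_line f : {in `]0, +oo[, continuous f} ->
  measurable_fun (`]0, +oo[%classic : set R) f.
Proof.
move=> cf; apply: open_continuous_measurable_fun; first exact: interval_open.
by move=> t; rewrite inE => /cf.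
Qed.

Lemma bounded_on_segment f e T : {within `[e, T], continuous f} ->
  exists2 C, 0 <= C & forall t, e <= t <= T -> `|f t| <= C.
Proof.
move=> cf; have [eT|Te] := leP e T; last first.
  by exists 0 => // t /andP[et tT]; move: (le_trans et tT); rewrite leNgt Te.
have [|c _ cmax] := @EVT_max _ (fun t => `|f t|) e T eT.
  move=> t; apply: (@continuous_comp _ _ _ (f : subspace `[e, T] -> R)); first exact: cf.
  exact: norm_continuous.
by exists `|f c| => // t etT; apply: cmax; rewrite in_itv/=.
Qed.

(** Near 0 the limit bounds the weighted function by |l| + 1; on the remaining compact interval
    continuity does. *)
Lemma weighted_bound a f (l : R) : {in `]0, +oo[, continuous f} ->
  t `^ (1 - a) * f t @[t --> 0^'+] --> l ->
  forall T, exists2 C, 0 <= C & forall t, 0 < t <= T -> `|f t| <= C * t `^ (a - 1).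
Proof.
move=> cf fl T.
have [d d0 fd] : exists2 d, 0 < d & forall t, 0 < t < d ->
    `|t `^ (1 - a) * f t| <= `|l| + 1.
  have /cvgrPdist_le/(_ _ ltr01)[d /= d0 fd] := fl; exists d => // t /andP[t0 td].
  have := fd t; rewrite /= sub0r normrN gtr0_norm// => /(_ td t0) tl.
  by rewrite -lerBlDl (le_trans (lerB_dist _ _))// distrC.
have [|C C0 fC] := @bounded_on_segment (fun t => t `^ (1 - a) * f t) d T.
  apply: continuous_in_subspaceT => t; rewrite inE/= in_itv/= => /andP[dt _].
  have t0 := lt_le_trans d0 dt.
  by apply: cvgM; [exact: continuous_powR_gt0|apply: cf; rewrite in_itv/= t0].
exists (`|l| + 1 + C) => [|t /andP[t0 tT]]; first by rewrite !addr_ge0.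
have -> : `|f t| = `|t `^ (1 - a) * f t| * t `^ (a - 1).
  rewrite normrM ger0_norm ?powR_ge0// mulrAC -gt0_powRD// (_ : _ + _ = 0) ?powRr0 ?mul1r//.
  by ring.
rewrite ler_wpM2r ?powR_ge0//; have [dt|td] := leP d t.
  by rewrite (le_trans (fC _ _)) ?dt// lerDr addr_ge0.
by rewrite (le_trans (fd _ _)) ?t0// lerDl.
Qed.

Lemma admissible_weighted a f (l : R) : 0 < a -> {in `]0, +oo[, continuous f} ->
  t `^ (1 - a) * f t @[t --> 0^'+] --> l -> admissible f.
Proof.
move=> a0 cf fl; split; first exact: measurable_half_line.
by exists a => // T; exact: weighted_bound cf fl T.
Qed.

Lemma admissible_bounded_mul q f : measurable_fun (`]0, +oo[%classic : set R) q ->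
  (forall T, exists2 C, 0 <= C & forall t, 0 < t <= T -> `|q t| <= C) ->
  admissible f -> admissible (fun t => q t * f t).
Proof.
move=> mq qb [mf [a a0 fa]]; split; first exact: measurable_funM.
exists a => // T; have [C C0 qC] := qb T; have [D D0 fD] := fa T.
exists (C * D) => [|t tT]; first exact: mulr_ge0.
by rewrite normrM -mulrA ler_pM// ?qC// fD.
Qed.

Lemma half_line_continuous q : {within `[0, +oo[, continuous q} ->
  {in `]0, +oo[, continuous q} /\
  forall T, exists2 C, 0 <= C & forall t, 0 < t <= T -> `|q t| <= C.
Proof.
move=> cq; split=> [|T]; first by have [] := (continuous_within_itvcyP 0 q).1 cq.
have [|C C0 qC] := @bounded_on_segment q 0 T.
  apply: continuous_subspaceW cq => t /=; rewrite !in_itv/= andbT.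
  by case/andP.
by exists C => // t /andP[t0 tT]; rewrite qC// (ltW t0).
Qed.

Lemma admissible_continuous q : {within `[0, +oo[, continuous q} -> admissible q.
Proof.
move=> /half_line_continuous[cq qb].
have -> : q = (fun t => q t * cst 1 t) by apply/funext => t; rewrite mulr1.
apply: admissible_bounded_mul => //; first exact: measurable_half_line.
exact: admissible_cst.
Qed.

Lemma admissible_integrable f T : admissible f ->
  mu.-integrable `]0, T[ (EFin \o f).
Proof.
move=> Wf; apply/integrableP; split.
  apply/measurable_EFinP; apply: measurable_funS Wf.1 => //.
  by move=> t /=; rewrite !in_itv/= => /andP[->].
by rewrite -l1_integral// ltry.
Qed.

Lemma convol1B f e t : admissible f -> 0 < e -> e < t ->
  convol (gk 1) f t - convol (gk 1) f e = \int[mu]_(s in `[e, t]) f s.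
Proof.
move=> Wf e0 et; have If := admissible_integrable t Wf.
have E T : convol (gk 1) f T = \int[mu]_(s in `]0, T[) f s.
  by rewrite /Rintegral -convol1_integral.
have mt : measurable_fun (`]0, t[%classic : set R) (EFin \o f).
  by have /integrableP[] := If.
have et' : `[e, t[ `<=` `]0, t[%classic.
  by move=> x /=; rewrite !in_itv/= => /andP[ex ->]; rewrite (lt_le_trans e0).
have U : `]0, t[%classic = `]0, e[ `|` `[e, t[ :> set R.
  apply/seteqP; split=> x /=; rewrite !in_itv/=.
    by move=> /andP[-> ->]; case: (ltP x e) => xe; [left|right].
  move=> [/andP[-> xe]|/andP[ex ->]]; first exact: lt_trans et.
  by rewrite (lt_le_trans e0).
rewrite -Rintegral_itv_bndo_bndc; last exact: integrableS If.
rewrite !E U Rintegral_setU ?addrK//; last 2 first.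
- by rewrite -U.
- rewrite disj_set2E; apply/eqP/seteqP; split=> // x /=.
  by rewrite !in_itv/= => -[/andP[_ xe] /andP[ex _]]; move: xe; rewrite ltNge ex.
by rewrite addrC addKr.
Qed.

Lemma convol1_small f e : admissible f -> 0 < e ->
  exists2 d, 0 < d & forall t, 0 < t <= d -> `|convol (gk 1) f t| <= e.
Proof.
move=> Wf e0; have [_ [a a0 fa]] := Wf; have [C C0 fC] := fa 1.
have C1 : 0 < C / a + 1 by rewrite ltr_wpDl// divr_ge0// ltW.
have [d d0 dp] := powR_small (divr_gt0 e0 C1) a0.
exists (Num.min d 1) => [|t]; first by rewrite lt_min d0 ltr01.
rewrite le_min => /and3P[t0 td t1].
rewrite (le_trans (norm_convol _ _ _))//.
apply: (@le_trans _ _ (convol (gk 1) (fun s => C * pw a s) t)).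
  apply: ler_convol => //; [exact: admissible_norm|exact: admissible_norm| | |].
  - by apply: admissibleZ; exact: admissible_pw.
  - by move=> s /andP[s0 _]; rewrite gk1// normr1 ler01 lexx.
  - move=> s /andP[s0 st]; rewrite normr_ge0 pwE// fC// s0/= ltW//.
    exact: lt_le_trans t1.
have -> : (fun s => C * pw a s) = (fun s => C * Gamma a * gk a s).
  by apply/funext => s; rewrite gk.unlock -mulrA [Gamma a * _]mulrC divfK// gt_eqF// Gamma_gt0.
rewrite convolZr//; last exact: admissible_gk.
rewrite convol1_gk// gkE// addrK GammaS//.
have := dp t; rewrite t0 td => /(_ isT) /ltW; rewrite ler_pdivlMr//.
move: (Gamma a) (Gamma_gt0 a0) => G G0 H; apply: le_trans H.
have -> : C * G * (t `^ a / (a * G)) = t `^ a * (C / a) by field; rewrite !gt_eqF.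
by rewrite ler_wpM2l ?powR_ge0// lerDl.
Qed.

(** [gk (1 - b)] turns c [pw b] into the constant c Gamma(b). Near 0 the difference is thus at most
    the same convolution of (e / Gamma(b)) [pw b], which equals e. *)
Lemma convol_weighted_cvg (b : R) f (l : R) e : 0 < b -> b < 1 -> 0 < e -> admissible f ->
  t `^ (1 - b) * f t @[t --> 0^'+] --> l ->
  exists2 d, 0 < d & forall t, 0 < t < d ->
    `|convol (gk (1 - b)) f t - Gamma b * l| <= e.
Proof.
move=> b0 b1 e0 Wf fl; have b1' : 0 < 1 - b by rewrite subr_gt0.
have G0 := Gamma_gt0 b0; have Wb := admissible_pw b0.
have /cvgrPdist_le/(_ _ (divr_gt0 e0 G0))[d /= d0 fd] := fl.
have Wg := admissible_gk b1'.
have cpw c t : 0 < t -> convol (gk (1 - b)) (fun s => c * pw b s) t = c * Gamma b.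
  move=> t0; have -> : (fun s => c * pw b s) = (fun s => c * Gamma b * gk b s).
    by apply/funext => s; rewrite gk.unlock -mulrA [Gamma b * _]mulrC divfK// gt_eqF.
  by rewrite convolZr//; [rewrite convol_gk// subrK gk1// mulr1|exact: admissible_gk].
exists d => // t /andP[t0 td].
rewrite [Gamma b * l]mulrC -(cpw _ _ t0) -convolBr//; last exact: admissibleZ.
apply: le_trans (norm_convol _ _ _) _ => //.
  by apply: admissibleB => //; exact: admissibleZ.
rewrite -[leRHS](@divfK _ (Gamma b)) ?gt_eqF// -(cpw _ _ t0).
apply: ler_convol => //; do ?exact: admissible_norm; do ?exact: admissibleZ.
- by apply: admissible_norm; apply: admissibleB => //; exact: admissibleZ.
- by move=> s _; rewrite normr_ge0/= ger0_norm// gk_ge0.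
move=> s /andP[s0 st]; rewrite normr_ge0/= pwE//.
have := fd s; rewrite /= sub0r normrN gtr0_norm// => /(_ (lt_trans st td) s0).
rewrite -(ler_pM2r (powR_gt0 (b - 1) s0)).
apply: le_trans; rewrite le_eqVlt; apply/orP; left; apply/eqP.
have fE : s `^ (1 - b) * f s * s `^ (b - 1) = f s.
  rewrite mulrAC -gt0_powRD// (_ : 1 - b + (b - 1) = 0); last by ring.
  by rewrite powRr0 mul1r.
rewrite -[X in _ = _ * X]ger0_norm ?powR_ge0// -normrM mulrBl fE.
exact: distrC.
Qed.

End half_line_functions.

(** * Variation of constants *)

Section resolvent.
Context {R : realType} (s : nat) (A : 'M[R]_s.+1) (al : R).
Hypothesis al01 : 0 < al < 1.
Variables (c : 'I_s.+1 -> R) (x f : 'I_s.+1 -> R -> R).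
Hypothesis Wx : forall i, admissible (x i).
Hypothesis Wf : forall i, admissible (f i).
Hypothesis xE : forall i t, 0 < t -> convol (gk (1 - al)) (x i) t =
  c i + convol (gk 1) (fun u => \sum_l A i l * x l u + f i u) t.
Implicit Types (i k l m : 'I_s.+1) (t u : R).
Local Notation K := (mlmx A al).

Let al0 : 0 < al. Proof. by case/andP: al01. Qed.
Let W1 := admissible_gk (@ltr01 R).
Let Wal : admissible (gk (1 - al)).
Proof. by apply: admissible_gk; case/andP: al01; rewrite subr_gt0. Qed.
Let WK k i : admissible (K k i). Proof. exact: admissible_mlmx. Qed.
Let U k i := convol (gk 1) (K k i).
Let WU k i : admissible (U k i). Proof. exact: admissible_convol. Qed.
Let WAx i : admissible (fun u => \sum_l A i l * x l u).
Proof. by apply: admissible_sum => l; exact: admissibleZ. Qed.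

Let convol_suml (I : Type) (r : seq I) (F : I -> R -> R) h t :
  admissible h -> (forall j, admissible (F j)) ->
  convol (fun u => \sum_(j <- r) F j u) h t = \sum_(j <- r) convol (F j) h t.
Proof.
move=> Wh WF; rewrite convolC//; last exact: admissible_sum.
by rewrite convol_sumr//; apply: eq_bigr => j _; rewrite convolC.
Qed.

(** The convolution of E_al(t^al A) with x is computed twice; here through E_al = I + (1 * K) A. *)
Let resolvent_l k i t : convol (mlmx1 A al k i) (x i) t =
  (k == i)%:R * convol (gk 1) (x i) t + \sum_m A m i * convol (U k m) (x i) t.
Proof.
have WS : admissible (fun u => \sum_m A m i * U k m u).
  by apply: admissible_sum => m; exact: admissibleZ.
rewrite -convolZl// -(eq_bigr _ (fun m _ => convolZl (A m i) t (Wx i) (WU k m))).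
rewrite -convol_suml//; last by move=> m; exact: admissibleZ.
rewrite -convolDl//; last exact: admissibleZ.
apply: eq_convol => // u /andP[u0 _]; rewrite mlmx1E// gk1// mulr1.
by congr (_ + _); apply: eq_bigr => m _; rewrite mulrC.
Qed.

(** Second computation: E_al is K convolved with [gk (1 - al)], and associativity brings in the
    integrated equation [xE]. *)
Let resolvent_r k i t : convol (mlmx1 A al k i) (x i) t =
  c i * U k i t + (\sum_l A i l * convol (U k i) (x l) t + convol (U k i) (f i) t).
Proof.
rewrite -(eq_bigr _ (fun l _ => convolZr (A i l) t (WU k i) (Wx l))).
rewrite -convol_sumr//; last by move=> l; exact: admissibleZ.
rewrite -convolDr//.
have WH : admissible (fun u => \sum_l A i l * x l u + f i u) by exact: admissibleD.
rewrite -convol_mlmx_gk// -convolA//.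
have UE : U k i = convol (K k i) (gk 1) by apply/funext => u; rewrite /U convolC.
rewrite UE -convolA// -convolZr// -convolDr//; last 2 first.
- exact: admissibleZ.
- exact: admissible_convol.
by apply: eq_convol => // u /andP[u0 _]; rewrite xE// gk1// mulr1.
Qed.

(** When the two computations are equated and the double sum is exchanged, the terms in A x cancel,
    leaving an identity between integrals from 0 to t. *)
Lemma resolvent_formula k t : convol (gk 1) (x k) t =
  convol (gk 1) (fun u => \sum_i (c i * K k i u + convol (K k i) (f i) u)) t.
Proof.
have WKf i : admissible (convol (K k i) (f i)) by exact: admissible_convol.
rewrite convol_sumr//; last by move=> i; apply: admissibleD => //; exact: admissibleZ.
have E i : convol (gk 1) (fun u => c i * K k i u + convol (K k i) (f i) u) t =
    c i * U k i t + convol (U k i) (f i) t.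
  by rewrite convolDr ?convolZr ?convolA//; exact: admissibleZ.
rewrite (eq_bigr _ (fun i _ => E i)).
have : \sum_i convol (mlmx1 A al k i) (x i) t = \sum_i convol (mlmx1 A al k i) (x i) t by [].
rewrite {1}(eq_bigr _ (fun i _ => resolvent_l k i t)).
rewrite (eq_bigr _ (fun i _ => resolvent_r k i t)) !big_split/=.
rewrite (bigD1 k)//= eqxx mul1r big1 => [|i /negbTE ik]; last first.
  by rewrite eq_sym ik mul0r.
rewrite addr0 [X in _ + X = _]exchange_big/= addrCA [RHS in RHS = _ -> _]addrC.
by move/addrI.
Qed.

End resolvent.

(** * From the initial value problem to a Volterra equation *)

Section initial_value_problem.
Context {R : realType} (s : nat).
Implicit Types (A : 'M[R]_s.+1) (Q : R -> 'M[R]_s.+1) (g : R -> 'cV[R]_s.+1).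
Implicit Types (x : R -> 'cV[R]_s.+1) (t : R).
Local Notation mu := (@lebesgue_measure R).

Lemma within_continuous_entry (D : set R) (m n : nat) (M : R -> 'M[R]_(m, n)) i j :
  {within D, continuous M} -> {within D, continuous (fun t => M t i j)}.
Proof.
move=> cM t; apply: (@continuous_comp _ _ _ (M : subspace D -> _) (fun M => M i j)).
  exact: cM.
exact: coord_continuous.
Qed.

Lemma continuous_entry (m n : nat) (M : R -> 'M[R]_(m, n)) i j t :
  {for t, continuous M} -> {for t, continuous (fun t => M t i j)}.
Proof.
move=> cM; apply: (@continuous_comp _ _ _ M (fun M => M i j)) => //.
exact: coord_continuous.
Qed.

Lemma RL_integralE (b : R) x i t : 0 < b -> 0 < t ->
  admissible (fun u => x u i 0) ->
  RL_integral b x t i 0 = convol (gk b) (fun u => x u i 0) t.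
Proof.
move=> b0 t0 Wx; rewrite mxE convol.unlock.
have Wg := admissible_gk b0; have G0 := Gamma_gt0 b0.
pose F u := (t - u) `^ (b - 1) * x u i 0.
have mF : measurable_fun (`]0, t[%classic : set R) F.
  apply: measurable_funM; last first.
    by apply: measurable_funS Wx.1 => // u /=; rewrite !in_itv/= => /andP[->].
  apply: (measurableT_comp (f := fun u => u `^ (b - 1))) => //.
  by apply: measurable_funB.
have mF' : measurable_fun (`]0, t]%classic : set R) F.
  by apply/measurable_fun_itv_bndo_bndcP.
rewrite /Rintegral -integral_itv_obnd_cbnd; last exact/measurable_EFinP.
rewrite -integral_itv_bndo_bndc; last exact/measurable_EFinP.
have IG := convol_integrable t Wg Wx.
have -> : (\int[mu]_(u in `]0%R, t[) (F u)%:E)%E =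
  (\int[mu]_u ((Gamma b)%:E *
     (on_half_line (gk b) (t - u) * on_half_line (fun u => x u i 0) u)%:E))%E.
  rewrite integral_mkcond; apply: eq_integral => u _.
  rewrite patchE; have [u0|u0] := leP u 0.
    rewrite [on_half_line _ u]pos_le0// mulr0 mule0 memNset//= in_itv/=.
    by rewrite (ltNge 0 u) u0.
  have [tu|ut] := leP t u.
    rewrite pos_le0 ?subr_le0// mul0r mule0 memNset//= in_itv/=.
    by rewrite (ltNge u t) tu andbF.
  rewrite mem_set/= ?in_itv/= ?u0//.
  rewrite !posE ?subr_gt0// gkE ?subr_gt0// -EFinM; congr (_%:E).
  by rewrite /F mulrA [Gamma b * _]mulrC divfK// gt_eqF.
rewrite integralZl// fineM//; last exact: integrable_fin_num.
by rewrite mulKf// gt_eqF.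
Qed.

(** The equation is integrated over [e, t] only, as x may be singular at 0; the initial condition
    enters through the limit Gamma(al) x0 of the fractional integral as e tends to 0. *)
Lemma IVP_volterra (al : R) A Q g (x0 : 'cV[R]_s.+1) x i t (al01 : 0 < al < 1) :
  {within `[0, +oo[, continuous Q} -> {within `[0, +oo[, continuous g} ->
  IVP_solution al A Q g x0 x -> (forall l, admissible (fun u => x u l 0)) -> 0 < t ->
  convol (gk (1 - al)) (fun u => x u i 0) t = Gamma al * x0 i 0 +
    convol (gk 1) (fun u => \sum_l A i l * x u l 0 +
      (\sum_l Q u i l * x u l 0 + g u i 0)) t.
Proof.
case/andP: al01 => al0 al1 cQ cg [[cx _] dx xx0] Wx t0.
have al1' : 0 < 1 - al by rewrite subr_gt0.
pose h u := \sum_l A i l * x u l 0 + (\sum_l Q u i l * x u l 0 + g u i 0).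
pose J u := RL_integral (1 - al) x u i 0.
have cQl l := half_line_continuous (@within_continuous_entry _ _ _ _ i l cQ).
have cgi := half_line_continuous (@within_continuous_entry _ _ _ _ i 0 cg).
have cxl l : {in `]0, +oo[, continuous (fun u => x u l 0)}.
  by move=> u u0; apply: continuous_entry; exact: cx.
have ch : {in `]0, +oo[, continuous h}.
  move=> u u0; apply: cvgD.
    by apply: cvg_big => [|l _]; [exact: add_continuous|]; apply: cvgM; [exact: cvg_cst|exact: cxl].
  apply: cvgD; last exact: cgi.1.
  by apply: cvg_big => [|l _]; [exact: add_continuous|]; apply: cvgM; [exact: (cQl l).1|exact: cxl].
have Wh : admissible h.
  apply: admissibleD; first by apply: admissible_sum => l; exact: admissibleZ.
  apply: admissibleD.
    apply: admissible_sum => l; apply: admissible_bounded_mul => //.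
      exact: measurable_half_line (cQl l).1.
    exact: (cQl l).2.
  by apply: admissible_continuous; exact: within_continuous_entry.
have dJ u : 0 < u -> derivable J u 1 /\ 'D_1 J u = h u.
  move=> u0; have [du Du] := dx u u0; split; first exact: (derivable_mxP _ _ _).1.
  move: Du; rewrite /RL_derivative derive1E derive_mx// => /matrixP/(_ i 0).
  by rewrite !mxE -addrA.
have JB e : 0 < e -> e < t -> J t - J e = \int[mu]_(u in `[e, t]) h u.
  move=> e0 et; rewrite /Rintegral (@continuous_FTC2 _ h J)//.
  - apply: continuous_in_subspaceT => u; rewrite inE/= in_itv/= => /andP[eu _].
    by apply: ch; rewrite in_itv/= (lt_le_trans e0).
  - have cJ u : 0 < u -> {for u, continuous J}.
      by move=> u0; apply/differentiable_continuous/derivable1_diffP; have [] := dJ u u0.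
    split.
    + by move=> u; rewrite in_itv/= => /andP[eu _]; have [] := dJ u (lt_trans e0 eu).
    + by apply: cvg_at_right_filter; exact: cJ.
    + by apply: cvg_at_left_filter; exact: cJ.
  - move=> u; rewrite in_itv/= => /andP[eu _]; rewrite derive1E.
    by have [] := dJ u (lt_trans e0 eu).
have JE u : 0 < u -> J u = convol (gk (1 - al)) (fun u => x u i 0) u.
  by move=> u0; exact: RL_integralE.
have xi0 : u `^ (1 - al) * x u i 0 @[u --> 0^'+] --> x0 i 0.
  have : (u `^ (1 - al) *: x u) i 0 @[u --> 0^'+] --> x0 i 0 by exact: entry_cvg.
  by apply: cvg_trans; apply: near_eq_cvg; apply: nearW => u; rewrite mxE.
rewrite -JE// -/h; apply/eqP; rewrite -subr_eq0 -normr_le0.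
apply/ler_addgt0Pl => e e0; rewrite addr0; have e2 : 0 < e / 2 by rewrite divr_gt0.
have [d1 d10 H1] := convol1_small Wh e2.
have [d2 d20 H2] := convol_weighted_cvg al0 al1 e2 (Wx i) xi0.
pose r := Num.min d1 (Num.min (d2 / 2) (t / 2)).
have r0 : 0 < r by rewrite !lt_min d10 !divr_gt0.
have rt : r < t by rewrite !gt_min; apply/orP; right; apply/orP; right; lra.
have rd1 : r <= d1 by rewrite ge_min lexx.
have rd2 : r < d2 by rewrite !gt_min; apply/orP; right; apply/orP; left; lra.
have -> : J t - (Gamma al * x0 i 0 + convol (gk 1) h t) =
    (J r - Gamma al * x0 i 0) - convol (gk 1) h r.
  have := JB _ r0 rt; rewrite -convol1B// => /eqP; rewrite subr_eq => /eqP ->.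
  by ring.
rewrite (le_trans (ler_normB _ _))// (splitr e) lerD//.
  by rewrite JE// H2// r0.
by rewrite H1// r0.
Qed.

End initial_value_problem.

(** * Pointwise estimates from integrated identities *)

Section pointwise_bounds.
Context {R : realType}.
Implicit Types (f p q : R -> R) (t T u M B : R).
Local Notation mu := (@lebesgue_measure R).
Let W1 := admissible_gk (@ltr01 R).

Lemma convol1B_bound q B t u : admissible q -> 0 < t -> t < u ->
  (forall s, t <= s <= u -> `|q s| <= B) ->
  `|convol (gk 1) q u - convol (gk 1) q t| <= B * (u - t).
Proof.
move=> Wq t0 tu qB; rewrite convol1B//.
have tu' : `[t, u] `<=` `]0, (u + 1)[%classic.
  move=> s /=; rewrite !in_itv/= => /andP[ts su].
  by rewrite (lt_le_trans t0)// (le_lt_trans su)// ltrDl.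
have sub f : admissible f -> mu.-integrable `[t, u] (EFin \o f).
  by move=> Wf; apply: integrableS (admissible_integrable (u + 1) Wf).
apply: le_trans (le_normr_Rintegral _ (sub _ Wq)) _ => //.
apply: (@le_trans _ _ (\int[mu]_(s in `[t, u]) B)).
  apply: le_Rintegral => //.
  - exact: integrable_norm (sub _ Wq).
  - exact: sub (admissible_cst B).
have mtu : mu `[t, u] = (u - t)%:E by rewrite lebesgue_measure_itv/= lte_fin tu.
by rewrite Rintegral_cst// [X in fine X]mtu.
Qed.

(* Average over [t, t + h] and let h tend to 0. *)
Lemma le_of_convol1_eq f p M a T : a <= 1 -> 0 <= M -> admissible f -> admissible p ->
  {in `]0, +oo[, continuous f} ->
  (forall t, convol (gk 1) f t = convol (gk 1) p t) ->
  (forall t, 0 < t < T -> `|p t| <= M * t `^ (a - 1)) ->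
  forall t, 0 < t < T -> `|f t| <= M * t `^ (a - 1).
Proof.
move=> a1 M0 Wf Wp cf fp pM t /andP[t0 tT]; apply/ler_addgt0Pl => e e0.
have /cvgrPdist_le/(_ _ e0)[d /= d0 fd] : {for t, continuous f}.
  by apply: cf; rewrite in_itv/= t0.
pose h := Num.min (d / 2) ((T - t) / 2).
have h0 : 0 < h by rewrite lt_min !divr_gt0// subr_gt0.
have hd : h < d by rewrite gt_min; apply/orP; left; lra.
have hT : t + h < T by rewrite -ltrBrDl gt_min; apply/orP; right; lra.
have tth : t < t + h by rewrite ltrDl.
have Wc := admissible_cst (f t).
have Wq : admissible (fun s => f t - f s) by exact: admissibleB Wc Wf.
have cstE u : 0 < u -> convol (gk 1) (cst (f t)) u = f t * u.
  move=> u0; have -> : convol (gk 1) (cst (f t)) u = convol (gk 1) (fun s => f t * gk 1 s) u.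
    by apply: eq_convol => // s /andP[s0 _]; rewrite gk1// mulr1.
  rewrite convolZr// convol1_gk// gkE// addrK GammaS// Gamma1 mulr1 divr1 powRr1//.
  exact: ltW.
have H1 := @convol1B_bound _ e _ _ Wq t0 tth.
have H2 := @convol1B_bound _ (M * t `^ (a - 1)) _ _ Wp t0 tth.
rewrite !convolBr// !cstE ?addr_gt0// in H1.
rewrite -(ler_pM2r h0) -{1}(gtr0_norm h0) -normrM.
have -> : f t * h = (f t * (t + h) - convol (gk 1) f (t + h) -
    (f t * t - convol (gk 1) f t)) + (convol (gk 1) p (t + h) - convol (gk 1) p t).
  by rewrite !fp; ring.
rewrite (le_trans (ler_normD _ _))// mulrDl lerD//.
  apply: le_trans (H1 _) _; last by rewrite addrAC subrr add0r.
  move=> s /andP[ts sth]; apply: fd; rewrite /= distrC ger0_norm ?subr_ge0//.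
  by rewrite ltrBlDl (le_lt_trans sth)// ltrD2l.
apply: le_trans (H2 _) _; last by rewrite addrAC subrr add0r.
move=> s /andP[ts sth]; have s0 := lt_le_trans t0 ts.
rewrite (le_trans (pM _ _)) ?s0 ?(le_lt_trans sth)// ler_wpM2l//.
by apply: le0_ler_powR; rewrite ?subr_le0.
Qed.

(** The hypothesis on g bounds the norm of the whole vector integrand, so the sum over i must stay
    inside the absolute value. Moving 1 / c to the left leaves [H] alone on the right, where
    monotonicity of the integral suffices. *)
Lemma norm_sum_convol_le (I : finType) (F G : I -> R -> R) c (H : R -> R) t :
  0 < c -> (forall i, admissible (F i)) -> (forall i, admissible (G i)) ->
  (forall s, 0 <= s <= t -> 0 <= H s) ->
  (forall s, 0 < s < t -> `|\sum_i F i (t - s) * G i s| <= c * H s) ->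
  ((c^-1 * `|\sum_i convol (F i) (G i) t|)%:E <= \int[mu]_(s in `[0%R, t]) (H s)%:E)%E.
Proof.
move=> c0 WF WG H0 FGH.
pose Phi s := \sum_i on_half_line (F i) (t - s) * on_half_line (G i) s.
have IFG i : mu.-integrable setT
    (fun s => (on_half_line (F i) (t - s) * on_half_line (G i) s)%:E).
  exact: convol_integrable.
have PhiE s : (Phi s)%:E =
    (\sum_i (on_half_line (F i) (t - s) * on_half_line (G i) s)%:E)%E.
  by rewrite sumEFin.
have E : ((\sum_i convol (F i) (G i) t)%:E = \int[mu]_s (Phi s)%:E)%E.
  rewrite -sumEFin; under eq_bigr do rewrite convol_integral//.
  by rewrite -integral_sum//; apply: eq_integral => s _; rewrite PhiE.
have IPhi : mu.-integrable setT (EFin \o Phi).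
  have := @integrable_sum _ _ _ mu setT measurableT _ (index_enum I) xpredT _ (fun i _ => IFG i).
  by apply: eq_integrable => // s _ /=; rewrite PhiE.
have mPhi : measurable_fun setT (EFin \o Phi) by have /integrableP[] := IPhi.
rewrite EFinM -abse_EFin E.
apply: (@le_trans _ _ ((c^-1)%:E * \int[mu]_s `|(Phi s)%:E|)%E).
  by rewrite lee_wpmul2l ?lee_fin ?invr_ge0 ?(ltW c0)//; exact: le_abse_integral.
rewrite -ge0_integralZl_EFin ?invr_ge0 ?(ltW c0)//; last exact: measurableT_comp.
rewrite [leRHS]integral_mkcond; apply: ge0_le_integral_nonmeasurable => s _.
  by rewrite mule_ge0// lee_fin invr_ge0 ltW.
rewrite abse_EFin -EFinM patchE; case: ifPn => [/set_mem/=|]; rewrite ?in_itv/=.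
  move=> /[dup] st /andP[s0 st']; rewrite lee_fin ler_pdivrMl// /Phi.
  have [s0'|s0'] := leP s 0.
    rewrite big1 ?normr0 ?mulr_ge0 ?(ltW c0) ?H0// => i _.
    by rewrite [X in _ * X]pos_le0// mulr0.
  have [ts|ts] := leP t s.
    rewrite big1 ?normr0 ?mulr_ge0 ?(ltW c0) ?H0// => i _.
    by rewrite pos_le0 ?subr_le0// mul0r.
  apply: le_trans (FGH _ _); last by rewrite s0'.
  by under eq_bigr do rewrite !posE ?subr_gt0//.
move=> /negP nst; rewrite lee_fin /Phi big1 ?normr0 ?mulr0// => i _.
have [s0'|s0'] := leP s 0; first by rewrite [X in _ * X]pos_le0// mulr0.
rewrite pos_le0 ?mul0r// subr_le0 leNgt; apply/negP => st; apply: nst.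
by rewrite inE/= in_itv/= (ltW s0') (ltW st).
Qed.

End pointwise_bounds.

(** * A weighted a priori bound for the solution *)

Section boundedness.
Context {R : realType} (s : nat) (N : 'cV[R]_s.+1 -> R) (al : R).
Context (A : 'M[R]_s.+1) (Q : R -> 'M[R]_s.+1) (g : R -> 'cV[R]_s.+1).
Hypothesis hN : is_norm N.
Hypothesis al01 : 0 < al < 1.
Hypothesis spA : spectrum A `<=` Lambda al.
Hypothesis cQ : {within `[0, +oo[, continuous Q}.
Hypothesis Qlim : induced_norm N (Q t) @[t --> +oo] --> 0.
Hypothesis cg : {within `[0, +oo[, continuous g}.
Hypothesis gsup : (ereal_sup
  [set (t `^ (1 - al))%:E *
       \int[lebesgue_measure]_(tau in `[0%R, t])
         ((t - tau) `^ (al - 1) *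
          N (mittag_leffler al al ((t - tau) `^ al *: A) *m g tau))%:E
  | t in `]0%R, +oo[] < +oo)%E.
Implicit Types (i j k l : 'I_s.+1) (t u T : R).
Local Notation K := (mlmx A al).

Let al0 : 0 < al. Proof. by case/andP: al01. Qed.
Let al1 : al <= 1. Proof. by case/andP: al01 => _ /ltW. Qed.
Let WK k i : admissible (K k i). Proof. exact: admissible_mlmx. Qed.
Let Wg i : admissible (fun u => g u i 0).
Proof. by apply: admissible_continuous; exact: within_continuous_entry. Qed.
Let WQ i l (y : R -> R) : admissible y -> admissible (fun u => Q u i l * y u).
Proof.
have [cQl Qb] := half_line_continuous (@within_continuous_entry _ _ _ _ _ i l cQ).
by move=> Wy; apply: admissible_bounded_mul => //; exact: measurable_half_line.
Qed.

(** Here the finite supremum in the hypothesis on g becomes a real bound M, and [coord_le_is_norm]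
    passes from the norm to each coordinate. *)
Lemma forcing_bound : exists2 G, 0 <= G & forall k t, 0 < t ->
  `|\sum_i convol (K k i) (fun u => g u i 0) t| <= G * t `^ (al - 1).
Proof.
have [c c0 Nc] := coord_le_is_norm hN.
pose H t u := (t - u) `^ (al - 1) *
  N (mittag_leffler al al ((t - u) `^ al *: A) *m g u).
have [M M0 HM] : exists2 M : R, 0 <= M & forall t, 0 < t ->
    ((t `^ (1 - al))%:E * \int[lebesgue_measure]_(u in `[0%R, t]) (H t u)%:E <= M%:E)%E.
  move: gsup; set S := ereal_sup _ => Soo.
  have HS t : 0 < t ->
      ((t `^ (1 - al))%:E * \int[lebesgue_measure]_(u in `[0%R, t]) (H t u)%:E <= S)%E.
    by move=> t0; apply: ereal_sup_ubound; exists t => //=; rewrite in_itv/= t0.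
  have S0 : (0 <= S)%E.
    apply: le_trans (HS 1 ltr01); rewrite mule_ge0 ?lee_fin ?powR_ge0//.
    by apply: integral_ge0 => u _; rewrite lee_fin mulr_ge0 ?powR_ge0 ?(is_norm_ge0 hN).
  exists (fine S); first exact: fine_ge0.
  by move=> t t0; rewrite fineK ?HS// ge0_fin_numE.
exists (c * M) => [|k t t0]; first by rewrite mulr_ge0// ltW.
set v := `|_|.
have H0 u : 0 <= u <= t -> 0 <= H t u.
  by move=> _; rewrite mulr_ge0 ?powR_ge0 ?(is_norm_ge0 hN).
have KH u : 0 < u < t -> `|\sum_i K k i (t - u) * g u i 0| <= c * H t u.
  move=> /andP[u0 ut]; have tu0 : 0 < t - u by rewrite subr_gt0.
  have -> : \sum_i K k i (t - u) * g u i 0 = (t - u) `^ (al - 1) *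
      (mittag_leffler al al ((t - u) `^ al *: A) *m g u) k 0.
    rewrite mxE mulr_sumr; apply: eq_bigr => i _.
    by rewrite mulrA mittag_leffler_mlmx.
  by rewrite normrM ger0_norm ?powR_ge0// mulrCA ler_wpM2l ?powR_ge0.
have := @norm_sum_convol_le _ _ (K k) (fun i u => g u i 0) c (H t) t c0 (WK k) Wg H0 KH.
rewrite -/v => vH.
have : ((t `^ (1 - al))%:E * (c^-1 * v)%:E <= M%:E)%E.
  by apply: le_trans (HM t t0); rewrite lee_wpmul2l// lee_fin powR_ge0.
rewrite -EFinM lee_fin mulrCA ler_pdivrMl// => tv.
have -> : v = t `^ (1 - al) * v * t `^ (al - 1).
  rewrite mulrAC -gt0_powRD// (_ : 1 - al + (al - 1) = 0) ?powRr0 ?mul1r//.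
  by ring.
by rewrite ler_wpM2r ?powR_ge0.
Qed.

Lemma entries_small e : 0 < e ->
  exists2 T, 0 < T & forall t i j, T <= t -> `|Q t i j| <= e.
Proof.
move=> e0; have [c c0 Qc] := entry_le_induced_norm hN.
(* c may be 0, hence the division by c + 1. *)
have c1 : 0 < c + 1 by rewrite ltr_wpDl.
have /cvgrPdist_le/(_ _ (divr_gt0 e0 c1))[M [_ HM]] := Qlim.
exists (`|M| + 1) => [|t i j Mt]; first by rewrite ltr_wpDl.
have /HM : M < t.
  by rewrite (lt_le_trans _ Mt)// (le_lt_trans (ler_norm M))// ltrDl.
rewrite sub0r normrN ler_pdivlMr// mulrC => ce; apply: le_trans (Qc _ _ _) _; apply: le_trans ce.
apply: (@le_trans _ _ (c * `|induced_norm N (Q t)|)).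
  by rewrite ler_wpM2l// ler_norm.
by rewrite ler_wpM2r// lerDl.
Qed.

Variables (x0 : 'cV[R]_s.+1) (x : R -> 'cV[R]_s.+1).
Hypothesis solx : IVP_solution al A Q g x0 x.

Let cx i : {in `]0, +oo[, continuous (fun u => x u i 0)}.
Proof. by case: solx => -[cx _] _ _ u u0; apply: continuous_entry; exact: cx. Qed.

Let cx0 i : u `^ (1 - al) * x u i 0 @[u --> 0^'+] --> x0 i 0.
Proof.
case: solx => _ _ xx0.
have : (u `^ (1 - al) *: x u) i 0 @[u --> 0^'+] --> x0 i 0 by exact: entry_cvg.
by apply: cvg_trans; apply: near_eq_cvg; apply: nearW => u; rewrite mxE.
Qed.

Let Wx i : admissible (fun u => x u i 0).
Proof. exact: admissible_weighted al0 (@cx i) (@cx0 i). Qed.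

Let q i u := \sum_l Q u i l * x u l 0.

Let Wq i : admissible (q i).
Proof. by apply: admissible_sum => l; exact: WQ. Qed.

Let xb T : exists2 X, 0 <= X & forall l u, 0 < u <= T -> `|x u l 0| <= X * pw al u.
Proof.
have /(_ _)/cid2-/all_sig2[X X0 HX] := fun l => weighted_bound (@cx l) (@cx0 l) T.
exists (\sum_l X l) => [|l u /[dup] uT /andP[u0 _]]; first exact: sumr_ge0.
rewrite (le_trans (HX l u uT))// pwE// ler_wpM2r ?powR_ge0//.
by rewrite (bigD1 l)//= lerDl sumr_ge0.
Qed.

(** Up to T0 both Q and x have bounds independent of m and T, which go into D; past T0 the entries
    of Q are at most e, and e multiplies m. *)
Let perturbation_bound e : 0 < e -> exists2 D, 0 <= D & forall m T, 0 <= m ->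
  (forall l u, 0 < u < T -> `|x u l 0| <= m * u `^ (al - 1)) ->
  forall i u, 0 < u < T -> `|q i u| <= (D + s.+1%:R * (e * m)) * pw al u.
Proof.
move=> e0; have [T0 T00 QT0] := entries_small e0; have [X X0 HX] := xb T0.
have /(_ _)/cid2-/all_sig2[B B0 HB] := fun il : 'I_s.+1 * 'I_s.+1 =>
  (half_line_continuous (@within_continuous_entry _ _ _ _ _ il.1 il.2 cQ)).2 T0.
exists (\sum_i \sum_l B (i, l) * X).
  by apply: sumr_ge0 => i _; apply: sumr_ge0 => l _; rewrite mulr_ge0.
move=> m T m0 Hx i u uT; have [u0 _] := andP uT.
rewrite mulrDl /q (le_trans (ler_norm_sum _ _ _))//; have [uT0|T0u] := leP u T0.
  rewrite -[leLHS]addr0 lerD//; last by rewrite !mulr_ge0 ?pw_ge0 ?(ltW e0).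
  rewrite [in leRHS](bigD1 i)//= mulrDl -[leLHS]addr0 lerD//; last first.
    rewrite mulr_ge0 ?pw_ge0//; apply: sumr_ge0 => k _; apply: sumr_ge0 => l _.
    by rewrite mulr_ge0.
  rewrite mulr_suml; apply: ler_sum => l _; rewrite normrM -mulrA.
  by rewrite ler_pM// ?HX ?u0//; apply: (HB (i, l)); rewrite u0.
rewrite -[leLHS]add0r lerD//.
  rewrite mulr_ge0 ?pw_ge0//; apply: sumr_ge0 => k _; apply: sumr_ge0 => l _.
  by rewrite mulr_ge0.
apply: (@le_trans _ _ (\sum_(l < s.+1) e * m * pw al u)); last first.
  by rewrite sumr_const card_ord -[leLHS]mulr_natl mulrA.
apply: ler_sum => l _; rewrite normrM -mulrA ler_pM//; first exact/QT0/ltW.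
by rewrite pwE// Hx.
Qed.

Let psi k u := \sum_i (Gamma al * x0 i 0 * K k i u +
  convol (K k i) (fun v => q i v + g v i 0) u).

Let Wpsi k : admissible (psi k).
Proof.
apply: admissible_sum => i; apply: admissibleD; first exact: admissibleZ.
by apply: admissible_convol => //; exact: admissibleD.
Qed.

Let x_psi k t : convol (gk 1) (fun u => x u k 0) t = convol (gk 1) (psi k) t.
Proof.
apply: (@resolvent_formula _ _ A al al01 (fun i => Gamma al * x0 i 0)
  (fun i u => x u i 0) (fun i v => q i v + g v i 0)) => //.
  by move=> i; exact: admissibleD.
by move=> i u u0; exact: (IVP_volterra _ al01 cQ cg solx Wx u0).
Qed.

Let psi_bound : exists2 B, 0 <= B & forall m T, 0 <= m ->
  (forall l u, 0 < u < T -> `|x u l 0| <= m * u `^ (al - 1)) ->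
  forall k t, 0 < t < T -> `|psi k t| <= (B + m / 2) * t `^ (al - 1).
Proof.
have [C C0 KC] := mlmx_pw_bound al01 spA; have [G G0 HG] := forcing_bound.
have [C' C'0 KC'] := mlmx_weighted al01 spA.
pose n : R := s.+1%:R; have n0 : 0 < n by rewrite ltr0n.
(* With this e the coefficient n^2 e C' of m is at most 1 / 2; the added 1 covers C' = 0. *)
pose e := (2 * n * n * (C' + 1))^-1.
have C'1 : 0 < C' + 1 by rewrite ltr_wpDl.
have e0 : 0 < e by rewrite invr_gt0 !mulr_gt0.
have [D D0 HD] := perturbation_bound e0.
pose P := \sum_i `|Gamma al * x0 i 0| * C.
have P0 : 0 <= P by apply: sumr_ge0 => i _; rewrite mulr_ge0.
exists (P + G + n * (D * C')); first by rewrite !addr_ge0// !mulr_ge0// ltW.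
move=> m T m0 Hx k t /[dup] tT /andP[t0 _].
have -> : psi k t = \sum_i Gamma al * x0 i 0 * K k i t +
    \sum_i convol (K k i) (fun u => g u i 0) t + \sum_i convol (K k i) (q i) t.
  rewrite -!big_split/=; apply: eq_bigr => i _.
  by rewrite convolDr// addrAC addrA.
have nE : n * (n * (e * m)) * C' <= m / 2.
  have -> : n * (n * (e * m)) * C' = m / 2 * (C' / (C' + 1)).
    by rewrite /e; field; rewrite !gt_eqF.
  rewrite -[leRHS]mulr1 ler_wpM2l ?divr_ge0//.
  by rewrite ler_pdivrMr// mul1r lerDl.
apply: (@le_trans _ _ ((P + G + n * ((D + n * (e * m)) * C')) * t `^ (al - 1))); last first.
  rewrite ler_wpM2r ?powR_ge0// -addrA -[leRHS]addrA -addrA lerD2l lerD2l.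
  rewrite mulrDl mulrDr lerD2l (le_trans _ nE)//.
  by rewrite le_eqVlt; apply/orP; left; apply/eqP; ring.
rewrite mulrDl (le_trans (ler_normD _ _))// lerD//.
  rewrite mulrDl (le_trans (ler_normD _ _))// lerD ?HG//.
  rewrite /P mulr_suml (le_trans (ler_norm_sum _ _ _))//; apply: ler_sum => i _.
  by rewrite normrM -mulrA ler_wpM2l ?KC.
rewrite (le_trans (ler_norm_sum _ _ _))//.
apply: (@le_trans _ _ (\sum_(i < s.+1) (D + n * (e * m)) * (C' * t `^ (al - 1)))).
  apply: ler_sum => i _; rewrite (le_trans (norm_convol _ _ _))//.
  have Dm0 : 0 <= D + n * (e * m).
    by rewrite addr_ge0// !mulr_ge0// ltW.
  apply: (@le_trans _ _ ((D + n * (e * m)) * convol (fun u => `|K k i u|) (pw al) t)).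
    rewrite -convolZr//; [|exact: admissible_norm|exact: admissible_pw].
    apply: ler_convol => //; do ?exact: admissible_norm.
    - by apply: admissibleZ; exact: admissible_pw.
    - by move=> u _; rewrite normr_ge0/=.
    - move=> u /andP[u0 ut]; rewrite normr_ge0/= (HD m T)// u0/=.
      by apply: lt_trans ut _; case/andP: tT.
  by rewrite ler_wpM2l// KC'.
by rewrite sumr_const card_ord -[leLHS]mulr_natl !mulrA.
Qed.

(** For fixed T the weighted supremum S over ]0, T[ is finite by [xb], and this is what lets S <= B
    + S / 2 yield S <= 2 B, a bound free of T. *)
Lemma IVP_solution_bound : exists2 B, 0 <= B & forall k t, 0 < t ->
  `|x t k 0| <= B * t `^ (al - 1).
Proof.
have [B B0 HB] := psi_bound; exists (2 * B) => [|k0 t1 t10]; first by rewrite mulr_ge0.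
pose T := t1 + 1; have T1 : 0 < t1 < T by rewrite /T t10/= ltrDl.
pose w u k := u `^ (1 - al) * `|x u k 0|.
pose E := [set w u k | u in [set u | 0 < u < T] & k in setT].
have [X X0 HX] := xb T.
have wE u k : 0 < u -> `|x u k 0| = w u k * u `^ (al - 1).
  move=> u0; rewrite /w mulrAC -gt0_powRD// (_ : 1 - al + (al - 1) = 0) ?powRr0 ?mul1r//.
  by ring.
have w_le u k c : 0 < u -> `|x u k 0| <= c * u `^ (al - 1) -> w u k <= c.
  by move=> u0; rewrite wE// ler_pM2r// powR_gt0.
have supE : has_sup E.
  split; first by exists (w t1 k0), t1 => //; exists k0.
  exists X => _ [u /= /andP[u0 uT] [k _ <-]]; apply: w_le => //.
  by rewrite -pwE// HX// u0 ltW.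
have Sx k u : 0 < u < T -> `|x u k 0| <= sup E * u `^ (al - 1).
  move=> /[dup] uT /andP[u0 _]; rewrite wE// ler_wpM2r ?powR_ge0//.
  by apply: ub_le_sup; [case: supE|exists u => //; exists k].
have S0 : 0 <= sup E.
  have wt0 : 0 <= w t1 k0 by rewrite mulr_ge0 ?powR_ge0.
  by apply: le_trans wt0 _; apply: ub_le_sup; [case: supE|exists t1 => //; exists k0].
have S2B : sup E <= B + sup E / 2.
  apply: ge_sup; first by case: supE.
  move=> _ [u /= /[dup] uT /andP[u0 _] [k _ <-]]; apply: w_le => //.
  apply: (@le_of_convol1_eq _ (fun u => x u k 0) (psi k) (B + sup E / 2) al T) => //.
  - by rewrite addr_ge0// divr_ge0.
  - exact: HB.
have SB : sup E <= 2 * B by lra.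
by rewrite (le_trans (Sx _ _ T1))// ler_wpM2r ?powR_ge0.
Qed.

End boundedness.

(** * Decay at infinity and the two conclusions *)

Lemma powR_small_pinfty {R : realType} (p e : R) : 0 < p -> 0 < e ->
  exists2 M : R, 0 < M & forall t, M <= t -> t `^ (- p) <= e.
Proof.
move=> p0 e0; exists (e `^ (- p^-1)); first exact: powR_gt0.
move=> t Mt; have t0 : 0 < t := lt_le_trans (powR_gt0 _ e0) Mt.
have := @ge0_ler_powR _ p (ltW p0) (e `^ (- p^-1)) t.
rewrite !nnegrE powR_ge0 (ltW t0) => /(_ isT isT Mt).
rewrite -powRrM mulNr mulVf ?gt_eqF// !powRN powRr1 ?(ltW e0)// => et.
by rewrite invf_ple ?posrE// powR_gt0.
Qed.

Theorem theorem4p4 (R : realType) (s : nat) (hs : (1 <= s)%N)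
    (N : 'cV[R]_s -> R) (hN : is_norm N)
    (alpha : R) (halpha : 0 < alpha < 1)
    (A : 'M[R]_s) (hA : spectrum A `<=` Lambda alpha)
    (Q : R -> 'M[R]_s) (hQ : {within `[0, +oo[, continuous Q})
    (hQlim : induced_norm N (Q t) @[t --> +oo] --> 0)
    (g : R -> 'cV[R]_s) (hg : {within `[0, +oo[, continuous g})
    (hgsup : (ereal_sup
       [set (t `^ (1 - alpha))%:E *
            \int[lebesgue_measure]_(tau in `[0%R, t])
              ((t - tau) `^ (alpha - 1) *
               N (mittag_leffler alpha alpha ((t - tau) `^ alpha *: A)
                    *m g tau))%:E
       | t in `]0%R, +oo[] < +oo)%E) :
  (forall (x0 : 'cV[R]_s) (phi : R -> 'cV[R]_s),
     IVP_solution alpha A Q g x0 phi -> C0_weighted N alpha phi) /\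
  (forall (x0 : 'cV[R]_s) (phi : R -> 'cV[R]_s),
     IVP_solution alpha A Q g x0 phi -> phi t @[t --> +oo] --> (0 : 'cV[R]_s)).
Proof.
have [al0 al1] := andP halpha.
(* Both conclusions follow from one coordinatewise bound. The estimates are stated in dimension n +
   1, where square matrices form a ring; [hs] excludes dimension 0. *)
have bound x0 phi : IVP_solution alpha A Q g x0 phi ->
    exists2 B, 0 <= B & forall k t, 0 < t -> `|phi t k 0| <= B * t `^ (alpha - 1).
  case: s hs N hN A hA Q hQ hQlim g hg hgsup x0 phi => // n _ N' hN' A' hA' Q' hQ'.
  move=> Qlim g' cg gsup x0 phi sol.
  have := @IVP_solution_bound R n N' alpha A' Q' g' hN' halpha.
  by move=> /(_ hA' hQ' Qlim cg gsup x0 phi sol).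
split=> x0 phi sol; have [B B0 HB] := bound x0 phi sol; last first.
  apply: cvg_mx_entry => k j; rewrite mxE (ord1 j).
  apply/cvgrPdist_le => e e0; have B1 : 0 < B + 1 by rewrite ltr_wpDl.
  have p0 : 0 < 1 - alpha by rewrite subr_gt0.
  have [M M0 HM] := powR_small_pinfty p0 (divr_gt0 e0 B1).
  exists M; split=> [|t /ltW Mt]; first exact: num_real.
  rewrite sub0r normrN (le_trans (HB _ _ _)) ?(lt_le_trans M0)//.
  have := HM t Mt; rewrite opprB ler_pdivlMr// mulrC; apply: le_trans.
  by rewrite ler_wpM2r ?powR_ge0// lerDl.
split; first by case: sol.
have [C C0 NC] : exists2 C, 0 <= C & forall x, N x <= C * \sum_k `|x k 0|.
  case: s hs N hN {A hA Q hQ hQlim g hg hgsup bound phi sol x0 HB} => // n _ N' hN'.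
  exact: is_norm_le_sum.
(* The weights t^(1 - alpha) and t^(alpha - 1) cancel, so this constant bounds every element of the
   set. *)
apply: (@le_lt_trans _ _ (C * \sum_(k < s) B)%:E); last exact: ltry.
apply: ge_ereal_sup => _ [t /= + <-]; rewrite in_itv/= andbT => t0.
rewrite lee_fin (le_trans (ler_wpM2l (powR_ge0 _ _) (NC _)))//.
rewrite mulrCA ler_wpM2l// mulr_sumr; apply: ler_sum => k _.
apply: (le_trans (ler_wpM2l (powR_ge0 _ _) (HB k t t0))).
rewrite mulrCA -gt0_powRD// (_ : 1 - alpha + (alpha - 1) = 0); last by ring.
by rewrite powRr0 mulr1.
Qed.
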